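(* Let $V$ be an irreducible non-trivial GHW (generalized highest weight) Harish-Chandra module over the full toroidal Lie algebra $\tau$. Then $V\cong L(X)^B$ for some irreducible cuspidal module $X$ over $\tau_0$ and some $B\in GL(n+1,\mathbb{Z})$.
   Context: All vector spaces are over $\mathbb{C}$; $n\geqslant 1$ is an integer; $\mathbb N$ is the set of positive integers; $\mathfrak{g}$ is a finite-dimensional simple Lie algebra with a symmetric non-degenerate invariant bilinear form $(\cdot|\cdot)$. Let $A=\mathbb{C}[t_0^{\pm1},\dots,t_n^{\pm1}]$ and $t^{\underline k}=t_0^{k_0}\cdots t_n^{k_n}$ for $\underline k\in\mathbb{Z}^{n+1}$. Let $\Omega_A$ be the free $A$-module with basis $K_0,\dots,K_n$, $d:A\to\Omega_A$ the linear map $d(t^{\underline k})=\sum_i k_i t^{\underline k}K_i$, and $\mathcal{Z}=\Omega_A/dA$; the image of $t^{\underline k}K_i$ in $\mathcal Z$ is again denoted $t^{\underline k}K_i$. Let $d_i=t_i\partial/\partial t_i$ and $\mathcal{W}_{n+1}=\mathrm{span}\{t^{\underline r}d_i\}=\mathrm{Der}(A)$. Put $\phi_1(t^{\underline r}d_i,t^{\underline s}d_j)=-s_ir_j\sum_p r_pt^{\underline r+\underline s}K_p$, $\phi_2(t^{\underline r}d_i,t^{\underline s}d_j)=r_is_j\sum_p r_pt^{\underline r+\underline s}K_p$, and let $\phi$ be an arbitrary fixed linear combination of $\phi_1,\phi_2$. The full toroidal Lie algebra is $\tau=(\mathfrak g\otimes A)\oplus\mathcal Z\oplus\mathcal W_{n+1}$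 with brackets: $[x\otimes t^{\underline k},y\otimes t^{\underline l}]=[x,y]\otimes t^{\underline k+\underline l}+(x|y)\sum_i k_it^{\underline k+\underline l}K_i$; $\mathcal Z$ is abelian and commutes with $\mathfrak g\otimes A$; $[t^{\underline r}d_i,t^{\underline s}K_j]=s_it^{\underline r+\underline s}K_j+\delta_{ij}\sum_p r_pt^{\underline r+\underline s}K_p$; $[t^{\underline r}d_i,t^{\underline s}d_j]=s_it^{\underline r+\underline s}d_j-r_jt^{\underline r+\underline s}d_i+\phi(t^{\underline r}d_i,t^{\underline s}d_j)$; $[t^{\underline r}d_i,x\otimes t^{\underline s}]=s_i\,x\otimes t^{\underline r+\underline s}$. It is $\mathbb{Z}^{n+1}$-graded, $\tau_{\underline m}=\mathrm{span}\{x\otimes t^{\underline m},t^{\underline m}K_i,t^{\underline m}d_i\}$. Let $D=\mathrm{span}\{d_0,\dots,d_n\}$; $\underline m\in\mathbb{Z}^{n+1}$ is identified with the functional $d_i\mapsto m_i$ in $D^*$. For a $\tau$-module $V$ and $\mu\in D^*$ put $V_\mu=\{v:d_iv=\mu(d_i)v\ \forall i\}$. $V$ is a Harish-Chandra module if, for some $\lambda\in D^*$, $V=\bigoplus_{\underline m\in\mathbb{Z}^{n+1}}V_{\lambda+\underline m}$ with all $V_{\lambda+\underline m}$ finite-dimensional. Non-trivial means that $\tau$ does not act by zero. $V$ is a GHW module with GHW $\Lambda_0\in D^*$ if there exist a non-zero $v_{\Lambda_0}\in V_{\Lambda_0}$ and $p\in\mathbb N$ with $\tau_{\underline k}v_{\Lambda_0}=(0)$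 for all $\underline k\in\mathbb{Z}^{n+1}$ with $k_i\geqslant p$ for all $0\le i\le n$. Let $\tau_+=\bigoplus_{m_0>0}\tau_{\underline m}$, $\tau_0=\bigoplus_{m_0=0}\tau_{\underline m}$. For an irreducible $\tau_0$-module $X$, let $\tau_+$ act by zero on $X$, let $M(X)=U(\tau)\otimes_{U(\tau_0\oplus\tau_+)}X$, and let $L(X)$ be its unique irreducible quotient. A $\tau_0$-module is cuspidal if it is the direct sum of simultaneous eigenspaces of $d_1,\dots,d_n$, with weights in a single coset of $\mathbb{Z}^n$ in $\mathbb{C}^n$, of finite and uniformly bounded dimensions. For $B=(a_{ij})_{0\le i,j\le n}\in GL(n+1,\mathbb{Z})$ with inverse $(b_{ij})$, the automorphism $T_B$ of $\tau$ is $T_B(x\otimes t^{\underline m})=x\otimes t^{\underline mB^t}$, $T_B(t^{\underline m}K_j)=\sum_p a_{pj}t^{\underline mB^t}K_p$, $T_B(t^{\underline m}d_j)=\sum_p b_{jp}t^{\underline mB^t}d_p$ ($\underline m$ a row vector); $L(X)^B$ is $L(X)$ with the $\tau$-action twisted by $T_B$. *)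

(* Defs.v *)
From HB Require Import structures.
From mathcomp Require Import all_boot all_order all_algebra finmap.
From mathcomp Require Import generic_quotient ring_quotient.
From mathcomp Require Import all_classical all_reals complex.
From mathcomp Require Import ring.

Set Implicit Arguments.
Unset Strict Implicit.
Unset Printing Implicit Defensive.

Import Order.TTheory GRing.Theory Num.Theory.
Local Open Scope classical_set_scope.
Local Open Scope quotient_scope.
Local Open Scope ring_scope.

Section LinearFacts.
Variables (K : pzRingType) (V M : lmodType K) (F : V -> M).
Hypothesis Flin : linear F.
Lemma lin0 : F 0 = 0.
Proof. by have := Flin (-1) 0 0; rewrite scaler0 addr0 scaleN1r addNr. Qed.
Lemma linD u v : F (u + v) = F u + F v.
Proof. by have := Flin 1 u v; rewrite !scale1r. Qed.
Lemma linZ a u : F (a *: u) = a *: F u.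
Proof. by have := Flin a u 0; rewrite lin0 !addr0. Qed.
Lemma linN u : F (- u) = - F u.
Proof. by rewrite -!scaleN1r linZ. Qed.
Lemma linB u v : F (u - v) = F u - F v.
Proof. by rewrite linD linN. Qed.
End LinearFacts.

(** Finitely supported functions [f], read as formal sums [\sum_k f(k) t^k]; [mono k v]
    is the single term [v t^k]. *)
Section FinitelySupported.
Variables (K : pzRingType) (T : choiceType) (V : lmodType K).

Definition fin_supp : {pred T -> V} :=
  fun f => `[< finite_set [set k | f k != 0] >].

Lemma fin_supp_submod : submod_closed fin_supp.
Proof.
split=> [|a f g /asboolP ff /asboolP fg]; apply/asboolP.
  by rewrite [X in finite_set X](_ : _ = set0) // -subset0 => k /=; rewrite eqxx.
apply: (@sub_finite_set _ _ ([set k | f k != 0] `|` [set k | g k != 0])).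
  move=> k /= fgk; apply/orP; apply: contraNT fgk.
  rewrite negb_or !negbK => /andP[/eqP fk /eqP gk].
  by rewrite /GRing.add /GRing.scale /= fk gk scaler0 addr0.
by rewrite finite_setU.
Qed.

HB.instance Definition _ :=
  GRing.isSubmodClosed.Build K (T -> V) fin_supp fin_supp_submod.

Record fsfunc := FsFunc { fs_fun :> T -> V; _ : fs_fun \in fin_supp }.
#[global] Arguments fs_fun : simpl never.
HB.instance Definition _ := [isSub for fs_fun].
HB.instance Definition _ := [Choice of fsfunc by <:].
HB.instance Definition _ := [SubChoice_isSubLmodule of fsfunc by <:].

Lemma mono_subproof k v : (fun l : T => if l == k then v else 0) \in fin_supp.
Proof.
apply/asboolP; apply: (@sub_finite_set _ _ [set k]); last exact: finite_set1.
by move=> l /=; case: ifP => [/eqP //|_]; rewrite eqxx.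
Qed.

Definition mono k v : fsfunc := FsFunc (mono_subproof k v).

Lemma fs_ext (f g : fsfunc) : f =1 g -> f = g.
Proof. by move=> fg; apply/val_inj/funext. Qed.

Lemma fs0E k : fs_fun 0 k = 0. Proof. by []. Qed.
Lemma fsDE (f g : fsfunc) k : fs_fun (f + g) k = f k + g k. Proof. by []. Qed.
Lemma fsZE a (f : fsfunc) k : fs_fun (a *: f) k = a *: f k. Proof. by []. Qed.
Lemma monoE k v l : mono k v l = if l == k then v else 0. Proof. by []. Qed.

Lemma mono_linear k : linear (mono k).
Proof.
move=> a u v; apply: fs_ext => l; rewrite fsDE fsZE !monoE.
by case: ifP; rewrite // scaler0 addr0.
Qed.

Definition supp (f : fsfunc) : {fset T} := fset_set [set k | f k != 0].

Lemma supp0 (f : fsfunc) k : k \notin supp f -> f k = 0.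
Proof.
rewrite /supp in_fset_set; last exact: (asboolW (valP f)).
by rewrite notin_setE /= => /negP; rewrite negbK => /eqP.
Qed.

End FinitelySupported.
Arguments mono {K T V}.

Section LinearExtension.
Variables (K : pzRingType) (T : choiceType) (V M : lmodType K).

(** The linear extension of [t^k v |-> h k v] to finitely supported functions. *)
Definition flin (h : T -> V -> M) (f : fsfunc T V) : M :=
  \sum_(k \in [set: T]) h k (f k).

Variables (h : T -> V -> M) (hlin : forall k, linear (h k)).

Let h0 k : h k 0 = 0. Proof. exact: lin0. Qed.

Lemma flin_widen (f : fsfunc T V) (A : {fset T}) :
  (supp f `<=` A)%fset -> flin h f = \sum_(k <- A) h k (f k).
Proof.
move=> fA; apply: fsbigTE => k kA; rewrite supp0 ?h0 //.
by apply: contra kA => /(fsubsetP fA).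
Qed.

Lemma flin_linear : linear (flin h).
Proof.
move=> a f g; pose A := (supp f `|` supp g `|` supp (a *: f + g)%R)%fset.
have fA : (supp f `<=` A)%fset by rewrite /A -fsetUA fsubsetUl.
have gA : (supp g `<=` A)%fset by rewrite /A fsetUAC fsubsetUr.
have fgA : (supp (a *: f + g)%R `<=` A)%fset by rewrite fsubsetUr.
rewrite (flin_widen fA) (flin_widen gA) (flin_widen fgA).
rewrite scaler_sumr -big_split; apply: eq_bigr => k _.
by rewrite fsDE fsZE hlin.
Qed.

Lemma flin_mono k v : flin h (mono k v) = h k v.
Proof.
rewrite (@flin_widen _ (k |` supp (mono k v))%fset) ?fsubsetU1 //.
rewrite (big_fsetD1 k) ?fset1U1 //= monoE eqxx big1_fset ?addr0 // => l.
by rewrite !inE => /andP[/negPf lk _] _; rewrite monoE lk h0.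
Qed.

End LinearExtension.

Lemma flin_param (K : pzRingType) (T : choiceType) (V M : lmodType K)
    (c : K) (h h1 h2 : T -> V -> M) (f : fsfunc T V) :
  (forall k, linear (h k)) -> (forall k, linear (h1 k)) ->
  (forall k, linear (h2 k)) ->
  (forall k v, h k v = c *: h1 k v + h2 k v) ->
  flin h f = c *: flin h1 f + flin h2 f.
Proof.
move=> hl h1l h2l hE; have ff := fsubset_refl (supp f).
rewrite (flin_widen hl ff) (flin_widen h1l ff) (flin_widen h2l ff).
by rewrite scaler_sumr -big_split; apply: eq_bigr => k _; rewrite hE.
Qed.

Section FsInd.
Variables (K : pzRingType) (T : choiceType) (V : lmodType K).

Lemma fs_sumE (f : fsfunc T V) : f = \sum_(k <- supp f) mono k (f k).
Proof.
rewrite -(flin_widen (@mono_linear _ _ _)) ?fsubset_refl //.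
apply: fs_ext => l; rewrite (flin_widen (A := (l |` supp f)%fset) (@mono_linear _ _ _)).
2: exact: fsubsetU1.
have -> : forall (r : seq T),
  fs_fun (\sum_(k <- r) mono k (f k)) l = \sum_(k <- r) (if l == k then f k else 0).
  by elim=> [|k r IH]; rewrite ?big_nil // !big_cons fsDE IH.
rewrite (big_fsetD1 l) ?fset1U1 //= eqxx big1_fset ?addr0 // => k.
by rewrite !inE eq_sym => /andP[/negPf-> _] _.
Qed.

Lemma fs_ind (P : fsfunc T V -> Prop) :
  P 0 -> (forall f g, P f -> P g -> P (f + g)) -> (forall k v, P (mono k v)) ->
  forall f, P f.
Proof. by move=> P0 PD Pm f; rewrite (fs_sumE f); elim/big_ind: _. Qed.

End FsInd.

Record subspace (K : pzRingType) (V : lmodType K) := Subspace {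
  subspace_pred :> {pred V};
  subspace_closed : submod_closed subspace_pred }.

HB.instance Definition _ (K : pzRingType) (V : lmodType K) (S : subspace V) :=
  GRing.isSubmodClosed.Build K V (subspace_pred S) (subspace_closed S).

Section QuotientSpace.
Variables (K : pzRingType) (V : lmodType K) (S : subspace V).

Definition lquot := Quotient.quot S.
HB.instance Definition _ := Choice.on lquot.
HB.instance Definition _ := GRing.Zmodule.on lquot.

Definition proj (u : V) : lquot := \pi_(Quotient.quot S) u.
Definition rep (x : lquot) : V := repr (x : Quotient.quot S).

Lemma repK : cancel rep proj. Proof. exact: reprK. Qed.

Lemma proj_eq u v : (proj u == proj v) = (u - v \in S).
Proof. by rewrite (Quotient.idealrBE S). Qed.

Lemma projD u v : proj (u + v) = proj u + proj v.
Proof. exact: (raddfD \pi_(Quotient.quot S)). Qed.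

Lemma projP u v : u - v \in S -> proj u = proj v.
Proof. by rewrite -proj_eq => /eqP. Qed.

Lemma rep_proj u : rep (proj u) - u \in S.
Proof. by rewrite -proj_eq repK. Qed.

Definition lquot_scale (a : K) (x : lquot) : lquot := proj (a *: rep x).

Lemma proj_scale a u : proj (a *: u) = lquot_scale a (proj u).
Proof.
by apply: projP; rewrite -scalerBr rpredZ // -opprB rpredN rep_proj.
Qed.

Fact lquot_scaleA a b v :
  lquot_scale a (lquot_scale b v) = lquot_scale (a * b) v.
Proof.
by rewrite -[v]repK -(proj_scale b) -(proj_scale a) -(proj_scale (a * b)) scalerA.
Qed.
Fact lquot_scale1 : left_id 1 lquot_scale.
Proof. by move=> v; rewrite -[v]repK -(proj_scale 1) scale1r. Qed.
Fact lquot_scaleDr : right_distributive lquot_scale +%R.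
Proof.
move=> a u v; rewrite -[u]repK -[v]repK -projD.
by rewrite -!(proj_scale a) -projD scalerDr.
Qed.
Fact lquot_scaleDl v : {morph lquot_scale^~ v : a b / a + b}.
Proof.
move=> a b; rewrite -[v]repK -(proj_scale a) -(proj_scale b) -(proj_scale (a + b)).
by rewrite -projD scalerDl.
Qed.

HB.instance Definition _ := GRing.Zmodule_isLmodule.Build K lquot
  lquot_scaleA lquot_scale1 lquot_scaleDr lquot_scaleDl.

Lemma projZ a u : proj (a *: u) = a *: proj u.
Proof. exact: proj_scale. Qed.

Lemma proj_linear : linear proj.
Proof. by move=> a u v; rewrite projD proj_scale. Qed.

HB.instance Definition _ := GRing.isLinear.Build K V lquot _ proj proj_linear.

Lemma proj_eq0 u : (proj u == 0) = (u \in S).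
Proof. by rewrite -(linear0 proj) proj_eq subr0. Qed.

End QuotientSpace.
Arguments proj {K V} S u : simpl never.
Arguments projD {K V} S u v.
Arguments projZ {K V} S a u.
Arguments proj_linear {K V} S.

Section Span.
Variables (K : pzRingType) (V : lmodType K) (G : set V).

Definition lspan_pred : {pred V} :=
  fun v => `[< forall S : subspace V, (forall g, G g -> g \in S) -> v \in S >].

Lemma lspan_closed : submod_closed lspan_pred.
Proof.
split=> [|a u v /asboolP uG /asboolP vG]; apply/asboolP => S GS.
  exact: rpred0.
by rewrite rpredD ?rpredZ ?uG ?vG.
Qed.

Definition lspan := Subspace lspan_closed.

Lemma sub_lspan g : G g -> g \in lspan.
Proof. by move=> Gg; apply/asboolP => S; apply. Qed.

Lemma lspan_sub (S : subspace V) :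
  (forall g, G g -> g \in S) -> forall v, v \in lspan -> v \in S.
Proof. by move=> GS v /asboolP; apply. Qed.

End Span.

Section MapSpan.
Variables (K : pzRingType) (V M : lmodType K) (F : V -> M).
Hypothesis Flin : linear F.

Lemma preim_closed (S : subspace M) :
  submod_closed [pred v | F v \in (S : {pred M})].
Proof.
split=> [|a u v]; rewrite !inE ?(lin0 Flin) ?rpred0 // => uS vS.
by rewrite Flin rpredD ?rpredZ.
Qed.

Lemma lspan_map (G : set V) (S : subspace M) :
  (forall g, G g -> F g \in S) -> forall v, v \in lspan G -> F v \in S.
Proof. by move=> GS v /(lspan_sub (S := Subspace (preim_closed S))); apply. Qed.

Lemma zero_closed : submod_closed (pred1 (0 : M)).
Proof.
by split=> [|a u v]; rewrite !inE // => /eqP-> /eqP->; rewrite scaler0 addr0.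
Qed.

Lemma lspan_ker (G : set V) :
  (forall g, G g -> F g = 0) -> forall v, v \in lspan G -> F v = 0.
Proof.
move=> G0 v /(@lspan_map _ (Subspace zero_closed)) Fv; apply/eqP/Fv => g Gg.
by rewrite inE G0.
Qed.

Definition qlift (S : subspace V) (x : lquot S) : M := F (rep x).

Lemma qlift_proj (S : subspace V) :
  (forall v, v \in S -> F v = 0) -> forall v, qlift (proj S v) = F v.
Proof.
move=> FS v; rewrite /qlift.
by rewrite -[rep _](subrK v) (linD Flin) (FS _ (rep_proj _ _)) add0r.
Qed.

Lemma qlift_linear (S : subspace V) :
  (forall v, v \in S -> F v = 0) -> linear (fun x : lquot S => qlift x).
Proof.
move=> FS a x y; rewrite -[x]repK -[y]repK -linearP !(qlift_proj FS).
exact: Flin.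
Qed.

End MapSpan.
Arguments qlift {K V M} F {S} x.

HB.mixin Record isLieAlgebra (K : fieldType) L of GRing.Lmodule K L := {
  lie : L -> L -> L;
  lie_linl : forall z, linear (lie^~ z);
  lie_linr : forall z, linear (lie z);
  lie_xx : forall x, lie x x = 0;
  lie_jacobi : forall x y z,
    lie x (lie y z) + lie y (lie z x) + lie z (lie x y) = 0 }.

#[short(type="lieAlgType")]
HB.structure Definition LieAlgebra (K : fieldType) :=
  {L of isLieAlgebra K L & GRing.Lmodule K L}.

#[short(type="finLieAlgType")]
HB.structure Definition FinLieAlgebra (K : fieldType) :=
  {L of LieAlgebra K L & Vector K L}.

Lemma lieC (K : fieldType) (L : lieAlgType K) (x y : L) : lie y x = - lie x y.
Proof.
apply/eqP; rewrite -addr_eq0 addrC; apply/eqP.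
have := lie_xx (x + y); rewrite (linD (lie_linl _)) !(linD (lie_linr _)).
by rewrite !lie_xx add0r addr0.
Qed.

Record subalgebra (K : fieldType) (L : lieAlgType K) := Subalgebra {
  subalgebra_space :> subspace L;
  subalgebra_lie : {in subalgebra_space &, forall x y, lie x y \in subalgebra_space} }.

Section LieSubalgebra.
Variables (K : fieldType) (L : lieAlgType K) (S : subalgebra L).

Record sub_lie := SubLie { sub_lie_val :> L; _ : sub_lie_val \in S }.
HB.instance Definition _ := [isSub for sub_lie_val].
HB.instance Definition _ := [Choice of sub_lie by <:].
HB.instance Definition _ := [SubChoice_isSubLmodule of sub_lie by <:].

Definition sub_bracket (x y : sub_lie) : sub_lie :=
  SubLie (subalgebra_lie (valP x) (valP y)).

Fact sub_linl z : linear (sub_bracket^~ z).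
Proof. by move=> a x y; apply: val_inj; rewrite linearP /= lie_linl. Qed.
Fact sub_linr z : linear (sub_bracket z).
Proof. by move=> a x y; apply: val_inj; rewrite linearP /= lie_linr. Qed.
Fact sub_lie_xx x : sub_bracket x x = 0.
Proof. by apply: val_inj; rewrite linear0 /= lie_xx. Qed.
Fact sub_jacobi x y z : sub_bracket x (sub_bracket y z) +
  sub_bracket y (sub_bracket z x) + sub_bracket z (sub_bracket x y) = 0.
Proof. by apply: val_inj; rewrite !linearD linear0 /= lie_jacobi. Qed.

HB.instance Definition _ := isLieAlgebra.Build K sub_lie
  sub_linl sub_linr sub_lie_xx sub_jacobi.

End LieSubalgebra.

Record lieModule (K : fieldType) (L : lieAlgType K) := LieModule {
  lieModule_sort :> lmodType K;
  act : L -> lieModule_sort -> lieModule_sort;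
  act_linl : forall v, linear (act^~ v);
  act_linr : forall x, linear (act x);
  act_lie : forall x y v,
    act (lie x y) v = act x (act y v) - act y (act x v) }.

Section Modules.
Variables (K : fieldType) (L : lieAlgType K).
Implicit Types V W : lieModule L.

Definition submodule V (U : subspace V) : Prop :=
  forall x v, v \in U -> act x v \in U.

Definition irreducible V : Prop :=
  (exists v : V, v != 0) /\
  forall U : subspace V, submodule U ->
    (forall v, v \in U -> v = 0) \/ (forall v, v \in U).

Definition module_hom V W (f : V -> W) : Prop :=
  linear f /\ forall x v, f (act x v) = act x (f v).

Definition module_iso V W : Prop :=
  exists f : V -> W, module_hom f /\ bijective f.

(** [Q], with the projection [q], is the unique irreducible quotient of [M]:
    every irreducible quotient of [M] is identified with it under [M]. *)
Definition unique_irreducible_quotient (M Q : lieModule L) : Prop :=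
  irreducible Q /\
  exists q : M -> Q, [/\ module_hom q, (forall w, exists v, q v = w) &
    forall (Q' : lieModule L) (q' : M -> Q'), irreducible Q' ->
      module_hom q' -> (forall w, exists v, q' v = w) ->
      exists f : Q -> Q', [/\ module_hom f, bijective f & q' = f \o q]].

End Modules.

Section Pullback.
Variables (K : fieldType) (L L' : lieAlgType K) (f : L -> L').
Hypotheses (flin : linear f) (flie : forall x y, f (lie x y) = lie (f x) (f y)).
Variable V : lieModule L'.

Fact pullback_linl (v : V) : linear (fun x => act (f x) v).
Proof. by move=> a x y; rewrite flin act_linl. Qed.
Fact pullback_lie x y (v : V) : act (f (lie x y)) v =
  act (f x) (act (f y) v) - act (f y) (act (f x) v).
Proof. by rewrite flie act_lie. Qed.

Definition pullback : lieModule L :=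
  LieModule pullback_linl (fun x => act_linr (f x)) pullback_lie.

End Pullback.

Section Enveloping.
Variables (K : fieldType) (L : lieAlgType K).

Definition tensor_alg := fsfunc (seq L) K^o.
HB.instance Definition _ := GRing.Lmodule.on tensor_alg.
Definition word (w : seq L) : tensor_alg := mono w (1 : K^o).

(** Modulo the first family of relations the free algebra on the set [L] becomes
    the tensor algebra of the vector space [L]. *)
Inductive env_rel : tensor_alg -> Prop :=
| env_rel_lin u v a x y : env_rel
    (word (u ++ (a *: x + y) :: v) - (a *: word (u ++ x :: v) + word (u ++ y :: v)))
| env_rel_lie u v x y : env_rel
    (word (u ++ [:: x, y & v]) - word (u ++ [:: y, x & v]) - word (u ++ lie x y :: v)).

Definition word_mul (f g : tensor_alg) : tensor_alg :=
  flin (fun u a => flin (fun v b => mono (u ++ v) (a * b : K^o)) g) f.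

(** [env_rel] is stable under multiplication by words, so its span is a two-sided
    ideal, and [env_alg] is the universal enveloping algebra [U(L)]. *)
Definition env_ideal := lspan env_rel.
Definition env_alg := lquot env_ideal.
HB.instance Definition _ := GRing.Lmodule.on env_alg.

Definition env_mul (x y : env_alg) : env_alg :=
  proj env_ideal (word_mul (rep x) (rep y)).

Let inner u (a : K^o) v :
  linear (fun b : K^o => mono (u ++ v) (a * b : K^o) : tensor_alg).
Proof.
move=> c b b'; rewrite -mono_linear; congr mono.
by rewrite mulrDr -[c *: b]/(c * b) mulrCA.
Qed.

Let outer g u : linear (fun a : K^o =>
  flin (fun v b => mono (u ++ v) (a * b : K^o)) g : tensor_alg).
Proof.
move=> c a a'; apply: flin_param => [v|v|v|v b];
  [exact: inner|exact: inner|exact: inner|].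
by rewrite -mono_linear; congr mono; rewrite mulrDl -[c *: a]/(c * a) -mulrA.
Qed.

Lemma word_mul_linl g : linear (word_mul^~ g).
Proof. exact/flin_linear/outer. Qed.

Lemma word_mul_linr f : linear (word_mul f).
Proof.
move=> c g g'; apply: flin_param => [u|u|u|u a];
  [exact: outer|exact: outer|exact: outer|].
exact/flin_linear/inner.
Qed.

Lemma word_mul_mono u a v b :
  word_mul (mono u a) (mono v b) = mono (u ++ v) (a * b : K^o).
Proof.
rewrite /word_mul flin_mono; last exact: outer.
by rewrite flin_mono //; exact: inner.
Qed.

Lemma word_mul_word u v : word_mul (word u) (word v) = word (u ++ v).
Proof. by rewrite word_mul_mono mulr1. Qed.

Let wmDl f f' g : word_mul (f + f') g = word_mul f g + word_mul f' g.
Proof. exact: (linD (word_mul_linl g)). Qed.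
Let wmDr f g g' : word_mul f (g + g') = word_mul f g + word_mul f g'.
Proof. exact: (linD (word_mul_linr f)). Qed.
Let wmBl f f' g : word_mul (f - f') g = word_mul f g - word_mul f' g.
Proof. exact: (linB (word_mul_linl g)). Qed.
Let wmBr f g g' : word_mul f (g - g') = word_mul f g - word_mul f g'.
Proof. exact: (linB (word_mul_linr f)). Qed.
Let wmZl a f g : word_mul (a *: f) g = a *: word_mul f g.
Proof. exact: (linZ (word_mul_linl g)). Qed.
Let wmZr a f g : word_mul f (a *: g) = a *: word_mul f g.
Proof. exact: (linZ (word_mul_linr f)). Qed.
Let wm0l g : word_mul 0 g = 0. Proof. exact: (lin0 (word_mul_linl g)). Qed.
Let wm0r f : word_mul f 0 = 0. Proof. exact: (lin0 (word_mul_linr f)). Qed.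

Lemma word_mulA : associative word_mul.
Proof.
move=> f g h; elim/fs_ind: f => [|f f' IH IH'|u a]; first by rewrite !wm0l.
  by rewrite !wmDl IH IH'.
elim/fs_ind: g => [|g g' IH IH'|v b]; first by rewrite !(wm0r, wm0l).
  by rewrite wmDl !wmDr wmDl IH IH'.
elim/fs_ind: h => [|h h' IH IH'|w c]; first by rewrite !wm0r.
  by rewrite !wmDr IH IH'.
by rewrite !word_mul_mono catA mulrA.
Qed.

Lemma word_mul1l : left_id (word [::]) word_mul.
Proof.
elim/fs_ind => [|f f' IH IH'|u a]; rewrite ?wm0r ?wmDr ?IH ?IH' //.
by rewrite word_mul_mono mul1r.
Qed.

Lemma word_mul1r : right_id (word [::]) word_mul.
Proof.
elim/fs_ind => [|f f' IH IH'|u a]; rewrite ?wm0l ?wmDl ?IH ?IH' //.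
by rewrite word_mul_mono mulr1 cats0.
Qed.

Let monoW u (a : K^o) : mono u a = a *: word u :> tensor_alg.
Proof.
apply: fs_ext => v; rewrite fsZE !monoE; case: ifP => _; rewrite ?scaler0 //.
by rewrite -[a *: _]/(a * 1) mulr1.
Qed.

Lemma env_ideal_l f g : g \in env_ideal -> word_mul f g \in env_ideal.
Proof.
move=> gI; elim/fs_ind: f => [|f f' IH IH'|u a].
- by rewrite wm0l rpred0.
- by rewrite wmDl rpredD.
rewrite monoW wmZl rpredZ //.
move: g gI; apply: (lspan_map (word_mul_linr _)) => g [] {g} u' v.
  move=> b x y; rewrite wmBr wmDr wmZr !word_mul_word !catA.
  exact/sub_lspan/env_rel_lin.
move=> x y; rewrite !wmBr !word_mul_word !catA.
exact/sub_lspan/env_rel_lie.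
Qed.

Lemma env_ideal_r f g : f \in env_ideal -> word_mul f g \in env_ideal.
Proof.
move=> fI; elim/fs_ind: g => [|g g' IH IH'|v a].
- by rewrite wm0r rpred0.
- by rewrite wmDr rpredD.
rewrite monoW wmZr rpredZ //.
move: f fI; apply: (lspan_map (word_mul_linl _)) => f [] {f} u v'.
  move=> b x y; rewrite wmBl wmDl wmZl !word_mul_word -!catA.
  exact/sub_lspan/env_rel_lin.
move=> x y; rewrite !wmBl !word_mul_word -!catA.
exact/sub_lspan/env_rel_lie.
Qed.

Lemma env_mul_proj f g :
  env_mul (proj env_ideal f) (proj env_ideal g) = proj env_ideal (word_mul f g).
Proof.
rewrite /env_mul; set f' := rep _; set g' := rep _; apply: projP.
have -> : word_mul f' g' - word_mul f g =
  word_mul (f' - f) g' + word_mul f (g' - g) by rewrite wmBl wmBr addrA subrK.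
by apply: rpredD; [apply: env_ideal_r|apply: env_ideal_l]; exact: rep_proj.
Qed.

Fact env_mulA : associative env_mul.
Proof.
by move=> x y z; rewrite -[x]repK -[y]repK -[z]repK !env_mul_proj word_mulA.
Qed.
Fact env_mul1l : left_id (proj env_ideal (word [::])) env_mul.
Proof. by move=> x; rewrite -[x]repK env_mul_proj word_mul1l. Qed.
Fact env_mul1r : right_id (proj env_ideal (word [::])) env_mul.
Proof. by move=> x; rewrite -[x]repK env_mul_proj word_mul1r. Qed.
Fact env_mulDl : left_distributive env_mul +%R.
Proof.
move=> x y z; rewrite -[x]repK -[y]repK -[z]repK -projD !env_mul_proj wmDl.
exact: projD.
Qed.
Fact env_mulDr : right_distributive env_mul +%R.
Proof.
move=> x y z; rewrite -[x]repK -[y]repK -[z]repK -projD !env_mul_proj wmDr.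
exact: projD.
Qed.

HB.instance Definition _ := GRing.Zmodule_isPzRing.Build env_alg
  env_mulA env_mul1l env_mul1r env_mulDl env_mulDr.

Lemma env_mulE f g : (proj env_ideal f : env_alg) * (proj env_ideal g : env_alg)
  = proj env_ideal (word_mul f g).
Proof. exact: env_mul_proj. Qed.

Lemma env_scalerAl (a : K) (x y : env_alg) : a *: (x * y) = (a *: x) * y.
Proof.
by rewrite -[x]repK -[y]repK env_mulE -!projZ env_mulE wmZl.
Qed.
Lemma env_scalerAr (a : K) (x y : env_alg) : a *: (x * y) = x * (a *: y).
Proof.
by rewrite -[x]repK -[y]repK env_mulE -!projZ env_mulE wmZr.
Qed.


Definition env_inj (x : L) : env_alg := proj env_ideal (word [:: x]).

Lemma env_inj_linear : linear env_inj.
Proof.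
move=> a x y; rewrite /env_inj -proj_linear; apply: projP.
exact/sub_lspan/(env_rel_lin [::] [::]).
Qed.

Lemma env_inj_lie x y :
  env_inj (lie x y) = env_inj x * env_inj y - env_inj y * env_inj x.
Proof.
rewrite !env_mulE !word_mul_word -(linB (proj_linear _)).
by apply/esym/projP/sub_lspan/(env_rel_lie [::] [::]).
Qed.

End Enveloping.

Section Induction.
Variables (K : fieldType) (L : lieAlgType K) (S : subalgebra L).
Variable X : lieModule (sub_lie S).

Let F := fsfunc (env_alg L * X)%type K^o.
Definition pair_gen (u : env_alg L) (x : X) : F := mono (u, x) (1 : K^o).

Inductive tensor_rel : F -> Prop :=
| tensor_rel_linl a u u' x : tensor_rel
    (pair_gen (a *: u + u') x - (a *: pair_gen u x + pair_gen u' x))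
| tensor_rel_linr a u x x' : tensor_rel
    (pair_gen u (a *: x + x') - (a *: pair_gen u x + pair_gen u x'))
| tensor_rel_bal u (s : sub_lie S) x : tensor_rel
    (pair_gen (u * env_inj (val s)) x - pair_gen u (act s x)).

Definition induced_space := lquot (lspan tensor_rel).
HB.instance Definition _ := GRing.Lmodule.on induced_space.

Definition tens u x : induced_space := proj (lspan tensor_rel) (pair_gen u x).

Definition free_act (y : L) (f : F) : F :=
  flin (fun ux a => mono (env_inj y * ux.1, ux.2) a) f.

Lemma free_act_linear y : linear (free_act y).
Proof. by apply: flin_linear => ux; exact: mono_linear. Qed.

Lemma free_act_gen y u x : free_act y (pair_gen u x) = pair_gen (env_inj y * u) x.
Proof. by rewrite /free_act flin_mono //= => ux; exact: mono_linear. Qed.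

Lemma free_act_rel y f :
  f \in lspan tensor_rel -> free_act y f \in lspan tensor_rel.
Proof.
have al := free_act_linear y.
move: f; apply: (lspan_map al) => f [] {f}.
- move=> a u u' x; rewrite (linB al) al !free_act_gen mulrDr -env_scalerAr.
  exact/sub_lspan/tensor_rel_linl.
- move=> a u x x'; rewrite (linB al) al !free_act_gen.
  exact/sub_lspan/tensor_rel_linr.
move=> u s x; rewrite (linB al) !free_act_gen mulrA.
exact/sub_lspan/tensor_rel_bal.
Qed.

Let G y f : induced_space := proj (lspan tensor_rel) (free_act y f).

Let Glin y : linear (G y).
Proof. by move=> a f g; rewrite /G free_act_linear proj_linear. Qed.

Let Gker y f : f \in lspan tensor_rel -> G y f = 0.
Proof. by move=> fR; apply/eqP; rewrite proj_eq0 free_act_rel. Qed.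

Definition induced_act (y : L) : induced_space -> induced_space :=
  fun v => qlift (G y) v.

Lemma induced_act_linear y : linear (induced_act y).
Proof. exact: (qlift_linear (Glin y) (Gker y)). Qed.

Lemma induced_act_tens y u x :
  induced_act y (tens u x) = tens (env_inj y * u) x.
Proof.
by rewrite /induced_act (qlift_proj (Glin y) (Gker y)) /G free_act_gen.
Qed.

Lemma tens_linl x : linear (tens^~ x).
Proof.
move=> a u u'; rewrite /tens -(proj_linear (lspan tensor_rel)).
exact/projP/sub_lspan/tensor_rel_linl.
Qed.

Lemma tens_linr u : linear (tens u).
Proof.
move=> a x x'; rewrite /tens -(proj_linear (lspan tensor_rel)).
exact/projP/sub_lspan/tensor_rel_linr.
Qed.

Lemma tens_bal u (s : sub_lie S) x : tens (u * env_inj (val s)) x = tens u (act s x).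
Proof. exact/projP/sub_lspan/tensor_rel_bal. Qed.

Lemma induced_ind (P : induced_space -> Prop) :
  P 0 -> (forall v w, P v -> P w -> P (v + w)) -> (forall u x, P (tens u x)) ->
  forall v, P v.
Proof.
move=> P0 PD Pt v; rewrite -[v]repK; elim/fs_ind: (rep v) => [|f g|[u x] a].
- by rewrite (lin0 (proj_linear _)).
- by rewrite projD; exact: PD.
have -> : mono (u, x) a = a *: pair_gen u x.
  apply: fs_ext => l; rewrite fsZE !monoE; case: ifP => _; rewrite ?scaler0 //.
  by rewrite -[a *: _]/(a * 1) mulr1.
rewrite projZ -[proj _ _]/(tens u x) -(linZ (tens_linl x)); exact: Pt.
Qed.

Fact induced_linl v : linear (induced_act^~ v).
Proof.
move=> a y z; elim/induced_ind: v => [|v w IHv IHw|u x].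
- by rewrite !(lin0 (induced_act_linear _)) scaler0 addr0.
- by rewrite !(linD (induced_act_linear _)) IHv IHw scalerDr addrACA.
rewrite !induced_act_tens env_inj_linear mulrDl -env_scalerAl.
exact: tens_linl.
Qed.

Fact induced_act_lie y z v : induced_act (lie y z) v =
  induced_act y (induced_act z v) - induced_act z (induced_act y v).
Proof.
elim/induced_ind: v => [|v w IHv IHw|u x].
- by rewrite !(lin0 (induced_act_linear _)) subr0.
- by rewrite !(linD (induced_act_linear _)) IHv IHw opprD addrACA.
by rewrite !induced_act_tens env_inj_lie mulrBl !mulrA (linB (tens_linl x)).
Qed.

(** [U(L) (x)_{U(S)} X]; it suffices to balance over [S], which generates [U(S)]. *)
Definition induced : lieModule L :=
  LieModule induced_linl induced_act_linear induced_act_lie.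

End Induction.

Record invForm (K : fieldType) (g : lieAlgType K) := InvForm {
  form :> g -> g -> K;
  form_linl : forall y, linear (form^~ y : g -> K^o);
  form_sym : forall x y, form x y = form y x;
  form_inv : forall x y z, form (lie x y) z = form x (lie y z);
  form_nondeg : forall x, (forall y, form x y = 0) -> x = 0 }.

Definition simple_lie (K : fieldType) (g : lieAlgType K) : Prop :=
  (exists x y : g, lie x y != 0) /\
  forall U : subspace g, (forall x y, y \in U -> lie x y \in U) ->
    (forall x, x \in U -> x = 0) \/ (forall x, x \in U).

Section Toroidal.
Variables (K : numFieldType) (n : nat) (g : finLieAlgType K) (kappa : invForm g).
Variables c1 c2 : K.

Local Notation Zn := 'rV[int]_n.+1.
Local Notation rv := 'rV[K]_n.+1.

Definition zvec (m : Zn) : rv := map_mx intr m.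

Definition dot (u v : rv) : K := \sum_i u 0 i * v 0 i.

(** Homogeneous components of [(g (x) A) (+) Omega_A (+) W_{n+1}]: in degree [m],
    [(x, w, u)] stands for
    [x (x) t^m + \sum_i w_i t^m K_i + \sum_i u_i t^m d_i]. *)
Definition piece : Type := (g * rv * rv)%type.
HB.instance Definition _ := GRing.Lmodule.on piece.

(** The bracket of the elements denoted by [a] in degree [k] and [b] in degree [l];
    see [tx_tx], [tK_tx], [tK_tK], [td_tx], [td_tK] and [td_td] for its values on
    the spanning elements.  The last two lines of the [K]-component are
    [phi = c1 phi_1 + c2 phi_2]. *)
Definition hom_bracket (k : rv) (a : piece) (l : rv) (b : piece) : piece :=
  let: (x, w, u) := a in
  let: (y, z, v) := b in
  ( lie x y + dot u l *: y - dot v k *: x,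
    kappa x y *: k
      + (dot u l *: z + dot u z *: k) - (dot v k *: w + dot v w *: l)
      + c1 *: - ((dot u l * dot v k) *: k)
      + c2 *: ((dot u k * dot v l) *: k),
    dot u l *: v - dot v k *: u ).

(** [(g (x) A) (+) Omega_A (+) W_{n+1}], to be divided by [dA]; the bracket below
    is a Lie bracket only modulo [dA]. *)
Definition cover := fsfunc Zn piece.
HB.instance Definition _ := GRing.Lmodule.on cover.

Definition cover_bracket (f h : cover) : cover :=
  flin (fun k a =>
    flin (fun l b => mono (k + l) (hom_bracket (zvec k) a (zvec l) b)) h) f.

Definition Kpart (w : rv) : piece := (0, w, 0).

Definition diff : fsfunc Zn K^o -> cover :=
  flin (fun k (c : K^o) => mono k (Kpart ((c : K) *: zvec k))).

Definition exact_pred : {pred cover} := fun f => `[< exists p, diff p = f >].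

Lemma dotDl u u' v : dot (u + u') v = dot u v + dot u' v.
Proof. by rewrite -big_split; apply: eq_bigr => i _; rewrite mxE mulrDl. Qed.
Lemma dotDr u v v' : dot u (v + v') = dot u v + dot u v'.
Proof. by rewrite -big_split; apply: eq_bigr => i _; rewrite mxE mulrDr. Qed.
Lemma dotZl c u v : dot (c *: u) v = c * dot u v.
Proof. by rewrite /dot mulr_sumr; apply: eq_bigr => i _; rewrite mxE mulrA. Qed.
Lemma dotZr c u v : dot u (c *: v) = c * dot u v.
Proof. by rewrite /dot mulr_sumr; apply: eq_bigr => i _; rewrite mxE mulrCA. Qed.
Lemma dotNl u v : dot (- u) v = - dot u v.
Proof. by rewrite -scaleN1r dotZl mulN1r. Qed.
Lemma dotNr u v : dot u (- v) = - dot u v.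
Proof. by rewrite -scaleN1r dotZr mulN1r. Qed.
Lemma dot0l v : dot 0 v = 0.
Proof. by rewrite -(scale0r 0) dotZl mul0r. Qed.
Lemma dot0r v : dot v 0 = 0.
Proof. by rewrite -(scale0r 0) dotZr mul0r. Qed.
Let dotE := (dotDl, dotDr, dotNl, dotNr, dotZl, dotZr).

Lemma zvecD k l : zvec (k + l) = zvec k + zvec l.
Proof. exact: map_mxD. Qed.

Lemma form_linr x : linear (kappa x : g -> K^o).
Proof. by move=> a y z; rewrite /= !(form_sym _ x) form_linl. Qed.

Lemma piece_eq (a b : piece) :
  (forall f : {scalar g}, f a.1.1 = f b.1.1) ->
  (forall j, a.1.2 0 j = b.1.2 0 j) -> (forall j, a.2 0 j = b.2 0 j) -> a = b.
Proof.
case: a b => [[x w] u] [[y z] v] /= xy wz uv; congr (_, _, _).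
- have c i : coord (vbasis fullv) i x = coord (vbasis fullv) i y.
    exact: (xy (coord (vbasis fullv) i)).
  rewrite (coord_vbasis (memvf x)) (coord_vbasis (memvf y)).
  by apply: eq_bigr => i _; rewrite c.
- by apply/rowP.
- by apply/rowP.
Qed.

Let fDl x x' y : kappa (x + x') y = kappa x y + kappa x' y.
Proof. exact: (linD (form_linl kappa y)). Qed.
Let fZl c x y : kappa (c *: x) y = c * kappa x y.
Proof. exact: (linZ (form_linl kappa y)). Qed.
Let fNl x y : kappa (- x) y = - kappa x y.
Proof. exact: (linN (form_linl kappa y)). Qed.
Let fDr x x' y : kappa y (x + x') = kappa y x + kappa y x'.
Proof. exact: (linD (form_linr y)). Qed.
Let fZr c x y : kappa y (c *: x) = c * kappa y x.
Proof. exact: (linZ (form_linr y)). Qed.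
Let fNr x y : kappa y (- x) = - kappa y x.
Proof. exact: (linN (form_linr y)). Qed.
Let fE := (fDl, fDr, fNl, fNr, fZl, fZr).
Let lDl (x x' y : g) : lie (x + x') y = lie x y + lie x' y.
Proof. exact: (linD (lie_linl y)). Qed.
Let lZl c (x y : g) : lie (c *: x) y = c *: lie x y.
Proof. exact: (linZ (lie_linl y)). Qed.
Let lNl (x y : g) : lie (- x) y = - lie x y.
Proof. exact: (linN (lie_linl y)). Qed.
Let lDr (x x' y : g) : lie y (x + x') = lie y x + lie y x'.
Proof. exact: (linD (lie_linr y)). Qed.
Let lZr c (x y : g) : lie y (c *: x) = c *: lie y x.
Proof. exact: (linZ (lie_linr y)). Qed.
Let lNr (x y : g) : lie y (- x) = - lie y x.
Proof. exact: (linN (lie_linr y)). Qed.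
Let lE := (lDl, lDr, lNl, lNr, lZl, lZr).

Lemma hom_bracket_linl k l b : linear (fun a => hom_bracket k a l b).
Proof.
case: b => [[y z] v] c [[x w] u] [[x' w'] u'].
apply: piece_eq => [f|j|j] /=; rewrite ?lE ?fE ?dotE.
- rewrite !(linearD, linearN, linearZ) /=; ring.
- rewrite !mxE; ring.
- rewrite !mxE; ring.
Qed.

Lemma hom_bracket_linr k a l : linear (hom_bracket k a l).
Proof.
case: a => [[x w] u] c [[y z] v] [[y' z'] v'].
apply: piece_eq => [f|j|j] /=; rewrite ?lE ?fE ?dotE.
- rewrite !(linearD, linearN, linearZ) /=; ring.
- rewrite !mxE; ring.
- rewrite !mxE; ring.
Qed.

Lemma hom_bracket_skew k a l b : exists c : K,
  hom_bracket k a l b + hom_bracket l b k a = Kpart (c *: (k + l)).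
Proof.
case: a b => [[x w] u] [[y z] v].
exists (kappa x y - c1 * (dot u l * dot v k) + c2 * (dot u k * dot v l)).
apply: piece_eq => [f|j|j] /=; rewrite ?(lieC x y) ?(form_sym _ y x).
- rewrite !(linear0, linearD, linearN, linearZ) /=; ring.
- rewrite !mxE; ring.
- rewrite !mxE; ring.
Qed.

Lemma hom_bracket_jacobi k a l b m c : exists d : K,
  hom_bracket k a (l + m) (hom_bracket l b m c) +
  hom_bracket l b (m + k) (hom_bracket m c k a) +
  hom_bracket m c (k + l) (hom_bracket k a l b) = Kpart (d *: (k + l + m)).
Proof.
case: a b c => [[x w] u] [[y z] v] [[x' w'] t].
exists (kappa x (lie y x') + dot u l * kappa y x' + dot v m * kappa x' x
   + dot t k * kappa x y
   + c1 * (- (dot t l * dot u l * dot v m) - dot t k * dot u l * dot v m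
      - dot t k * dot u m * dot v m + dot t l * dot u m * dot v k
      - dot t k * dot u l * dot v k)
   + c2 * (dot t m * dot u l * dot v l + dot t m * dot u k * dot v m
      + dot t k * dot u k * dot v l)).
have f1 : kappa y (lie x' x) = kappa x (lie y x').
  by rewrite -form_inv form_sym.
have f2 : kappa x' (lie x y) = kappa x (lie y x').
  by rewrite form_sym form_inv.
apply: piece_eq => [f|j|j] /=; rewrite ?lE ?fE ?f1 ?f2 ?dotE.
- have := congr1 f (lie_jacobi x y x').
  rewrite !(linear0, linearD, linearN, linearZ) /=.
  rewrite (lieC x x') (lieC y x) (lieC x' y) !(linearN) /= => J.
  rewrite -[RHS]J; ring.
- rewrite !mxE (form_sym _ x' y) (form_sym _ y x) (form_sym _ x x'); ring.
- rewrite !mxE; ring.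
Qed.

Let inner k a l :
  linear (fun b => mono (k + l) (hom_bracket (zvec k) a (zvec l) b) : cover).
Proof. by move=> c b b'; rewrite hom_bracket_linr mono_linear. Qed.

Let outer (h : cover) k : linear (fun a =>
  flin (fun l b => mono (k + l) (hom_bracket (zvec k) a (zvec l) b)) h : cover).
Proof.
move=> c a a'; apply: flin_param => [l|l|l|l b];
  [exact: inner|exact: inner|exact: inner|].
by rewrite hom_bracket_linl mono_linear.
Qed.

Lemma cover_bracket_linl h : linear (cover_bracket^~ h).
Proof. exact/flin_linear/outer. Qed.

Lemma cover_bracket_linr f : linear (cover_bracket f).
Proof.
move=> c h h'; apply: flin_param => [k|k|k|k a];
  [exact: outer|exact: outer|exact: outer|].
exact/flin_linear/inner.
Qed.

Lemma cover_bracket_mono k a l b : cover_bracket (mono k a) (mono l b) =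
  mono (k + l) (hom_bracket (zvec k) a (zvec l) b).
Proof.
rewrite /cover_bracket flin_mono; last exact: outer.
by rewrite flin_mono //; exact: inner.
Qed.

Lemma Kpart_linear : linear Kpart.
Proof.
move=> c v w; apply: piece_eq => [f|j|j] //=.
  by rewrite scaler0 addr0.
by rewrite scaler0 addr0.
Qed.

Let diff_inner k : linear (fun c : K^o => mono k (Kpart ((c : K) *: zvec k))).
Proof.
move=> c a b; rewrite -mono_linear -Kpart_linear; congr (mono _ (Kpart _)).
by rewrite scalerDl scalerA.
Qed.

Lemma diff_linear : linear diff.
Proof. exact/flin_linear/diff_inner. Qed.

Lemma exact_closed : submod_closed exact_pred.
Proof.
split=> [|a u v /asboolP[p pu] /asboolP[q qv]]; apply/asboolP.
  by exists 0; rewrite (lin0 diff_linear).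
by exists (a *: p + q); rewrite diff_linear pu qv.
Qed.

Definition exact_forms : subspace cover := Subspace exact_closed.

(** The carrier ignores [kappa], [c1], [c2], but the Lie structure inferred from
    it does not. *)
#[using="kappa c1 c2"]
Definition tau : Type := lquot exact_forms.
HB.instance Definition _ := GRing.Lmodule.on tau.

Definition tau_bracket (x y : tau) : tau :=
  proj exact_forms (cover_bracket (rep x) (rep y)).

Lemma diff_mono k (c : K) :
  diff (mono k (c : K^o)) = mono k (Kpart (c *: zvec k)).
Proof. by rewrite /diff flin_mono //; exact: diff_inner. Qed.

Lemma exact_mono k (c : K) : mono k (Kpart (c *: zvec k)) \in exact_forms.
Proof. by apply/asboolP; exists (mono k (c : K^o)); rewrite diff_mono. Qed.

Lemma exact_ind (S : subspace cover) :
  (forall k (c : K), mono k (Kpart (c *: zvec k)) \in S) ->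
  forall f, f \in exact_forms -> f \in S.
Proof.
move=> Sm f /asboolP[p <-]; elim/fs_ind: p => [|p q IHp IHq|k c].
- by rewrite (lin0 diff_linear) rpred0.
- by rewrite (linD diff_linear) rpredD.
by rewrite diff_mono Sm.
Qed.

Lemma exact_l f h : h \in exact_forms -> cover_bracket f h \in exact_forms.
Proof.
move=> hE; elim/fs_ind: f => [|f f' IH IH'|k a].
- by rewrite (lin0 (cover_bracket_linl _)) rpred0.
- by rewrite (linD (cover_bracket_linl _)) rpredD.
move: h hE; apply: (exact_ind
  (S := Subspace (preim_closed (cover_bracket_linr (mono k a)) exact_forms))).
move=> l c; rewrite -[_ \in _]/(cover_bracket (mono k a) _ \in exact_forms).
rewrite cover_bracket_mono.
have -> : hom_bracket (zvec k) a (zvec l) (Kpart (c *: zvec l)) =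
  Kpart ((c * dot a.2 (zvec l)) *: zvec (k + l)).
  case: a => [[x w] u]; rewrite zvecD.
  apply: piece_eq => [f|j|j] /=;
    rewrite ?(lin0 (lie_linr _)) ?(lin0 (form_linr _)) ?dot0l ?dotE.
  - rewrite !(linear0, linearD, linearN, linearZ) /=; ring.
  - rewrite !mxE; ring.
  - rewrite !mxE; ring.
exact: exact_mono.
Qed.

Lemma cover_skew f h : cover_bracket f h + cover_bracket h f \in exact_forms.
Proof.
elim/fs_ind: f => [|f f' IH IH'|k a].
- by rewrite (lin0 (cover_bracket_linl _)) (lin0 (cover_bracket_linr _)) addr0 rpred0.
- rewrite (linD (cover_bracket_linl _)) (linD (cover_bracket_linr _)) addrACA.
  by rewrite rpredD.
elim/fs_ind: h => [|h h' IH IH'|l b].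
- by rewrite (lin0 (cover_bracket_linl _)) (lin0 (cover_bracket_linr _)) addr0 rpred0.
- rewrite (linD (cover_bracket_linl _)) (linD (cover_bracket_linr _)) addrACA.
  by rewrite rpredD.
rewrite !cover_bracket_mono [l + k]addrC -(linD (mono_linear _)).
have [c ->] := hom_bracket_skew (zvec k) a (zvec l) b.
by rewrite -zvecD exact_mono.
Qed.

Lemma exact_r f h : f \in exact_forms -> cover_bracket f h \in exact_forms.
Proof.
move=> fex; rewrite -[cover_bracket f h](addrK (cover_bracket h f)).
by rewrite rpredB ?cover_skew ?exact_l.
Qed.

Lemma tau_bracket_proj f h :
  tau_bracket (proj exact_forms f) (proj exact_forms h) =
  proj exact_forms (cover_bracket f h).
Proof.
rewrite /tau_bracket; set f' := rep _; set h' := rep _; apply: projP.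
have -> : cover_bracket f' h' - cover_bracket f h =
    cover_bracket (f' - f) h' + cover_bracket f (h' - h).
  by rewrite (linB (cover_bracket_linl _)) (linB (cover_bracket_linr _)) addrA subrK.
by apply: rpredD; [apply: exact_r|apply: exact_l]; exact: rep_proj.
Qed.

Fact tau_linl z : linear (tau_bracket^~ z).
Proof.
move=> a x y; rewrite -[x]repK -[y]repK -[z]repK -(proj_linear exact_forms).
by rewrite !tau_bracket_proj cover_bracket_linl proj_linear.
Qed.

Fact tau_linr z : linear (tau_bracket z).
Proof.
move=> a x y; rewrite -[x]repK -[y]repK -[z]repK -(proj_linear exact_forms).
by rewrite !tau_bracket_proj cover_bracket_linr proj_linear.
Qed.

Fact tau_xx x : tau_bracket x x = 0.
Proof.
rewrite -[x]repK tau_bracket_proj; apply/eqP; rewrite proj_eq0.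
have := cover_skew (rep x) (rep x); rewrite -mulr2n -scaler_nat.
move=> /(rpredZ (2%:R^-1 : K)); rewrite scalerA mulVf ?scale1r //.
by rewrite pnatr_eq0.
Qed.

Definition tmono (k : Zn) (a : piece) : tau := proj exact_forms (mono k a).

Lemma tmono_linear k : linear (tmono k).
Proof. by move=> c a b; rewrite /tmono mono_linear proj_linear. Qed.

Lemma tmono_bracket k a l b : tau_bracket (tmono k a) (tmono l b) =
  tmono (k + l) (hom_bracket (zvec k) a (zvec l) b).
Proof. by rewrite tau_bracket_proj cover_bracket_mono. Qed.

Lemma tmono_exact k (c : K) : tmono k (Kpart (c *: zvec k)) = 0.
Proof. by apply/eqP; rewrite proj_eq0 exact_mono. Qed.

Lemma tau_ind (P : tau -> Prop) :
  P 0 -> (forall x y, P x -> P y -> P (x + y)) -> (forall k a, P (tmono k a)) ->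
  forall x, P x.
Proof.
move=> P0 PD Pm x; rewrite -[x]repK; elim/fs_ind: (rep x) => [|f h|k a].
- by rewrite (lin0 (proj_linear _)).
- by rewrite projD; exact: PD.
exact: Pm.
Qed.

Fact tau_jacobi x y z : tau_bracket x (tau_bracket y z) +
  tau_bracket y (tau_bracket z x) + tau_bracket z (tau_bracket x y) = 0.
Proof.
have Dl u u' v : tau_bracket (u + u') v = tau_bracket u v + tau_bracket u' v.
  exact: (linD (tau_linl v)).
have Dr u u' v : tau_bracket v (u + u') = tau_bracket v u + tau_bracket v u'.
  exact: (linD (tau_linr v)).
have z0l v : tau_bracket 0 v = 0 := lin0 (tau_linl v).
have z0r v : tau_bracket v 0 = 0 := lin0 (tau_linr v).
have D3 (a b c a' b' c' : tau) : a + b + c = 0 -> a' + b' + c' = 0 ->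
    (a + a') + (b + b') + (c + c') = 0.
  by move=> h h'; rewrite (addrACA a) (addrACA (a + b)) h h' addr0.
elim/tau_ind: x => [|x x' IH IH'|k a]; first by rewrite !(z0l, z0r) !addr0.
  by rewrite !(Dl, Dr); exact: D3.
elim/tau_ind: y => [|y y' IH IH'|l b]; first by rewrite !(z0l, z0r) !addr0.
  by rewrite !(Dl, Dr); exact: D3.
elim/tau_ind: z => [|z z' IH IH'|m c]; first by rewrite !(z0l, z0r) !addr0.
  by rewrite !(Dl, Dr); exact: D3.
rewrite !tmono_bracket !zvecD.
have -> : l + (m + k) = k + (l + m) by rewrite addrA addrC.
have -> : m + (k + l) = k + (l + m) by rewrite addrC -addrA.
rewrite -!(linD (tmono_linear _)).
have [d ->] := hom_bracket_jacobi (zvec k) a (zvec l) b (zvec m) c.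
by rewrite -!zvecD -addrA tmono_exact.
Qed.

HB.instance Definition _ := isLieAlgebra.Build K tau
  tau_linl tau_linr tau_xx tau_jacobi.

Definition tx (x : g) (k : Zn) : tau := tmono k (x, 0, 0).
Definition tK (k : Zn) (i : 'I_n.+1) : tau := tmono k (0, delta_mx 0 i, 0).
Definition td (k : Zn) (i : 'I_n.+1) : tau := tmono k (0, 0, delta_mx 0 i).

Lemma td_sum k (u : rv) : \sum_i u 0 i *: td k i = tmono k (0, 0, u).
Proof.
rewrite {2}[u]row_sum_delta.
have dl : linear (fun u : rv => tmono k ((0, 0, u) : piece)).
  move=> c v w; rewrite -tmono_linear; congr tmono.
  by apply: piece_eq => [f|j|j] //=; rewrite scaler0 addr0.
rewrite (big_morph (fun u : rv => tmono k ((0, 0, u) : piece)) (linD dl) (lin0 dl)).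
by apply: eq_bigr => i _; rewrite -(linZ dl).
Qed.

Lemma tK_sum k (w : rv) : \sum_i w 0 i *: tK k i = tmono k (Kpart w).
Proof.
rewrite {2}[w]row_sum_delta.
have KD u v : Kpart (u + v) = Kpart u + Kpart v := linD Kpart_linear u v.
have tD u v : tmono k (u + v) = tmono k u + tmono k v := linD (tmono_linear k) u v.
rewrite (big_morph Kpart KD (lin0 Kpart_linear)).
rewrite (big_morph (tmono k) tD (lin0 (tmono_linear k))).
apply: eq_bigr => i _.
by rewrite -(linZ (tmono_linear k)) -(linZ Kpart_linear).
Qed.

Lemma dot_delta i (v : rv) : dot (delta_mx 0 i) v = v 0 i.
Proof.
rewrite /dot (bigD1 i) //= big1 => [|j ji]; rewrite mxE.
  by rewrite !eqxx mul1r addr0.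
by rewrite eqxx (negPf ji) mul0r.
Qed.

Section BracketFormulas.
Implicit Types (k l r s : Zn) (i j p : 'I_n.+1) (x y : g).

Lemma tK_exact k : \sum_i (k 0 i)%:~R *: tK k i = 0.
Proof.
rewrite -[RHS](tmono_exact k 1) scale1r -tK_sum.
by apply: eq_bigr => i _; rewrite mxE.
Qed.

Let sumK k m : \sum_i (k 0 i)%:~R *: tK m i = tmono m (Kpart (zvec k)).
Proof. by rewrite -tK_sum; apply: eq_bigr => i _; rewrite mxE. Qed.

Lemma lie_mono k a l b : lie (tmono k a) (tmono l b) =
  tmono (k + l) (hom_bracket (zvec k) a (zvec l) b).
Proof. exact: tmono_bracket. Qed.

Let zvecE k i : zvec k 0 i = (k 0 i)%:~R. Proof. by rewrite mxE. Qed.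
Let l0l (x : g) : lie 0 x = 0. Proof. exact: (lin0 (lie_linl x)). Qed.
Let l0r (x : g) : lie x 0 = 0. Proof. exact: (lin0 (lie_linr x)). Qed.
Let f0l x : kappa 0 x = 0. Proof. exact: (lin0 (form_linl kappa x)). Qed.
Let f0r x : kappa x 0 = 0. Proof. exact: (lin0 (form_linr x)). Qed.
Let simp0 := (l0l, l0r, f0l, f0r, dot0l, dot0r, dot_delta, zvecE).

Lemma tx_tx x y k l : lie (tx x k) (tx y l) = tx (lie x y) (k + l) +
  kappa x y *: \sum_i (k 0 i)%:~R *: tK (k + l) i.
Proof.
have tl := tmono_linear (k + l).
rewrite sumK lie_mono -(linZ tl) -(linD tl); congr tmono.
apply: piece_eq => [f|p|p] /=; rewrite ?simp0.
- rewrite !(linear0, linearD, linearN, linearZ) /=; ring.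
- rewrite !mxE; ring.
- rewrite !mxE; ring.
Qed.

Lemma tK_tx k i x l : lie (tK k i) (tx x l) = 0.
Proof.
rewrite lie_mono -(lin0 (tmono_linear (k + l))); congr tmono.
apply: piece_eq => [f|p|p] /=; rewrite ?simp0.
- rewrite !(linear0, linearD, linearN, linearZ) /=; ring.
- rewrite !mxE; ring.
- rewrite !mxE; ring.
Qed.

Lemma tK_tK k i l j : lie (tK k i) (tK l j) = 0.
Proof.
rewrite lie_mono -(lin0 (tmono_linear (k + l))); congr tmono.
apply: piece_eq => [f|p|p] /=; rewrite ?simp0.
- rewrite !(linear0, linearD, linearN, linearZ) /=; ring.
- rewrite !mxE; ring.
- rewrite !mxE; ring.
Qed.

Lemma td_tx r i x s : lie (td r i) (tx x s) = (s 0 i)%:~R *: tx x (r + s).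
Proof.
have tl := tmono_linear (r + s).
rewrite lie_mono -(linZ tl); congr tmono.
apply: piece_eq => [f|p|p] /=; rewrite ?simp0.
- rewrite !(linear0, linearD, linearN, linearZ) /=; ring.
- rewrite !mxE; ring.
- rewrite !mxE; ring.
Qed.

Lemma td_tK r i s j : lie (td r i) (tK s j) = (s 0 i)%:~R *: tK (r + s) j +
  (i == j)%:R *: \sum_p (r 0 p)%:~R *: tK (r + s) p.
Proof.
have tl := tmono_linear (r + s).
rewrite sumK lie_mono -!(linZ tl) -(linD tl); congr tmono.
apply: piece_eq => [f|p|p] /=; rewrite ?simp0.
- rewrite !(linear0, linearD, linearN, linearZ) /=; ring.
- rewrite !mxE eqxx /=; ring.
- rewrite !mxE; ring.
Qed.

Lemma td_td r i s j : lie (td r i) (td s j) =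
  (s 0 i)%:~R *: td (r + s) j - (r 0 j)%:~R *: td (r + s) i
  + (c1 *: (- ((s 0 i)%:~R * (r 0 j)%:~R) *:
               \sum_p (r 0 p)%:~R *: tK (r + s) p)
     + c2 *: (((r 0 i)%:~R * (s 0 j)%:~R) *:
               \sum_p (r 0 p)%:~R *: tK (r + s) p)).
Proof.
have tl := tmono_linear (r + s).
rewrite sumK lie_mono -!(linZ tl) -(linB tl) -!(linD tl); congr tmono.
apply: piece_eq => [f|p|p] /=; rewrite ?simp0.
- rewrite !(linear0, linearD, linearN, linearZ) /=; ring.
- rewrite !mxE; ring.
- rewrite !mxE; ring.
Qed.

End BracketFormulas.

Definition tau_deg (m : Zn) (y : tau) : Prop := exists a, y = tmono m a.

(** [\bigoplus_(P m) tau_m] *)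
Definition tau_on (P : pred Zn) : subspace tau :=
  lspan (fun y => exists2 m, P m & tau_deg m y).

Lemma tau_on_lie (P : pred Zn) : (forall k l, P k -> P l -> P (k + l)) ->
  {in tau_on P &, forall x y, lie x y \in tau_on P}.
Proof.
move=> PD x y xP yP; move: x xP; apply: (lspan_map (lie_linl y)).
move=> _ [k Pk [a ->]]; move: y yP; apply: (lspan_map (lie_linr _)).
move=> _ [l Pl [b ->]]; apply: sub_lspan; exists (k + l); first exact: PD.
by exists (hom_bracket (zvec k) a (zvec l) b); exact: tmono_bracket.
Qed.

(** [tau_on deg0] is [tau_0] and [tau_on deg_ge0] is [tau_0 (+) tau_+]. *)
Definition deg0 : pred Zn := fun m => m 0 ord0 == 0.
Definition deg_ge0 : pred Zn := fun m => 0 <= m 0 ord0.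

Lemma deg0D k l : deg0 k -> deg0 l -> deg0 (k + l).
Proof. by rewrite /deg0 mxE => /eqP-> /eqP->. Qed.
Lemma deg_ge0D k l : deg_ge0 k -> deg_ge0 l -> deg_ge0 (k + l).
Proof. by rewrite /deg_ge0 mxE; exact: addr_ge0. Qed.

Definition sub0 : subalgebra tau := Subalgebra (tau_on_lie deg0D).
Definition sub_ge0 : subalgebra tau := Subalgebra (tau_on_lie deg_ge0D).

Definition tau0 := sub_lie sub0.
HB.instance Definition _ := LieAlgebra.on tau0.
Definition tau_ge0 := sub_lie sub_ge0.
HB.instance Definition _ := LieAlgebra.on tau_ge0.

Lemma td0_subproof (i : 'I_n) : td 0 (lift ord0 i) \in sub0.
Proof.
apply: sub_lspan; exists 0; first by rewrite /deg0 mxE.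
by exists (0, 0, delta_mx 0 (lift ord0 i)).
Qed.
Definition td0 (i : 'I_n) : tau0 := SubLie (td0_subproof i).

(** The projection of [tau] onto [tau_0] along the other homogeneous components. *)
Let cut (f : cover) : tau :=
  proj exact_forms (flin (fun k a => if deg0 k then mono k a else 0) f).
Let cut_inner k : linear (fun a : piece => if deg0 k then mono k a : cover else 0).
Proof. by case: (deg0 k) => [|a b c]; [exact: mono_linear|rewrite scaler0 addr0]. Qed.
Let cut_linear : linear cut.
Proof.
by move=> a f h; rewrite /cut (flin_linear cut_inner) (proj_linear exact_forms).
Qed.
Let cut_ker f : f \in exact_forms -> cut f = 0.
Proof.
move=> /(exact_ind
  (S := Subspace (preim_closed cut_linear (Subspace (@zero_closed _ _))))).
move=> H; apply/eqP; apply: H => k c; apply/eqP.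
rewrite /cut flin_mono; last exact: cut_inner.
by case: ifP => _; [exact: tmono_exact|exact: lin0 (proj_linear _)].
Qed.

Definition trunc : tau -> tau := fun y => qlift cut y.

Lemma trunc_linear : linear trunc.
Proof. exact: qlift_linear. Qed.

Lemma trunc_mono k a : trunc (tmono k a) = if deg0 k then tmono k a else 0.
Proof.
rewrite /trunc qlift_proj // /cut flin_mono; last exact: cut_inner.
by case: ifP => _ //; exact: lin0 (proj_linear _).
Qed.

Lemma trunc_sub y : trunc y \in sub0.
Proof.
elim/tau_ind: y => [|x y IHx IHy|k a].
- by rewrite (lin0 trunc_linear) rpred0.
- by rewrite (linD trunc_linear) rpredD.
rewrite trunc_mono; case: ifP => [k0|_]; last exact: rpred0.
by apply: sub_lspan; exists k => //; exists a.
Qed.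

Lemma trunc_lie : {in sub_ge0 &, forall x y,
  trunc (lie x y) = lie (trunc x) (trunc y)}.
Proof.
move=> x y xP yP; apply/eqP; rewrite -subr_eq0; apply/eqP; move: x xP.
have tl := trunc_linear.
apply: lspan_ker => [a u v|_ [k k0 [a ->]]].
  by rewrite lie_linl !tl lie_linl scalerBr opprD addrACA.
move: y yP; apply: lspan_ker => [c u v|_ [l l0 [b ->]]].
  by rewrite lie_linr !tl lie_linr scalerBr opprD addrACA.
have kl : deg0 (k + l) = deg0 k && deg0 l by rewrite /deg0 mxE paddr_eq0.
rewrite lie_mono !trunc_mono kl.
case: (deg0 k) => /=; last by rewrite (lin0 (lie_linl _)) subrr.
by case: (deg0 l); rewrite ?lie_mono ?(lin0 (lie_linr _)) subrr.
Qed.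

Definition trunc0 (y : tau_ge0) : tau0 := SubLie (trunc_sub (val y)).

Fact trunc0_linear : linear trunc0.
Proof.
move=> a x y; apply: val_inj; rewrite [RHS]linearP; exact: trunc_linear.
Qed.
Fact trunc0_lie x y : trunc0 (lie x y) = lie (trunc0 x) (trunc0 y).
Proof. by apply: val_inj; exact: trunc_lie (valP x) (valP y). Qed.

(** [X] as a [tau_0 (+) tau_+]-module on which [tau_+] acts by zero. *)
Definition inflate (X : lieModule tau0) : lieModule tau_ge0 :=
  pullback trunc0_linear trunc0_lie X.

(** [M(X)] *)
Definition verma (X : lieModule tau0) : lieModule tau := induced (inflate X).

Section Twist.
Variables (B : 'M[int]_n.+1) (Bunit : B \in unitmx).

Definition zmx (A : 'M[int]_n.+1) : 'M[K]_n.+1 := map_mx intr A.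

Definition twist_piece (a : piece) : piece :=
  let: (x, w, u) := a in (x, w *m (zmx B)^T, u *m zmx (invmx B)).

Definition cover_twist : cover -> cover :=
  flin (fun m a => mono (m *m B^T) (twist_piece a)).

(** [T_B] *)
Definition twist (y : tau) : tau :=
  qlift (fun f => proj exact_forms (cover_twist f)) y.

Lemma twist_piece_linear : linear twist_piece.
Proof.
move=> c [[x w] u] [[y z] v]; rewrite /twist_piece /=.
by rewrite !mulmxDl -!scalemxAl.
Qed.

Let twist_inner m :
  linear (fun a => mono (m *m B^T) (twist_piece a) : cover).
Proof. by move=> c a b; rewrite twist_piece_linear mono_linear. Qed.

Lemma twist_subproof : linear (fun f => proj exact_forms (cover_twist f)).
Proof.
by move=> c f h; rewrite /cover_twist (flin_linear twist_inner) proj_linear.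
Qed.

Lemma zvec_twist m : zvec (m *m B^T) = zvec m *m (zmx B)^T.
Proof. by rewrite /zvec /zmx map_mxM map_trmx. Qed.

Lemma twist_ker f : f \in exact_forms -> proj exact_forms (cover_twist f) = 0.
Proof.
move=> /(exact_ind
  (S := Subspace (preim_closed twist_subproof (Subspace (@zero_closed _ _))))).
move=> H; apply/eqP; apply: H => k c; apply/eqP.
rewrite /cover_twist flin_mono; last exact: twist_inner.
rewrite -[RHS](tmono_exact (k *m B^T) c) zvec_twist /tmono /Kpart /=.
by rewrite mul0mx scalemxAl.
Qed.

Lemma twist_linear : linear twist.
Proof. exact: (qlift_linear twist_subproof twist_ker). Qed.

Lemma twist_mono m a : twist (tmono m a) = tmono (m *m B^T) (twist_piece a).
Proof.
rewrite /twist (qlift_proj twist_subproof twist_ker).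
by rewrite /cover_twist flin_mono //; exact: twist_inner.
Qed.

Lemma twist_tx x m : twist (tx x m) = tx x (m *m B^T).
Proof. by rewrite twist_mono /= !mul0mx. Qed.

Lemma twist_tK m j :
  twist (tK m j) = \sum_p (B p j)%:~R *: tK (m *m B^T) p.
Proof.
transitivity (\sum_p (row j (zmx B)^T) 0 p *: tK (m *m B^T) p).
  by rewrite twist_mono /= mul0mx -rowE tK_sum.
by apply: eq_bigr => p _; rewrite !mxE.
Qed.

Lemma twist_td m j :
  twist (td m j) = \sum_p (invmx B j p)%:~R *: td (m *m B^T) p.
Proof.
transitivity (\sum_p (row j (zmx (invmx B))) 0 p *: td (m *m B^T) p).
  by rewrite twist_mono /= mul0mx -rowE td_sum.
by apply: eq_bigr => p _; rewrite !mxE.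
Qed.

Lemma dot_twist u v : dot (u *m zmx (invmx B)) (v *m (zmx B)^T) = dot u v.
Proof.
have dotM (a b : rv) : dot a b = (a *m b^T) 0 0.
  by rewrite mxE; apply: eq_bigr => i _; rewrite mxE.
rewrite !dotM trmx_mul trmxK mulmxA -(mulmxA u) /zmx -map_mxM mulVmx //.
by rewrite map_mx1 mulmx1.
Qed.

Lemma twist_lie x y : twist (lie x y) = lie (twist x) (twist y).
Proof.
have tl := twist_linear.
elim/tau_ind: x => [|x x' IH IH'|k a].
- by rewrite (lin0 tl) !(lin0 (lie_linl _)) (lin0 tl).
- by rewrite (linD tl) !(linD (lie_linl _)) (linD tl) IH IH'.
elim/tau_ind: y => [|y y' IH IH'|l b].
- by rewrite (lin0 tl) !(lin0 (lie_linr _)) (lin0 tl).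
- by rewrite (linD tl) !(linD (lie_linr _)) (linD tl) IH IH'.
rewrite lie_mono !twist_mono lie_mono mulmxDl; congr tmono.
case: a b => [[x w] u] [[y z] v]; rewrite !zvec_twist.
apply: piece_eq => [f|j|j] /=; rewrite !dot_twist //.
  by rewrite !(mulmxDl, mulmxBl, mulNmx, =^~ scalemxAl).
by rewrite !(mulmxDl, mulmxBl, mulNmx, =^~ scalemxAl).
Qed.

(** [V^B]: the element [y] acts on it as [T_B y] acts on [V]. *)
Definition twist_module (V : lieModule tau) : lieModule tau :=
  pullback twist_linear twist_lie V.

End Twist.

End Toroidal.

Definition is_direct_sum (K : pzRingType) (I : choiceType) (V : lmodType K)
    (U : I -> V -> Prop) : Prop :=
  forall v, exists! f : fsfunc I V,
    (forall i, U i (f i)) /\ v = \sum_(i \in [set: I]) f i.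

Definition dim_le (K : pzRingType) (V : lmodType K) (U : V -> Prop) (N : nat) : Prop :=
  exists s : 'I_N -> V, (forall i, U (s i)) /\
    forall v, U v -> exists c : 'I_N -> K, v = \sum_i c i *: s i.

Section ToroidalModules.
Variables (K : numFieldType) (n : nat) (g : finLieAlgType K) (kappa : invForm g).
Variables c1 c2 : K.

Local Notation tau := (tau n kappa c1 c2).
Local Notation tau0 := (tau0 n kappa c1 c2).

Definition nontrivial (V : lieModule tau) : Prop :=
  exists (x : tau) (v : V), act x v != 0.

(** [mu : 'rV_n.+1] is the functional [d_i |-> mu_i] on [D]. *)
Definition weight_space (V : lieModule tau) (mu : 'rV[K]_n.+1) (v : V) : Prop :=
  forall i, act (td kappa c1 c2 0 i) v = mu 0 i *: v.

Definition harish_chandra (V : lieModule tau) : Prop :=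
  exists lam : 'rV[K]_n.+1,
    is_direct_sum (fun m : 'rV[int]_n.+1 => @weight_space V (lam + zvec K m)) /\
    forall m : 'rV[int]_n.+1, exists N, dim_le (@weight_space V (lam + zvec K m)) N.

Definition has_GHW (V : lieModule tau) (Lam : 'rV[K]_n.+1) : Prop :=
  exists (v : V) (p : nat), [/\ v != 0, weight_space Lam v, (0 < p)%N &
    forall k : 'rV[int]_n.+1, (forall i, p%:Z <= k 0 i) ->
      forall x : tau, tau_deg k x -> act x v = 0].

Definition GHW_module (V : lieModule tau) : Prop := exists Lam, has_GHW V Lam.

Definition weight_space0 (X : lieModule tau0) (mu : 'rV[K]_n) (x : X) : Prop :=
  forall i, act (td0 kappa c1 c2 i) x = mu 0 i *: x.

Definition cuspidal (X : lieModule tau0) : Prop :=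
  exists lam : 'rV[K]_n,
    is_direct_sum (fun m : 'rV[int]_n => @weight_space0 X (lam + map_mx intr m)) /\
    exists N, forall m : 'rV[int]_n,
      dim_le (@weight_space0 X (lam + map_mx intr m)) N.

(** [L] is [L(X)]. *)
Definition is_L (X : lieModule tau0) (L : lieModule tau) : Prop :=
  unique_irreducible_quotient (verma X) L.

End ToroidalModules.

(* Main.v *)
Require Import Defs.
From HB Require Import structures.
From mathcomp Require Import all_boot all_order all_algebra finmap.
From mathcomp Require Import all_classical all_reals complex.
From mathcomp Require Import zify ring.

(** Only one feature of the bracket matters for most of the proof: the degrees [k] and
    [l] bracket onto the whole degree [k + l] as soon as [k <> l] ([bracket_full]).
    Hence the degrees killing a vector are closed under sums of distinct elements,
    and a nonzero vector of [V] is not killed by all degrees.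

    Call a degree [p] positive if every vector is killed by [x p + q] for every [q] and
    all large [x].  By irreducibility one nonzero vector decides, so the generalized
    highest weight condition makes all degrees with positive coordinates positive.  If
    [p] is positive, then [- p] kills no nonzero vector, so the support of [V] is stable
    under subtracting [p]; since weight spaces are finite-dimensional, the support is
    bounded in the direction [p] ([supp_bounded]).  These two facts force the positive
    degrees to be the strict part of a total preorder ([positive_compl]).

    The preorder could still be that of a half-space with irrational boundary, or be
    lexicographic.  To exclude this, take a vector [w] on top of a line in direction
    [k].  For [u] orthogonal to [k], but not to the weight, the products
    [t^(-ak) d_u t^(-(X-a)k) d_u w] are independent, so a weight space at distance [X]
    below the top has dimension at least about [X / 2].  Thus the support reaches at
    most [2 dim V_s + 2] steps above [s] in every positive direction that is not
    parallel to the weight; the other directions are dealt with by moving [s], and the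
    bound is uniform over all positive directions ([supp_uniform_bound]).  It follows
    that the positive degrees are those with [b . k > 0] for a primitive integral
    covector [b] ([half_space]), and that some nonzero weight vector is killed by all
    of them ([exists_top_vector]).

    Complete [b] to a unimodular matrix and twist, so that [b . k] becomes [k_0].  Then
    some nonzero vector is killed by [tau_+], and [X] is taken to be the space of such
    vectors of its [d_0]-eigenvalue.  The module consists of [X] and of lower
    [d_0]-eigenspaces, which gives the irreducibility of [X] and identifies the module
    with [L(X)] ([top_irreducible], [top_is_L]).  Finally [X] is cuspidal: a nonzero
    vector of [X] is not killed by a degree [(-1, r)], since this degree and [tau_+]
    generate [tau]; choosing [r] so that the images land in one fixed weight space of
    the module bounds the dimensions uniformly ([top_cuspidal]). *)

Set Implicit Arguments.
Unset Strict Implicit.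
Unset Printing Implicit Defensive.
Import Order.TTheory GRing.Theory Num.Theory.
Local Open Scope ring_scope.

(** * Linear independence and module actions *)

Section Independence.
Variables (K : fieldType) (V : lmodType K).
Implicit Types (U : subspace V) (t : nat -> V).

(** Families are indexed by all of [nat], with only the first [r] members in play, so
    that appending a vector does not change the type. *)
Definition indep (r : nat) t : Prop :=
  forall c : nat -> K, \sum_(i < r) c i *: t i = 0 ->
  forall i, (i < r)%N -> c i = 0.

Lemma indep_snoc U r t u : (forall i, (i < r)%N -> t i \in U) -> u \notin U ->
  indep r t -> indep r.+1 (fun i => if (i < r)%N then t i else u).
Proof.
move=> tU uU it c; rewrite big_ord_recr /= ltnn.
have -> : \sum_(i < r) c i *: (if (i < r)%N then t i else u) =
          \sum_(i < r) c i *: t i by apply: eq_bigr => i _; rewrite ltn_ord.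
move=> c0; have cr : c r = 0.
  apply/eqP; apply: contraNT uU => cr.
  have -> : u = - (c r)^-1 *: \sum_(i < r) c i *: t i.
    rewrite -[in RHS](addrK (c r *: u) (\sum_(i < r) _)) c0 sub0r.
    by rewrite scalerN scaleNr opprK scalerA mulVf ?scale1r.
  by rewrite rpredZ ?rpred_sum // => i _; rewrite rpredZ ?tU.
move: c0; rewrite cr scale0r addr0 => /it c0 i.
by rewrite ltnS leq_eqVlt => /orP[/eqP-> //|/c0].
Qed.

(** Jointly injective linear maps [T_j : U -> W], all with values in the span of the
    same [D] vectors, embed [U] into a product of [C] copies of that span. *)
Lemma indep_le (W : lmodType K) (C D : nat) (T : 'I_C -> V -> W) (w : 'I_D -> W) U :
  (forall j, linear (T j)) ->
  (forall j u, u \in U -> exists c : 'I_D -> K, T j u = \sum_i c i *: w i) ->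
  (forall u, u \in U -> (forall j, T j u = 0) -> u = 0) ->
  forall r t, (forall i, (i < r)%N -> t i \in U) -> indep r t -> (r <= C * D)%N.
Proof.
move=> Tl Tw T0 r t tU it.
have /choice[a aE] (x : 'I_C * 'I_r) : exists c : 'I_D -> K,
    T x.1 (t x.2) = \sum_i c i *: w i by apply: Tw; exact: tU.
rewrite leqNgt; apply/negP => CDr.
pose A := \matrix_(i < r, j < #|{: 'I_C * 'I_D}|)
  a ((enum_val j).1, i) (enum_val j).2.
have : ~~ row_free A.
  rewrite -row_leq_rank -ltnNge; apply: leq_ltn_trans (rank_leq_col A) _.
  by rewrite card_prod !card_ord.
rewrite -kermx_eq0 => /rowV0Pn[c /sub_kermxP cA /rV0Pn[i ci]].
pose c' k := if insub k is Some j then c 0 j else 0.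
have c'E (j : 'I_r) : c' j = c 0 j by rewrite /c' valK.
suff /it/(_ i (ltn_ord i)) : \sum_(i < r) c' i *: t i = 0.
  by move=> /eqP; rewrite c'E (negPf ci).
apply: T0 => [|j].
  by rewrite rpred_sum // => k _; rewrite rpredZ ?tU.
rewrite (big_morph _ (linD (Tl j)) (lin0 (Tl j))).
transitivity (\sum_(k < D) (\sum_(i < r) c 0 i * a (j, i) k) *: w k).
  under [RHS]eq_bigr do rewrite scaler_suml.
  rewrite exchange_big; apply: eq_bigr => k _; rewrite c'E (linZ (Tl j)).
  by rewrite (aE (j, k)) scaler_sumr; apply: eq_bigr => l _; rewrite scalerA.
apply: big1 => k _; move/matrixP: cA => /(_ 0 (enum_rank (j, k))).
rewrite !mxE; under eq_bigr do rewrite mxE enum_rankK.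
by move=> ->; rewrite scale0r.
Qed.

Lemma dim_le_indep U D : dim_le (fun v => v \in U) D ->
  forall r t, (forall i, (i < r)%N -> t i \in U) -> indep r t -> (r <= D)%N.
Proof.
move=> [w [wU wE]] r t tU it; rewrite -[D]mul1n.
apply: (@indep_le V 1 D (fun _ => id) w U) tU it.
- by [].
- by move=> j u uU; exact: wE.
- by move=> u _ /(_ ord0).
Qed.

Lemma span_closed r t : submod_closed
  [pred v | `[< exists c : nat -> K, v = \sum_(i < r) c i *: t i >]].
Proof.
split=> [|a u v /asboolP[c ->] /asboolP[d ->]]; apply/asboolP.
  by exists (fun=> 0); rewrite big1 // => i _; rewrite scale0r.
exists (fun i => a * c i + d i); rewrite scaler_sumr -big_split.
by apply: eq_bigr => i _; rewrite scalerA scalerDl.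
Qed.

(** A maximal independent family of [U] spans; it is padded with zeros because
    [dim_le] asks for exactly [M] vectors. *)
Lemma indep_dim_le U M :
  (forall r t, (forall i, (i < r)%N -> t i \in U) -> indep r t -> (r <= M)%N) ->
  dim_le (fun v => v \in U) M.
Proof.
move=> UM; pose Q r := `[< exists t, (forall i, (i < r)%N -> t i \in U) /\ indep r t >].
have Q0 : exists r, Q r by exists 0%N; apply/asboolP; exists (fun=> 0).
have QM r : Q r -> (r <= M)%N by move=> /asboolP[t [tU it]]; exact: UM it.
case: (ex_maxnP Q0 QM) => r /asboolP[t [tU it]] rmax.
have rM := UM _ _ tU it.
exists (fun i : 'I_M => if (i < r)%N then t i else 0); split.
  by move=> i; case: ifP => [/tU//|_]; rewrite rpred0.
move=> v vU; have [] := boolP (v \in Subspace (span_closed r t)).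
  move=> /asboolP[c ->]; exists (fun i => c i).
  rewrite (big_ord_widen_cond M predT (fun i => c i *: t i)) // big_mkcond /=.
  by apply: eq_bigr => i _; case: ifP => // _; rewrite scaler0.
move=> vt; have : Q r.+1.
  apply/asboolP; exists (fun i => if (i < r)%N then t i else v); split.
    by move=> i _; case: ifP => [/tU|].
  apply: indep_snoc vt it => i ir; apply/asboolP.
  exists (fun j => (j == i)%:R); rewrite (bigD1 (Ordinal ir)) //= eqxx scale1r.
  rewrite big1 ?addr0 // => j; rewrite -val_eqE /= => /negPf->.
  by rewrite scale0r.
by move=> /rmax; rewrite ltnn.
Qed.

(** An infinite properly increasing chain of subspaces needs infinite dimension. *)
Lemma no_infinite_chain U D (F : nat -> subspace V) :
  dim_le (fun v => v \in U) D ->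
  (forall x, {subset F x <= U}) ->
  (forall x y, (x <= y)%N -> {subset F x <= F y}) ->
  (forall x, exists y, exists2 u, u \in F y & u \notin F x) -> False.
Proof.
move=> UD FU Fle Fchain.
have [x [t [tF it]]] : exists x t, (forall i, (i < D.+1)%N -> t i \in F x) /\ indep D.+1 t.
  elim: (D.+1) => [|r [x [t [tF it]]]]; first by exists 0%N, (fun=> 0).
  have [y [u uy ux]] := Fchain x.
  exists (maxn x y), (fun i => if (i < r)%N then t i else u); split.
    move=> i _; case: ifP => [/tF|_]; first exact/Fle/leq_maxl.
    by move: uy; apply/Fle/leq_maxr.
  exact: (indep_snoc tF ux it).
have := dim_le_indep UD (fun i h => FU x _ (tF i h)) it.
by rewrite ltnn.
Qed.

End Independence.

Section ActionLemmas.
Variables (K : fieldType) (L : lieAlgType K) (V : lieModule L).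
Implicit Types (x y : L) (u v : V).

Lemma act0r x : act x (0 : V) = 0. Proof. exact: lin0 (act_linr x). Qed.
Lemma act0l v : act 0 v = 0. Proof. exact: lin0 (act_linl v). Qed.
Lemma actDr x u v : act x (u + v) = act x u + act x v.
Proof. exact: linD (act_linr x) _ _. Qed.
Lemma actDl x y v : act (x + y) v = act x v + act y v.
Proof. exact: linD (act_linl v) _ _. Qed.
Lemma actZr x a v : act x (a *: v) = a *: act x v.
Proof. exact: linZ (act_linr x) _ _. Qed.
Lemma actZl x a v : act (a *: x) v = a *: act x v.
Proof. exact: linZ (act_linl v) _ _. Qed.
Lemma actNl x v : act (- x) v = - act x v.
Proof. exact: linN (act_linl v) _. Qed.
Lemma actBr x u v : act x (u - v) = act x u - act x v.
Proof. exact: linB (act_linr x) _ _. Qed.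
Lemma act_sumr I (r : seq I) (P : pred I) x (F : I -> V) :
  act x (\sum_(i <- r | P i) F i) = \sum_(i <- r | P i) act x (F i).
Proof. exact: (big_morph _ (actDr x) (act0r x)). Qed.
Lemma act_suml I (r : seq I) (P : pred I) (F : I -> L) v :
  act (\sum_(i <- r | P i) F i) v = \sum_(i <- r | P i) act (F i) v.
Proof.
by elim/big_rec2: _ => [|i y1 y2 _ <-]; rewrite ?act0l // actDl.
Qed.

Lemma act_swap x y v : act x (act y v) = act y (act x v) + act (lie x y) v.
Proof. by rewrite act_lie addrC subrK. Qed.

Lemma irreducible_all (U : subspace V) (v : V) :
  irreducible V -> submodule U -> v \in U -> v != 0 -> forall u, u \in U.
Proof.
move=> [_ Virr] /Virr[U0|//] vU v0.
by rewrite (U0 _ vU) eqxx in v0.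
Qed.

End ActionLemmas.

(** * The bracket of two homogeneous components *)

Lemma row_span_ind (K : pzRingType) (n : nat) (Q : 'rV[K]_n -> Prop) :
  (forall u v, Q u -> Q v -> Q (u + v)) -> (forall a u, Q u -> Q (a *: u)) ->
  (forall i, Q (delta_mx 0 i)) -> Q 0 -> forall w, Q w.
Proof.
move=> QD QZ Qe Q0 w; rewrite [w]row_sum_delta; elim/big_ind: _ => // i _.
exact/QZ/Qe.
Qed.

Section Homogeneous.
Variables (K : numFieldType) (n : nat) (g : finLieAlgType K) (kappa : invForm g).
Variables c1 c2 : K.

Local Notation tau := (tau n kappa c1 c2).
Local Notation tm := (tmono kappa c1 c2).
Local Notation Zn := 'rV[int]_n.+1.
Local Notation rv := 'rV[K]_n.+1.
Local Notation hb := (hom_bracket kappa c1 c2).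

Let l0l (x : g) : lie 0 x = 0. Proof. exact: (lin0 (lie_linl x)). Qed.
Let l0r (x : g) : lie x 0 = 0. Proof. exact: (lin0 (lie_linr x)). Qed.
Let f0l x : kappa 0 x = 0. Proof. exact: (lin0 (form_linl kappa x)). Qed.
Let f0r x : kappa x 0 = 0. Proof. exact: (lin0 (form_linr kappa x)). Qed.
Let simp0 := (l0l, l0r, f0l, f0r, dot0l, dot0r).

Ltac piece_ring := apply: piece_eq => [f|p|p] /=; rewrite ?simp0;
  [rewrite !(linear0, linearD, linearN, linearZ) /=; ring
  |rewrite !mxE; ring|rewrite !mxE; ring].

Lemma hom_bracket_dK (k l u z : rv) :
  hb k (0, 0, u) l (0, z, 0) = Kpart g (dot u l *: z + dot u z *: k).
Proof. piece_ring. Qed.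

Lemma hom_bracket_dx (k l u : rv) (x : g) :
  hb k (0, 0, u) l (x, 0, 0) = (dot u l *: x, 0, 0).
Proof. piece_ring. Qed.

Lemma hom_bracket_dd (k l u v : rv) : hb k (0, 0, u) l (0, 0, v) =
  Kpart g ((c2 * (dot u k * dot v l) - c1 * (dot u l * dot v k)) *: k) +
  ((0, 0, dot u l *: v - dot v k *: u) : piece n g).
Proof. piece_ring. Qed.

Lemma hom_bracket_d0 (i : 'I_n.+1) (l : rv) (b : piece n g) :
  hb 0 (0, 0, delta_mx 0 i) l b = l 0 i *: b.
Proof.
case: b => [[x w] u].
apply: piece_eq => [f|p|p] /=; rewrite ?simp0 ?dot_delta.
- rewrite !(linear0, linearD, linearN, linearZ) /=; ring.
- rewrite !mxE; ring.
- rewrite !mxE; ring.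
Qed.

Lemma piece_split (x : g) (w u : rv) :
  ((x, w, u) : piece n g) =
  ((x, 0, 0) : piece n g) + Kpart g w + ((0, 0, u) : piece n g).
Proof. piece_ring. Qed.

Lemma lie_td0 (i : 'I_n.+1) (k : Zn) (a : piece n g) : lie (td kappa c1 c2 0 i) (tm k a) = (k 0 i)%:~R *: tm k a.
Proof.
rewrite lie_mono add0r -(linZ (tmono_linear _ _ _ k)).
have -> : zvec K 0 = 0 :> rv by rewrite /zvec map_mx0.
by rewrite hom_bracket_d0 mxE.
Qed.

Variable V : lieModule tau.
Implicit Types (v w : V) (k l m : Zn).

(** The degrees in which [tau] kills [v]. *)
Definition kills v k : Prop := forall a, act (tm k a) v = 0.

Lemma weight_act mu m a v : weight_space mu v ->
  weight_space (mu + zvec K m) (act (tm m a) v).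
Proof.
move=> vmu i; rewrite act_swap vmu lie_td0 actZr actZl -scalerDl.
by rewrite !mxE.
Qed.

(** The degrees [k] and [l] bracket onto the whole degree [k + l].  The [W]-part comes
    from [[t^k d_u, t^l d_u]], a nonzero multiple of [t^(k+l) d_u] whenever [u] is not
    orthogonal to [l - k]; the other two parts come from letting derivations act,
    which needs [l <> 0]. *)
Let bracket_full_nz k l v : (0 < n)%N -> k != l -> l != 0 ->
  (forall a b, act (lie (tm k a) (tm l b)) v = 0) -> kills v (k + l).
Proof.
move=> n0 kl l0 vkl; pose Z c := act (tm (k + l) c) v = 0.
have tl := tmono_linear kappa c1 c2 (k + l).
have ZD c d : Z c -> Z d -> Z (c + d).
  by rewrite /Z (linD tl) actDl => -> ->; rewrite addr0.
have ZZ c a : Z c -> Z (a *: c).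
  by rewrite /Z (linZ tl) actZl => ->; rewrite scaler0.
have ZZ' c a : a != 0 -> Z (a *: c) -> Z c.
  by move=> a0 /(ZZ _ a^-1); rewrite scalerA mulVf ?scale1r.
have Z0 : Z 0 by rewrite /Z (lin0 tl) act0l.
have Zb a b : Z (hb (zvec K k) a (zvec K l) b).
  by have := vkl a b; rewrite lie_mono.
have KD (a b : rv) : Kpart g (a + b) = Kpart g a + Kpart g b := linD (@Kpart_linear _ _ _) a b.
have KZ a (b : rv) : Kpart g (a *: b) = a *: Kpart g b := linZ (@Kpart_linear _ _ _) a b.
have /rV0Pn[j lj] := l0.
have Lj : zvec K l 0 j != 0 by rewrite mxE intr_eq0.
have ZK : forall w : rv, Z (Kpart g w).
  have Zi i : i != j -> Z (Kpart g (delta_mx 0 i)).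
    move=> ij; have := Zb (0, 0, delta_mx 0 j) (0, delta_mx 0 i, 0).
    rewrite hom_bracket_dK !dot_delta [delta_mx 0 i 0 j]mxE (negPf (_ : j != i)) 1?eq_sym //.
    by rewrite andbF scale0r addr0 KZ => /(ZZ' _ _ Lj).
  apply: row_span_ind => [u w|a u|i|].
  - by rewrite KD; exact: ZD.
  - by rewrite KZ; exact: (ZZ).
  - have [->|/Zi//] := eqVneq i j.
    (* [delta_j + e delta_i0] paired with the derivation [delta_j - e delta_i0] that
       is orthogonal to it, for a sign [e] with [l_j <> e l_i0]. *)
    pose i0 : 'I_n.+1 := if j == ord0 then ord_max else ord0.
    have i0j : i0 != j.
      rewrite /i0; case: (eqVneq j ord0) => [->|]; last by rewrite eq_sym.
      by rewrite -val_eqE /= -lt0n.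
    have Zpm (e : K) : e * e = 1 -> zvec K l 0 j - e * zvec K l 0 i0 != 0 ->
        Z (Kpart g (delta_mx 0 j)).
      move=> ee lne.
      have := Zb (0, 0, delta_mx 0 j - e *: delta_mx 0 i0)
                 (0, delta_mx 0 j + e *: delta_mx 0 i0, 0).
      rewrite hom_bracket_dK !(dotDl, dotNl, dotZl) !dot_delta.
      rewrite [X in _ + X *: _](_ : _ = 0).
        rewrite scale0r addr0 KZ => /(ZZ' _ _ lne).
        rewrite KD KZ => H.
        rewrite -[Kpart g (delta_mx 0 j)](addrK (e *: Kpart g (delta_mx 0 i0))).
        apply: (ZD) H _; rewrite -scaleNr; exact/ZZ/Zi.
      rewrite !mxE !eqxx (negPf i0j) (negPf (_ : j != i0)) 1?eq_sym //=.
      by rewrite !mulr0 addr0 add0r mulr1 ee subrr.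
    have [/eqP|] := eqVneq (zvec K l 0 j - 1 * zvec K l 0 i0) 0.
      rewrite mul1r subr_eq0 => /eqP lji; apply: (Zpm (-1)).
        by rewrite mulrNN mulr1.
      by rewrite mulN1r opprK -lji -mulr2n mulrn_eq0.
    by apply: Zpm; rewrite mulr1.
  - by rewrite (lin0 (@Kpart_linear _ _ _)).
have ZT : forall u, Z (0, 0, u).
  have lk0 : l - k != 0 by rewrite subr_eq0 eq_sym.
  have /rV0Pn[i lki] := lk0.
  pose ph (u : rv) := dot u (zvec K l) - dot u (zvec K k).
  have phE i' : ph (delta_mx 0 i') = ((l - k) 0 i')%:~R.
    by rewrite /ph !dot_delta !mxE rmorphB.
  have phD u u' : ph (u + u') = ph u + ph u'.
    by rewrite /ph !dotDl opprD addrACA.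
  have Zu u : ph u != 0 -> Z (0, 0, u).
    move=> pu; have := Zb (0, 0, u) (0, 0, u).
    rewrite hom_bracket_dd -scalerBl -/(ph u) => H.
    apply: (ZZ' _ _ pu).
    have -> : ph u *: ((0, 0, u) : piece n g) = (0, 0, ph u *: u).
      by rewrite /GRing.scale /= /scale_pair /= /scale_pair /= !scaler0.
    set c := (0, 0, _); set w := Kpart g _ in H.
    rewrite -[c](addKr w); apply: (ZD) H; rewrite -scaleN1r; exact/ZZ/ZK.
  have pD (u u' : rv) : ((0, 0, u + u') : piece n g) = ((0, 0, u) : piece n g) + ((0, 0, u') : piece n g).
    by rewrite /GRing.add /= /add_pair /= /add_pair /= !addr0.
  have pZ a (u : rv) : ((0, 0, a *: u) : piece n g) = a *: ((0, 0, u) : piece n g).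
    by rewrite [in RHS]/GRing.scale /= /scale_pair /= /scale_pair /= !scaler0.
  have ei : ph (delta_mx 0 i) != 0 by rewrite phE intr_eq0.
  apply: row_span_ind => [u w|a u|i'|//].
  - by rewrite pD; exact: ZD.
  - by rewrite pZ; exact: (ZZ).
  have [pi'|/Zu//] := eqVneq (ph (delta_mx 0 i')) 0.
  rewrite -[delta_mx 0 i'](addrK (delta_mx 0 i)) pD.
  apply: (ZD); first by apply: Zu; rewrite phD pi' add0r.
  by rewrite -scaleN1r pZ; apply/ZZ/Zu.
move=> [[x w] u]; rewrite piece_split; apply: (ZD); last exact: ZT.
apply: (ZD); last exact: ZK.
have := Zb (0, 0, delta_mx 0 j) (x, 0, 0); rewrite hom_bracket_dx dot_delta.
have -> : ((zvec K l 0 j *: x, 0, 0) : piece n g) = zvec K l 0 j *: ((x, 0, 0) : piece n g).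
  piece_ring.
exact: ZZ'.
Qed.

(** If [l = 0], then [k <> 0], and the roles are exchanged. *)
Lemma bracket_full k l v : (0 < n)%N -> k != l ->
  (forall a b, act (lie (tm k a) (tm l b)) v = 0) -> kills v (k + l).
Proof.
move=> n0 kl vkl; have [l0|] := eqVneq l 0; last first.
  by move=> l0; exact: bracket_full_nz.
rewrite addrC; apply: bracket_full_nz => //; first by rewrite eq_sym.
  by rewrite -l0.
by move=> a b; rewrite lieC actNl vkl oppr0.
Qed.

Lemma kills_add k l v : (0 < n)%N -> k != l -> kills v k -> kills v l ->
  kills v (k + l).
Proof.
move=> n0 kl vk vl; apply: bracket_full => // a b.
by rewrite act_lie vk vl !act0r subrr.
Qed.

End Homogeneous.

(** * Positive degrees and the support *)

Section Parallel.
Variable n : nat.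
Local Notation Zn := 'rV[int]_n.+1.
Implicit Types a b f : Zn.

Definition parallel a b : Prop := forall i j, a 0 i * b 0 j = a 0 j * b 0 i.

Lemma parallel_refl a : parallel a a.
Proof. by move=> i j; rewrite mulrC. Qed.

Lemma parallelD a b b' : parallel a b -> parallel a b' -> parallel a (b + b').
Proof. by move=> ab ab' i j; rewrite !mxE !mulrDr ab ab'. Qed.

Lemma parallelMn a b x : parallel a b -> parallel a (b *+ x).
Proof.
move=> ab; elim: x => [|x IH]; last by rewrite mulrS; exact: parallelD.
by move=> i j; rewrite mulr0n !mxE !mulr0.
Qed.

Lemma parallelN a b : parallel a b -> parallel a (- b).
Proof. by move=> ab i j; rewrite !mxE !mulrN ab. Qed.

Lemma parallelB a b b' : parallel a b -> parallel a b' -> parallel a (b - b').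
Proof. by move=> ab ab'; apply/parallelD/parallelN. Qed.

Lemma exists_nonparallel a : (0 < n)%N -> a != 0 -> exists f, ~ parallel a f.
Proof.
move=> n0 /rV0Pn[i ai]; pose j : 'I_n.+1 := if i == ord0 then ord_max else ord0.
have ji : j != i.
  rewrite /j; case: (eqVneq i ord0) => [->|]; last by rewrite eq_sym.
  by rewrite -val_eqE /= -lt0n.
exists (delta_mx 0 j) => /(_ i j); rewrite !mxE !eqxx (negPf (_ : i != j)) 1?eq_sym //=.
by rewrite mulr1 mulr0 => /eqP; rewrite (negPf ai).
Qed.

End Parallel.

Section Support.
Variables (K : numFieldType) (n : nat) (g : finLieAlgType K) (kappa : invForm g).
Variables c1 c2 : K.

Local Notation tau := (tau n kappa c1 c2).
Local Notation tm := (tmono kappa c1 c2).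
Local Notation Zn := 'rV[int]_n.+1.
Local Notation rv := 'rV[K]_n.+1.

Variable V : lieModule tau.
Hypotheses (n_gt0 : (0 < n)%N) (Virr : irreducible V) (Vnontriv : nontrivial V).
Implicit Types (v w : V) (k l m p q : Zn).

Lemma annihilator_closed :
  submod_closed [pred v : V | `[< forall y, act y v = 0 >]].
Proof.
split=> [|a u v /asboolP u0 /asboolP v0]; apply/asboolP => y.
  exact: act0r.
by rewrite actDr actZr u0 v0 scaler0 addr0.
Qed.

(** A vector killed by all of [tau] spans a trivial submodule. *)
Lemma kills_all v : (forall k, kills v k) -> v = 0.
Proof.
move=> vk; apply/eqP; apply: contrapT => /negP v0.
have vann : v \in Subspace annihilator_closed.
  apply/asboolP; elim/tau_ind => [|x y IHx IHy|k a]; last exact: vk.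
    exact: act0l.
  by rewrite actDl IHx IHy addr0.
have [y [u /eqP[]]] := Vnontriv.
have ann : submodule (Subspace annihilator_closed).
  by move=> x u' /asboolP u'0; apply/asboolP => z; rewrite u'0 act0r.
by have /asboolP/(_ y) := irreducible_all Virr ann vann v0 u.
Qed.

(** In geometric terms, [p] lies in the interior of the cone of directions along which
    [v] is eventually killed: the whole line through any [q] is allowed. *)
Definition absorbs v p : Prop :=
  forall q, exists x0, forall x, (x0 <= x)%N -> kills v (p *+ x + q).

Definition positive p : Prop := forall v, absorbs v p.

Lemma absorbs_closed p : submod_closed [pred v : V | `[< absorbs v p >]].
Proof.
split=> [|c u v /asboolP pu /asboolP pv]; apply/asboolP => q.
  by exists 0%N => x _ a; exact: act0r.
have [x ux] := pu q; have [y vy] := pv q; exists (maxn x y) => z.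
rewrite geq_max => /andP[xz yz] a.
by rewrite actDr actZr ux // vy // scaler0 addr0.
Qed.

Lemma kills_act m a v k : kills v k -> kills v (k + m) ->
  kills (act (tm m a) v) k.
Proof.
by move=> vk vkm b; rewrite act_swap vk act0r add0r lie_mono vkm.
Qed.

(** The vectors absorbed by [p] form a submodule, since acting by an element of degree
    [m] only shifts [q] by [m].  So one nonzero vector decides. *)
Lemma absorbs_positive v p : v != 0 -> absorbs v p -> positive p.
Proof.
move=> v0 vp u; apply/asboolP.
apply: (@irreducible_all _ _ _ (Subspace (absorbs_closed p)) v) => //; last first.
  exact/asboolP.
move=> y; elim/tau_ind: y => [w _|x y IHx IHy w wp|m a w /asboolP wp].
- by rewrite act0l; exact: rpred0.
- by rewrite actDl rpredD ?IHx ?IHy.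
apply/asboolP => q; have [x wx] := wp q; have [y wy] := wp (q + m).
exists (maxn x y) => z; rewrite geq_max => /andP[xz yz].
by apply: kills_act; rewrite -?addrA; [exact: wx|exact: wy].
Qed.

Lemma positive_neq0 p : positive p -> p <> 0.
Proof.
move=> pp p0; have [[v v0] _] := Virr; case/eqP: v0; apply: kills_all => q.
by have [x /(_ x (leqnn x))] := pp v q; rewrite p0 mul0rn add0r.
Qed.

Lemma positiveD p p' : positive p -> positive p' -> positive (p + p').
Proof.
move=> pp pp' v q; pose f : Zn := delta_mx 0 ord0.
have [x vx] := pp v 0; have [x' vx'] := pp' v q.
have [y vy] := pp v f; have [y' vy'] := pp' v (q - f).
exists (maxn (maxn x x') (maxn y y')) => z.
rewrite !geq_max => /andP[/andP[xz xz'] /andP[yz yz']]; rewrite mulrnDl.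
(* The two summands must be distinct; if they are equal, shift them apart by [f]. *)
have [e|ne] := eqVneq (p *+ z + 0) (p' *+ z + q); last first.
  by rewrite -addrA -[p *+ z](addr0); apply: kills_add => //; [exact: vx|exact: vx'].
have -> : p *+ z + p' *+ z + q = (p *+ z + f) + (p' *+ z + (q - f)).
  by rewrite [RHS]addrACA [f + _]addrC subrK.
apply: kills_add => //; [|exact: vy|exact: vy'].
rewrite -[p *+ z]addr0 e; apply/eqP => /rowP/(_ ord0); rewrite !mxE !eqxx /=; lia.
Qed.

(** [a] may be added any number of times to [b], because an equality of summands on
    the way would make [b] a multiple of [a]. *)
Lemma kills_addn w a b i : kills w a -> kills w b -> ~ parallel a b ->
  kills w (b + a *+ i).
Proof.
move=> wa wb ab; elim: i => [|i IH]; first by rewrite addr0.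
rewrite mulrSr addrA; apply: kills_add => //; apply/eqP => e; apply: ab.
rewrite -[b](addrK (a *+ i)) e; apply: parallelB; first exact: parallel_refl.
exact/parallelMn/parallel_refl.
Qed.

(** Together with an absorbing direction, a killed degree [a] may be repeated
    arbitrarily often, with a bound on [x] that does not depend on [i].  When
    [p x + c] is itself parallel to [a], it is first split into two degrees off that
    line. *)
Lemma kills_absorb w p a c : absorbs w p -> kills w a ->
  exists x0, forall x i, (x0 <= x)%N -> kills w (p *+ x + c + a *+ i).
Proof.
move=> wp wa; have [a0|a0] := eqVneq a 0.
  by have [x wx] := wp c; exists x => y i /wx; rewrite a0 mul0rn addr0.
have [f af] := exists_nonparallel n_gt0 a0.
have [x0 w0] := wp c; have [x1 w1] := wp f; have [x2 w2] := wp (f *+ 2).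
have [x3 w3] := wp (c - f); have [x4 w4] := wp (c - f *+ 2).
have [N NE] : exists N, N = (x0 + x1 + x2 + x3 + x4)%N by eexists.
exists (N + N)%N => x i Nx.
have [ab|] := pselect (parallel a (p *+ x + c)); last first.
  by apply: kills_addn => //; apply: w0; lia.
have [h [wh1 wh2 ah]] : exists h, [/\ kills w (p *+ N + h),
    kills w (p *+ (x - N) + (c - h)) & ~ parallel a (p *+ N + h)].
  have [af1|] := pselect (parallel a (p *+ N + f)); last first.
    by exists f; split=> //; [apply: w1|apply: w3]; lia.
  (* [f] and [2 f] cannot both bring [p N] onto the line of [a]. *)
  exists (f *+ 2); split; [apply: w2|apply: w4|]; try lia.
  move=> af2; apply: af; have := parallelB af2 af1.
  by rewrite opprD addrACA subrr add0r mulr2n addrK.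
have -> : p *+ x + c + a *+ i = (p *+ N + h + a *+ i) + (p *+ (x - N) + (c - h)).
  rewrite -{1}(@subnKC N x) ?mulrnDr; last by lia.
  by rewrite [RHS]addrAC [in RHS]addrACA subrKC.
apply: kills_add => //; last exact: kills_addn.
apply/eqP => e; apply: ah => i1 j1; have := ab; rewrite -{1}(@subnKC N x); last by lia.
have -> : p *+ (N + (x - N)) + c = (p *+ N + h) + (p *+ (x - N) + (c - h)).
  by rewrite mulrnDr [RHS]addrACA subrKC.
rewrite -e addrA => ab'.
have /(_ i1 j1) := parallelB ab' (parallelMn i (parallel_refl a)).
rewrite addrK !mxE; lia.
Qed.

(** Otherwise [q = p x + q + x (-p)] is killed for every [q]. *)
Lemma not_kills_opp w p : positive p -> w != 0 -> ~ kills w (- p).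
Proof.
move=> pp /eqP w0 wp; apply: w0; apply: kills_all => q.
have [x /(_ x x (leqnn x))] := kills_absorb q (pp w) wp.
by rewrite mulNrn addrC addrA addNr add0r.
Qed.

(** If [3 j - p] is killed, then [i (3 j - p) + i p + q] is killed for large [i], which
    makes [j] absorbing. *)
Lemma not_kills_skew w j p : positive p -> ~ positive j -> w != 0 ->
  ~ kills w (j *+ 3 - p).
Proof.
move=> pp jp w0 wj; apply: jp; apply: absorbs_positive w0 _ => q.
have [x0 w0] := kills_absorb q (pp w) wj.
have [x1 w1] := kills_absorb (j + q) (pp w) wj.
have [x2 w2] := kills_absorb (j *+ 2 + q) (pp w) wj.
exists (x0 + x1 + x2).+1.*2.*2 => x xle.
have -> : j *+ x + q = p *+ (x %/ 3) + (j *+ (x %% 3) + q) + (j *+ 3 - p) *+ (x %/ 3).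
  rewrite {1}(divn_eq x 3) mulrnDr mulrnBl -mulrnA.
  by rewrite [RHS]addrC [in RHS]addrA subrK addrA mulnC.
have := ltn_pmod x (isT : (0 < 3)%N); have := divn_eq x 3.
case: (x %% 3)%N => [|[|[|//]]] xE _; rewrite ?mulr0n ?add0r ?mulr1n.
- by apply: w0; lia.
- by apply: w1; lia.
- by apply: w2; lia.
Qed.

Variable lam : rv.
Hypothesis Vspan : forall v, v \in lspan (fun v => exists m, weight_space (lam + zvec K m) v).
Hypothesis Vfin : forall m, exists N, dim_le (@weight_space K n g kappa c1 c2 V (lam + zvec K m)) N.

Local Notation wt m := (weight_space (lam + zvec K m)).

Lemma weight_closed mu : submod_closed [pred v : V | `[< weight_space mu v >]].
Proof.
split=> [|a u v /asboolP u0 /asboolP v0]; apply/asboolP => i.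
  by rewrite act0r scaler0.
by rewrite actDr actZr u0 v0 scalerDr !scalerA mulrC.
Qed.

Lemma weight_act_deg m k a v : wt m v -> wt (m + k) (act (tm k a) v).
Proof. by move=> /(weight_act k a); rewrite zvecD addrA. Qed.

Definition in_supp m : Prop := exists v, v != 0 /\ wt m v.

Lemma not_in_supp m v : ~ in_supp m -> wt m v -> v = 0.
Proof.
by move=> mS vm; apply/eqP; apply: contrapT => /negP v0; apply: mS; exists v.
Qed.

Lemma supp_nonempty : exists m, in_supp m.
Proof.
apply: contrapT => S0; have [[v /eqP v0] _] := Virr; apply: v0.
apply: (@lspan_ker _ _ _ id _ _ _ v (Vspan v)) => // w [m wm].
by apply: (not_in_supp _ wm) => mS; apply: S0; exists m.
Qed.

Lemma supp_step m k : (forall w, w != 0 -> ~ kills w k) -> in_supp m ->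
  in_supp (m + k).
Proof.
move=> nk [v [v0 vm]]; apply: contrapT => mk; apply: (nk v v0) => a.
exact/(not_in_supp mk)/weight_act_deg.
Qed.

Lemma supp_opp m p x : positive p -> in_supp m -> in_supp (m - p *+ x).
Proof.
move=> pp mS; elim: x => [|x IH]; first by rewrite subr0.
rewrite mulrSr opprD addrA; apply: supp_step IH => w; exact: not_kills_opp.
Qed.

(** These subspaces of one weight space increase with [y]. *)
Definition chain_pred s p y : {pred V} := [pred u : V |
  `[< wt s u /\ forall y', (y <= y')%N -> kills u (p *+ y') >]].

Lemma chain_closed s p y : submod_closed (chain_pred s p y).
Proof.
split=> [|c u v /asboolP[us uk] /asboolP[vs vk]]; apply/asboolP; split.
- by move=> i; rewrite act0r scaler0.
- by move=> y' _ a; rewrite act0r.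
- by have [_ /(_ c u v)/(_ _ _)/asboolP] := weight_closed (lam + zvec K s); apply;
    apply/asboolP.
by move=> y' yy' a; rewrite actDr actZr uk // vk // scaler0 addr0.
Qed.

(** A vector at level [x] of the line [s + Z p] whose killing threshold [Y] lies below
    its level: if the degree [p Y] does not kill [v], applying it raises the level by
    [Y] and does not raise the threshold. *)
Let low_threshold s p X : positive p -> (2 <= X)%N ->
  in_supp (s + p *+ X) -> exists w x Y, [/\ (X <= x)%N, (Y < x)%N, w != 0,
    wt (s + p *+ x) w & forall y, (Y <= y)%N -> kills w (p *+ y)].
Proof.
move=> pp X2 [v [v0 vX]]; have [Y vY] := pp v 0.
have {vY} : forall y, (Y <= y)%N -> kills v (p *+ y).
  by move=> y /vY; rewrite addr0.
elim: Y => [|Y IH] vY; first by exists v, X, 0%N; split=> //; lia.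
have [YX|XY] := ltnP Y.+1 X; first by exists v, X, Y.+1; split.
have [vk|] := pselect (kills v (p *+ Y)).
  apply: IH => y; rewrite leq_eqVlt => /orP[/eqP<-//|]; exact: vY.
move=> /existsNP[a /eqP va0].
exists (act (tm (p *+ Y) a) v), (X + Y)%N, Y.+1; split=> //; try by lia.
  by rewrite mulrnDr addrA; exact: weight_act_deg.
move=> y Yy; apply: kills_act; first exact: vY.
by rewrite -mulrnDr; apply: vY; lia.
Qed.

(** Let [w] be a vector at level [x] with threshold [Y < x].  Some element of degree
    [- p x] sends it to a vector of weight [s] that is killed by [p y] for all
    [y >= x + Y], but not by [p (x - 1)], since [(x - 1) - x = -1] and [- p] kills no
    nonzero vector.  For arbitrarily large [x] this gives an infinite chain of
    subspaces. *)
Lemma not_all_supp s p : positive p -> ~ forall x, in_supp (s + p *+ x).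
Proof.
move=> pp allS; have [D sD] := Vfin s.
apply: (@no_infinite_chain _ _ (Subspace (weight_closed (lam + zvec K s))) D
  (fun y => Subspace (chain_closed s p y))).
- have [t [tw tE]] := sD; exists t; split=> [i|v /asboolP /tE //].
  exact/asboolP.
- by move=> y u /asboolP[us _]; apply/asboolP.
- move=> x y xy u /asboolP[us uk]; apply/asboolP; split=> // y' yy'.
  exact/uk/(leq_trans xy).
move=> y.
have [w [x [Y [yx Yx w0 wx wY]]]] := low_threshold pp (isT : (1 < y.+2)%N) (allS y.+2).
have [b [a /eqP ab0]] : exists b a, act (tm (p *+ x.-1) a) (act (tm (- (p *+ x)) b) w) <> 0.
  apply: contrapT => H; apply: (not_kills_opp pp w0).
  have -> : - p = p *+ x.-1 + - (p *+ x).
    by rewrite -{2}(@prednK x) ?mulrSr ?opprD ?addrA ?subrr ?add0r //; lia.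
  apply: bracket_full => // [|a b].
    apply/eqP => e; apply: (positive_neq0 pp); apply/rowP => i.
    move/eqP: e; rewrite -subr_eq0 opprK -mulrnDr => /eqP/rowP/(_ i)/eqP.
    rewrite mulmxnE mxE mulrn_eq0 => /orP[|/eqP->//].
    by move=> /eqP; lia.
  rewrite act_lie; apply/eqP; rewrite subr_eq0; apply/eqP.
  rewrite (wY x.-1); last by lia.
  by rewrite act0r; apply: contrapT => abne; apply: H; exists b, a.
exists (x + Y)%N, (act (tm (- (p *+ x)) b) w).
  apply/asboolP; split.
    by rewrite -[s](addrK (p *+ x)); exact: weight_act_deg.
  move=> y' xYy'; apply: kills_act; first by apply: wY; lia.
  by rewrite -mulrnBr; [apply: wY|]; lia.
apply/asboolP => -[_ /(_ x.-1)]; move/eqP: ab0 => ab0 H; apply: ab0.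
by apply: H; lia.
Qed.

Lemma supp_bounded s p : positive p -> exists X, forall x, (X <= x)%N -> ~ in_supp (s + p *+ x).
Proof.
move=> pp; have /existsNP[X XS] := @not_all_supp s p pp; exists X => x Xx xS; apply: XS.
have -> : s + p *+ X = s + p *+ x - p *+ (x - X).
  by rewrite -addrA mulrnBr // subKr.
exact: supp_opp.
Qed.

(** If neither [k] nor [p - k] were positive, then [3 (p - k) - p] and [3 k - p] would
    both translate the support into itself, hence so would their sum [p], and the
    support would be unbounded in the direction [p]. *)
Lemma positive_compl k p : positive p -> ~ positive k -> positive (p - k).
Proof.
move=> pp kp; apply: contrapT => jp.
have [s sS] := supp_nonempty; apply: (@not_all_supp s p pp); elim=> [|x IH].
  by rewrite addr0.
rewrite mulrSr addrA.
have pE : p = ((p - k) *+ 3 - p) + (k *+ 3 - p).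
  by rewrite addrACA -mulrnDl subrK -opprD -mulr2n mulrS addrK.
rewrite [X in in_supp (_ + X)]pE addrA; apply: supp_step; first by move=> w; exact: not_kills_skew.
by apply: supp_step => // w; exact: not_kills_skew.
Qed.

End Support.

(** * A bound that is uniform in the direction *)

Section PartitionBound.
Variables (K : numFieldType) (n : nat) (g : finLieAlgType K) (kappa : invForm g).
Variables c1 c2 : K.

Local Notation tau := (tau n kappa c1 c2).
Local Notation tm := (tmono kappa c1 c2).
Local Notation Zn := 'rV[int]_n.+1.
Local Notation rv := 'rV[K]_n.+1.

Variables (V : lieModule tau) (lam : rv).
Implicit Types (v w : V) (k l m p q s : Zn).
Local Notation wt m := (weight_space (lam + zvec K m)).

Lemma mulmxzE k (z : int) i : (k *~ z) 0 i = k 0 i * z.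
Proof.
have mxn x : (k *+ x) 0 i = k 0 i * x%:Z by rewrite mulmxnE -mulr_natr natz.
case: z => x; first by rewrite -pmulrn mxn.
by rewrite NegzE mulrNz mxE -pmulrn mxn mulrN.
Qed.

Lemma zvecMz k (z : int) : zvec K (k *~ z) = z%:~R *: zvec K k.
Proof. by apply/rowP => i; rewrite !mxE mulmxzE rmorphM mulrC. Qed.

Lemma weight_td0 mu v (u : rv) : weight_space mu v ->
  act (tm 0 (0, 0, u)) v = dot u mu *: v.
Proof.
move=> vmu; rewrite -td_sum act_suml /dot scaler_suml; apply: eq_bigr => i _.
by rewrite actZl vmu scalerA.
Qed.

(** The fields [I_z = t^(z k) d_u] with [u] orthogonal to [k] commute, and
    [L_z = t^(z k) d_i0] acts on them as a derivation with
    [[L_y, I_z] = z k_i0 I_(y+z)]; the orthogonality removes both cocycles.  On a top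
    vector [w] this makes products of the [I_(-a)] independent. *)
Section Line.
Variables (k : Zn) (u : rv) (i0 : 'I_n.+1).
Hypotheses (uk : dot u (zvec K k) = 0).

Let I (z : int) := tm (k *~ z) (0, 0, u).
Let L (z : int) := tm (k *~ z) (0, 0, delta_mx 0 i0).
Let kap : K := zvec K k 0 i0.

Let uzk z : dot u (zvec K (k *~ z)) = 0.
Proof. by rewrite zvecMz dotZr uk mulr0. Qed.

Let lie_II y z : lie (I y) (I z) = 0.
Proof.
rewrite lie_mono hom_bracket_dd !uzk !(mulr0, mul0r, subrr, scale0r, subr0).
by rewrite (lin0 (@Kpart_linear _ _ _)) add0r (lin0 (tmono_linear _ _ _ _)).
Qed.

Let lie_LI y z : lie (L y) (I z) = (z%:~R * kap) *: I (y + z).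
Proof.
rewrite lie_mono hom_bracket_dd !uzk !(mulr0, mul0r, subrr, scale0r, subr0).
rewrite (lin0 (@Kpart_linear _ _ _)) add0r dot_delta zvecMz mxE -mulrzDr.
rewrite -(linZ (tmono_linear _ _ _ _)); congr tmono.
by rewrite [in RHS]/GRing.scale /= /scale_pair /= /scale_pair /= !scaler0.
Qed.

Variables (w : V) (alpha : K).
Hypotheses (w0 : w != 0) (wI0 : act (I 0) w = alpha *: w).
Hypotheses (alpha0 : alpha != 0) (kap0 : kap != 0).
Hypothesis wtop : forall y, (0 < y)%N -> kills w (k *+ y).

Let wtopz (y : int) a : 0 < y -> act (tm (k *~ y) a) w = 0.
Proof. by case: y => // y y0; rewrite -pmulrn; apply: wtop. Qed.

Let II y z v : act (I y) (act (I z) v) = act (I z) (act (I y) v).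
Proof. by rewrite act_swap lie_II act0l addr0. Qed.

Let LII y z z' : 0 < y -> act (L y) (act (I z) (act (I z') w)) =
  (z'%:~R * kap) *: act (I z) (act (I (y + z')) w) +
  (z%:~R * kap) *: act (I (y + z)) (act (I z') w).
Proof.
move=> y0; rewrite act_swap (act_swap (L y) (I z')) !lie_LI !actZl /L wtopz //.
by rewrite act0r add0r actZr.
Qed.

Definition line_vec (X x : nat) : V := act (I (- x.+1%:Z)) (act (I (x.+1%:Z - X%:Z)) w).

(** Applying [L_(X-b)] and then [L_b] is triangular: it annihilates [line_vec X (a-1)]
    for [a > b] and sends [line_vec X (b-1)] to a nonzero multiple of [w]. *)
Lemma line_vec_indep X r : (2 * r < X)%N -> indep r (line_vec X).
Proof.
move=> rX c c0; elim/ltn_ind => i IH ir.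
have := congr1 (act (L i.+1%:Z)) (congr1 (act (L (X%:Z - i.+1%:Z))) c0).
rewrite !act0r !act_sumr (bigD1 (Ordinal ir)) //= big1 => [|[j jr] /= ji].
  rewrite addr0 !actZr LII; last by lia.
  have -> : X%:Z - i.+1%:Z + (i.+1%:Z - X%:Z) = 0 by lia.
  rewrite wI0 [act (I (X%:Z - _ + _)) _]II /I wtopz; last by lia.
  rewrite act0r scaler0 addr0 !actZr act_swap lie_LI /L wtopz; last by lia.
  rewrite act0r add0r actZl addrN wI0 !scalerA => /eqP.
  rewrite scaler_eq0 (negPf w0) orbF !mulf_eq0 (negPf alpha0) (negPf kap0) !orbF.
  rewrite !intr_eq0 oppr_eq0 /= orbF => /orP[/eqP //|]; lia.
move: ji; rewrite -val_eqE /= => ji; have [ij|ji'] := ltnP i j; last by rewrite IH ?scale0r ?act0r //; lia.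
rewrite !actZr LII; last by lia.
rewrite [act (I (X%:Z - _ + - _)) _]II /I !wtopz; try by lia.
by rewrite !act0r !scaler0 addr0 act0r scaler0.
Qed.

End Line.

(** The non-vanishing minor provides [u] orthogonal to [k] on which the weight does not
    vanish. *)
Lemma line_top_bound s k D X w (i j : 'I_n.+1) :
  (lam + zvec K s) 0 i * zvec K k 0 j != (lam + zvec K s) 0 j * zvec K k 0 i ->
  dim_le (@weight_space K n g kappa c1 c2 V (lam + zvec K s)) D -> w != 0 ->
  wt (s + k *+ X) w -> (forall y, (0 < y)%N -> kills w (k *+ y)) ->
  (X <= 2 * D + 2)%N.
Proof.
move=> ij sD w0 wX wtop; rewrite leqNgt; apply/negP => DX.
have k0 : k != 0.
  by apply: contraNneq ij => ->; rewrite /zvec map_mx0 !mxE !mulr0.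
have /rV0Pn[i0 ki0] := k0.
pose u : rv := zvec K k 0 j *: delta_mx 0 i - zvec K k 0 i *: delta_mx 0 j.
have uk : dot u (zvec K k) = 0.
  by rewrite /u dotDl dotNl !dotZl !dot_delta mulrC subrr.
pose alpha := dot u (lam + zvec K s).
have alpha0 : alpha != 0.
  rewrite /alpha /u dotDl dotNl !dotZl !dot_delta subr_eq0.
  by rewrite mulrC [X in _ != X]mulrC.
have wI0 : act (tm (k *~ 0) (0, 0, u)) w = alpha *: w.
  rewrite mulr0z (weight_td0 _ wX) zvecD addrA dotDr pmulrn zvecMz.
  by rewrite [dot u (_ *: _)]dotZr uk mulr0 addr0.
have kap0 : zvec K k 0 i0 != 0 by rewrite mxE intr_eq0.
have it := @line_vec_indep k u i0 uk w alpha w0 wI0 alpha0 kap0 wtop X D.+1.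
suff : (D.+1 <= D)%N by rewrite ltnn.
have ws : dim_le (fun v => v \in Subspace (@weight_closed _ _ _ _ _ _ V (lam + zvec K s))) D.
  by have [t [tw tE]] := sD; exists t; split=> [a|v /asboolP /tE //]; exact/asboolP.
apply: (dim_le_indep ws (t := line_vec k u w X)); last by apply: it; lia.
move=> x _; apply/asboolP; rewrite /line_vec.
have -> : s = s + k *+ X + k *~ (x.+1%:Z - X%:Z) + k *~ (- x.+1%:Z).
  by rewrite -addrA -mulrzDr -addrA pmulrn -mulrzDr (_ : X%:Z + _ = 0) ?addr0 //; lia.
exact/weight_act_deg/weight_act_deg.
Qed.

Hypotheses (n_gt0 : (0 < n)%N) (Virr : irreducible V) (Vnontriv : nontrivial V).
Hypothesis Vspan : forall v, v \in lspan (fun v => exists m, weight_space (lam + zvec K m) v).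
Hypothesis Vfin : forall m, exists N, dim_le (@weight_space K n g kappa c1 c2 V (lam + zvec K m)) N.

Local Notation in_supp := (@in_supp K n g kappa c1 c2 V lam).
Local Notation positive := (@positive K n g kappa c1 c2 V).

(** The previous bound at the highest point of the support on the line; what matters is
    that it does not involve [k]. *)
Lemma supp_line_bound s k D (i j : 'I_n.+1) :
  (lam + zvec K s) 0 i * zvec K k 0 j != (lam + zvec K s) 0 j * zvec K k 0 i ->
  dim_le (@weight_space K n g kappa c1 c2 V (lam + zvec K s)) D ->
  positive k -> forall x, (2 * D + 3 <= x)%N -> ~ in_supp (s + k *+ x).
Proof.
move=> ij sD kp x Dx xS.
have [Y YS] := supp_bounded n_gt0 Virr Vnontriv Vfin s kp.
pose Q x := `[< in_supp (s + k *+ x) >].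
have QY y : Q y -> (y <= Y)%N.
  move=> /asboolP yS; rewrite leqNgt; apply/negP => Yy.
  exact: YS (ltnW Yy) yS.
have Qx : exists x, Q x by exists x; exact/asboolP.
case: (ex_maxnP Qx QY) => X /asboolP[w [w0 wX]] Xmax.
have xX : (x <= X)%N by apply: Xmax; exact/asboolP.
have := line_top_bound ij sD w0 wX; suff wk : forall y, (0 < y)%N -> kills w (k *+ y).
  by move=> /(_ wk); lia.
move=> y y0 a; apply: (@not_in_supp _ _ _ _ _ _ _ lam (s + k *+ (X + y))).
  move=> XyS; suff : (X + y <= X)%N by lia.
  by apply: Xmax; exact/asboolP.
by rewrite mulrnDr addrA; exact: weight_act_deg.
Qed.

(** The exceptional directions, those parallel to the weight [lam + s], are dealt
    with by moving [s] to [s - q] with [q] not parallel to [k]. *)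
Lemma supp_uniform_bound q1 q2 s : positive q1 -> positive q2 ->
  (forall k, k != 0 -> parallel q1 k -> ~ parallel q2 k) -> in_supp s ->
  exists M, forall k, positive k -> ~ in_supp (s + k *+ M).
Proof.
move=> q1p q2p q12 sS.
have [D0 sD0] := Vfin s; have [D1 sD1] := Vfin (s - q1); have [D2 sD2] := Vfin (s - q2).
exists (2 * (D0 + D1 + D2) + 3)%N => k kp kS.
have k0 : k != 0 by apply/eqP; exact: (positive_neq0 Virr Vnontriv kp).
pose mu := lam + zvec K s.
have [npar|par] := pselect (exists i j, mu 0 i * zvec K k 0 j != mu 0 j * zvec K k 0 i).
  have [i [j ij]] := npar; apply: (supp_line_bound ij sD0 kp) kS; lia.
have {}par i j : mu 0 i * zvec K k 0 j = mu 0 j * zvec K k 0 i.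
  by apply/eqP; apply: contrapT => /negP ij; apply: par; exists i, j.
have key q D : positive q -> ~ parallel q k -> (D <= D0 + D1 + D2)%N ->
    dim_le (@weight_space K n g kappa c1 c2 V (lam + zvec K (s - q))) D -> False.
  move=> qp /existsNP[i /existsNP[j /eqP qij]] DD sD.
  have ij : (lam + zvec K (s - q)) 0 i * zvec K k 0 j !=
            (lam + zvec K (s - q)) 0 j * zvec K k 0 i.
    have zq : lam + zvec K (s - q) = mu - zvec K q.
      by rewrite /mu -addrA; congr (_ + _); rewrite /zvec map_mxB.
    rewrite zq !mxE !mulrBl; have := par i j; rewrite !mxE => ->.
    by rewrite (inj_eq (addrI _)) eqr_opp -!intrM eqr_int.
  apply: (supp_line_bound ij sD kp (x := (2 * (D0 + D1 + D2) + 3)%N)); first by lia.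
  have := supp_opp n_gt0 Virr Vnontriv 1 qp kS.
  by rewrite mulr1n addrAC.
have [q1k|q1k] := pselect (parallel q1 k).
  apply: (key q2 D2) => //; [exact: q12|lia].
apply: (key q1 D1) => //; lia.
Qed.

(** With [s] in the support and [M] the uniform bound at [s - p]: if [p - k M] were
    positive, then [s - (p - k M) = (s - p) + k M] would lie in the support. *)
Lemma positive_arch q1 q2 p : positive q1 -> positive q2 ->
  (forall k, k != 0 -> parallel q1 k -> ~ parallel q2 k) ->
  positive p -> exists M, forall k, positive k -> ~ positive (p - k *+ M).
Proof.
move=> q1p q2p q12 pp; have [s sS] := supp_nonempty Virr Vspan.
have spS : in_supp (s - p).
  by have := supp_opp n_gt0 Virr Vnontriv 1 pp sS; rewrite mulr1n.
have [M MS] := supp_uniform_bound q1p q2p q12 spS; exists M => k kp pkp.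
apply: (MS k kp); have := supp_opp n_gt0 Virr Vnontriv 1 pkp sS.
by rewrite mulr1n opprB [k *+ M - p]addrC addrA.
Qed.

End PartitionBound.

(** * Archimedean preorders on a lattice *)

(** By [PC], [P] is the strict part of a total preorder compatible with addition; by
    [Parch], the multiples of the positive elements eventually exceed [p] at a rate
    that is uniform in the element.  This excludes both irrational half-spaces, which
    have arbitrarily small positive elements, and lexicographic orders. *)
Section HalfSpace.
Variables (n : nat) (P : 'rV[int]_n -> Prop).
Local Notation Zn := 'rV[int]_n.
Implicit Types (k m p h : Zn).
Hypothesis PD : forall p q, P p -> P q -> P (p + q).
Hypothesis P0 : ~ P 0.
Hypothesis PC : forall k p, ~ P k -> P p -> P (p - k).
Hypothesis Parch : forall p, P p -> exists M, forall k, P k -> ~ P (p - k *+ M).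
Variables (p0 : Zn) (Pp0 : P p0).

Let PM p x : P p -> P (p *+ x.+1).
Proof. by move=> Pp; elim: x => [|x IH] //; rewrite mulrS; exact: PD. Qed.

(** Without a minimal positive element one could halve forever: [p0] would exceed
    [2 ^ j k] for every [j] and suitable [k], against the uniform bound. *)
Lemma exists_minimal : exists e, P e /\ forall k, P k -> ~ P (e - k).
Proof.
apply: contrapT => nm.
have {}nm e : P e -> exists k, P k /\ P (e - k).
  move=> Pe; apply: contrapT => H; apply: nm; exists e; split=> // k Pk Pek.
  by apply: H; exists k.
have half j : exists k, P k /\ forall x, P x -> P (x + (p0 - k *+ (2 ^ j))).
  elim: j => [|j [k [Pk kP]]].
    by exists p0; split=> // x; rewrite expn0 mulr1n subrr addr0.
  have step k' : P k' -> (forall x, P x -> P (x + (k - k' *+ 2))) ->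
      exists k, P k /\ forall x, P x -> P (x + (p0 - k *+ (2 ^ j.+1))).
    move=> Pk' k'P; exists k'; split=> // x Px.
    have -> : x + (p0 - k' *+ 2 ^ j.+1) =
        x + (k - k' *+ 2) *+ (2 ^ j) + (p0 - k *+ 2 ^ j).
      rewrite expnS mulrnA mulrnBl -addrA; congr (_ + _).
      by rewrite [RHS]addrC addrA subrK.
    apply: kP; elim: (2 ^ j)%N => [|y IH]; first by rewrite mulr0n addr0.
    by rewrite mulrSr addrA; exact: k'P.
  have [k' [Pk' Pkk']] := nm _ Pk.
  have [Pk2|nPk2] := pselect (P (k - k' *+ 2)).
    by apply: (step k') => // x Px; exact: PD.
  apply: (step (k - k')) => // x Px.
  have -> : k - (k - k') *+ 2 = - (k - k' *+ 2).
    by rewrite mulrnBl !opprB addrCA [k *+ 2]mulr2n opprD addNKr.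
  exact: PC.
have [M MP] := Parch Pp0.
have [k [Pk kP]] := half M; apply: (MP k) => //.
have M2 : (M < 2 ^ M)%N by exact: ltn_expl.
have := kP _ (PM ((2 ^ M - M).-1) Pk).
rewrite prednK ?subn_gt0 // addrCA mulrnBr ?(ltnW M2) //.
by rewrite addrAC subrr sub0r.
Qed.

(** Modulo the subgroup [H] of elements that are neither positive nor negative, every
    element is a multiple of the minimal positive element [e]; [b] reads off the
    multiple. *)
Lemma half_space : exists b e : Zn, \sum_i b 0 i * e 0 i = 1 /\
  forall m, P m <-> 0 < \sum_i b 0 i * m 0 i.
Proof.
have [e [Pe emin]] := exists_minimal.
pose H h := ~ P h /\ ~ P (- h).
have PH p h : H h -> P p -> P (p + h).
  by move=> [_ h1] Pp; rewrite -[h]opprK; exact: PC.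
have HN h : H h -> H (- h) by move=> [h1 h2]; split; rewrite ?opprK.
have HD h h' : H h -> H h' -> H (h + h').
  have aux h1 h2 : H h1 -> H h2 -> ~ P (h1 + h2).
    move=> Hh1 Hh2 P12; have [] := Hh2; case; have := PH _ _ (HN _ Hh1) P12.
    by rewrite addrAC subrr add0r.
  by move=> h1 h2; split; rewrite ?opprD; apply: aux => //; exact: HN.
have H0 : H 0 by split; rewrite ?oppr0.
have HMz h (z : int) : H h -> H (h *~ z).
  move=> Hh; have HMn x : H (h *+ x).
    by elim: x => [|x IH] //; rewrite mulrS; exact: HD.
  by case: z => x; [exact: HMn|rewrite NegzE mulrNz; exact/HN/HMn].
have coef m : exists z : int, H (m - e *~ z).
  have low m' : exists M, ~ P (m' - e *+ M).
    have [Pm|Pm] := pselect (P m'); last by exists 0%N; rewrite subr0.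
    by have [M MP] := Parch Pm; exists M; exact: MP.
  have [M nM] := low m; have [M' nM'] := low (- m).
  have PM' : P (m + e *+ M'.+1).
    by have := PC nM' Pe; rewrite opprB opprK addrA -mulrS addrC.
  have [x [Px nPx]] : exists x, P (m + e *+ M'.+1 - e *+ x) /\
      ~ P (m + e *+ M'.+1 - e *+ x.+1).
    have : ~ P (m + e *+ M'.+1 - e *+ (M'.+1 + M)).
      by rewrite mulrnDr opprD addrA addrK.
    elim: (M'.+1 + M)%N => [|N IH] nN; first by rewrite subr0 in nN.
    have [PN|] := pselect (P (m + e *+ M'.+1 - e *+ N)); last exact: IH.
    by exists N.
  exists (x.+1%:Z - M'.+1%:Z).
  have -> : m - e *~ (x.+1%:Z - M'.+1%:Z) = m + e *+ M'.+1 - e *+ x.+1.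
    by rewrite mulrzBr opprB -!pmulrn addrA.
  split=> //; set a := m + _; have -> : a - e *+ x.+1 = a - e *+ x - e.
    by rewrite [e *+ x.+1]mulrSr opprD addrA.
  by rewrite opprB; exact: emin.
have /choice[b bH] (i : 'I_n) : exists z : int, H (delta_mx 0 i - e *~ z).
  exact: coef.
pose be := \row_i b i; pose d m := \sum_i be 0 i * m 0 i.
have dH m : H (m - e *~ d m).
  have -> : m - e *~ d m = \sum_i (delta_mx 0 i - e *~ b i) *~ (m 0 i).
    rewrite (eq_bigr (fun i => m 0 i *: delta_mx 0 i - e *~ (be 0 i * m 0 i))).
      rewrite sumrB -row_sum_delta; congr (_ - _).
      exact: (big_morph (fun z : int => e *~ z) (mulrzDr e) (mulr0z e)).
    by move=> i _; rewrite mxE mulrzBl mulrzA -[delta_mx 0 i *~ _]scaler_int intz.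
  by elim/big_ind: _ => // i _; exact: HMz.
have Pez z : P (e *~ z) <-> 0 < z.
  case: z => [[|z]|z]; first by split; rewrite // mulr0z.
    by split=> // _; exact: PM.
  split=> // Pz; exfalso; apply: P0; have := PD Pz (PM z Pe).
  by rewrite NegzE mulrNz pmulrn addNr.
have Pd m : P m <-> 0 < d m.
  rewrite -Pez; split=> [Pm|Pm].
    by have := PH _ _ (HN _ (dH m)) Pm; rewrite opprB addrC subrK.
  by have := PH _ _ (dH m) Pm; rewrite addrC subrK.
exists be, e; split=> //.
have := dH e; rewrite -/(d e) -{1}[e]mulr1z -mulrzBr => -[h1 h2].
rewrite -mulrNz in h2; move: h1 h2; rewrite !Pez; lia.
Qed.

End HalfSpace.

(** By the Smith normal form, [b] is a multiple [c] of the first row of a unimodular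
    matrix, and [b . e = 1] makes [c] a unit. *)
Lemma unimodular_completion n (b e : 'rV[int]_n.+1) :
  \sum_i b 0 i * e 0 i = 1 -> exists2 B : 'M[int]_n.+1, B \in unitmx & row 0 B = b.
Proof.
move=> be1; have [L Lu [R Ru [d _ bE]]] := int_Smith_normal_form b.
pose c := L 0 0 * d`_0.
have bR : b = c *: row 0 R.
  rewrite bE; apply/rowP => j; rewrite !mxE (bigD1 0) //= big1 => [|i i0].
    rewrite !mxE big_ord1 !mxE /= addr0 mulr1n.
    by [].
  rewrite !mxE big_ord1 !mxE /= (_ : (0%N == i) = false) ?mulr0n ?mulr0 ?mul0r //.
  by apply/negbTE; rewrite eq_sym; move: i0; rewrite -val_eqE.
have cu : c \is a GRing.unit.
  apply/unitrP; exists (\sum_i row 0 R 0 i * e 0 i).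
  suff cE : c * (\sum_i row 0 R 0 i * e 0 i) = 1 by rewrite mulrC.
  by rewrite -be1 bR mulr_sumr; apply: eq_bigr => i _; rewrite !mxE mulrA.
exists (c *: R); first by rewrite unitmxZ.
by rewrite bR linearZ.
Qed.

(** * Existence of a top vector *)

Section TopVector.
Variables (K : numFieldType) (n : nat) (g : finLieAlgType K) (kappa : invForm g).
Variables c1 c2 : K.

Local Notation tau := (tau n kappa c1 c2).
Local Notation Zn := 'rV[int]_n.+1.
Local Notation rv := 'rV[K]_n.+1.

Variables (V : lieModule tau) (lam : rv).
Implicit Types (v w : V) (k l m p q s : Zn).
Local Notation wt m := (weight_space (lam + zvec K m)).
Hypotheses (n_gt0 : (0 < n)%N) (Virr : irreducible V) (Vnontriv : nontrivial V).
Hypothesis Vspan : forall v, v \in lspan (fun v => exists m, weight_space (lam + zvec K m) v).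
Hypothesis Vfin : forall m, exists N, dim_le (@weight_space K n g kappa c1 c2 V (lam + zvec K m)) N.
Hypothesis VGHW : GHW_module V.

Local Notation in_supp := (@in_supp K n g kappa c1 c2 V lam).
Local Notation positive := (@positive K n g kappa c1 c2 V).

Lemma GHW_positive q : (forall i, 0 < q 0 i) -> positive q.
Proof.
move=> q0; have [Lam [v [p [v0 _ _ vp]]]] := VGHW.
apply: (absorbs_positive Virr v0) => r.
exists (p + \sum_i `|r 0%R i|)%N => x xle a; apply: vp; last by exists a.
move=> i; rewrite mxE mulmxnE; have : (`|r 0%R i| <= \sum_i `|r 0%R i|)%N by rewrite (bigD1 i) //= leq_addr.
have qx : x%:Z <= q 0 i * x%:Z by rewrite ler_peMl //; have := q0 i; lia.
move=> rS; have xp : (p + `|r 0%R i| <= x)%N.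
  by apply: leq_trans xle; rewrite leq_add2l.
rewrite -mulr_natr natz; set y := r 0 i in xp *; move: (q 0 i * x%:Z) qx => z; lia.
Qed.

Lemma positive_half_space : exists b e : Zn, \sum_i b 0 i * e 0 i = 1 /\
  forall m, positive m <-> 0 < \sum_i b 0 i * m 0 i.
Proof.
pose q1 : Zn := const_mx 1; pose q2 : Zn := const_mx 1 + delta_mx 0 ord0.
have q1p : positive q1 by apply: GHW_positive => i; rewrite mxE.
have q2p : positive q2 by apply: GHW_positive => i; rewrite !mxE; lia.
have q12 k : k != 0 -> parallel q1 k -> ~ parallel q2 k.
  move=> /rV0Pn[i ki] k1 k2; have := k2 ord0 ord_max; have := k1 ord0 ord_max.
  have := k1 i ord0; rewrite !mxE /= -val_eqE /= -[n == 0%N]negbK -lt0n n_gt0 /= addr0 !mul1r mulrDl mul1r.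
  move/eqP: ki; move: (k 0 i) (k 0 ord0) (k 0 ord_max) => x y z x0 xy zy zzy; apply: x0; lia.
apply: (@half_space _ positive _ _ _ _ q1 q1p).
- exact: positiveD.
- by move=> p0; exact: (positive_neq0 Virr Vnontriv p0).
- by move=> k p kp pp; exact: (positive_compl n_gt0 Virr Vnontriv Vspan Vfin pp kp).
- by move=> p; exact: (positive_arch n_gt0 Virr Vnontriv Vspan Vfin q1p q2p q12).
Qed.

(** Take the highest point [m] of the support on a line in direction [e].  Beyond level
    1 above [m] there is nothing, since subtracting positive degrees stays in the
    support; so either [m] or a point of the support at level 1 is on top. *)
Lemma exists_top_vector : exists b e : Zn, \sum_i b 0 i * e 0 i = 1 /\
  exists m w, [/\ w != 0, wt m w & forall k, 0 < \sum_i b 0 i * k 0 i -> kills w k].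
Proof.
have [b [e [be bP]]] := positive_half_space; exists b, e; split=> //.
have ep : positive e by apply/bP; rewrite be.
have bD k l : \sum_i b 0 i * (k + l) 0 i = \sum_i b 0 i * k 0 i + \sum_i b 0 i * l 0 i.
  by rewrite -big_split; apply: eq_bigr => i _; rewrite mxE mulrDr.
have bN k : \sum_i b 0 i * (- k) 0 i = - \sum_i b 0 i * k 0 i.
  by rewrite -sumrN; apply: eq_bigr => i _; rewrite mxE mulrN.
have [s sS] := supp_nonempty Virr Vspan.
have [Y YS] := supp_bounded n_gt0 Virr Vnontriv Vfin s ep.
pose Q x := `[< in_supp (s + e *+ x) >].
have QY y : Q y -> (y <= Y)%N.
  move=> /asboolP yS; rewrite leqNgt; apply/negP => Yy.
  exact: YS (ltnW Yy) yS.
have Q0 : exists x, Q x by exists 0%N; apply/asboolP; rewrite addr0.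
case: (ex_maxnP Q0 QY) => X /asboolP XS Xmax.
pose m := s + e *+ X.
have mtop l : 1 < \sum_i b 0 i * l 0 i -> ~ in_supp (m + l).
  move=> l2 lS; have lep : positive (l - e) by apply/bP; rewrite bD bN be; lia.
  have := supp_opp n_gt0 Virr Vnontriv 1 lep lS.
  rewrite mulr1n -addrA subKr /m -addrA -mulrSr => eS.
  by have := Xmax X.+1 (asboolT eS); rewrite ltnn.
suff [m' [[w [w0 wm']] m'top]] : exists m', in_supp m' /\
    forall k, 0 < \sum_i b 0 i * k 0 i -> ~ in_supp (m' + k).
  exists m', w; split=> // k k0 a.
  by apply: (not_in_supp (m'top _ k0)); exact: weight_act_deg.
have [[l [lS l1]]|nl] := pselect (exists l, in_supp (m + l) /\ 0 < \sum_i b 0 i * l 0 i).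
  exists (m + l); split=> // k k0; rewrite -addrA; apply: mtop; rewrite bD; lia.
by exists m; split=> // k k0 kS; apply: nl; exists k.
Qed.

End TopVector.

(** * Modules over the enveloping algebra and induction *)

Section EnvelopingAction.
Variables (K : fieldType) (L : lieAlgType K) (V : lieModule L).
Implicit Types (v : V) (w : seq L) (f : tensor_alg L) (u : env_alg L).

Definition word_act w v : V := foldr (fun y x => act y x) v w.

Lemma word_act_cat w w' v : word_act (w ++ w') v = word_act w (word_act w' v).
Proof. by rewrite /word_act foldr_cat. Qed.

Lemma word_act_linear w : linear (word_act w).
Proof. by elim: w => [|y w IH] a x z //=; rewrite IH act_linr. Qed.

Definition tensor_act v f : V := flin (fun w (a : K^o) => (a : K) *: word_act w v) f.

Let inner v w : linear (fun a : K^o => (a : K) *: word_act w v).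
Proof. by move=> c a b; rewrite scalerDl scalerA. Qed.

Lemma tensor_act_linear v : linear (tensor_act v).
Proof. exact: flin_linear. Qed.

Lemma tensor_act_mono v w (a : K) : tensor_act v (mono w (a : K^o)) = a *: word_act w v.
Proof. by rewrite /tensor_act flin_mono. Qed.

Lemma tensor_act_word v w : tensor_act v (word w) = word_act w v.
Proof. by rewrite tensor_act_mono scale1r. Qed.

Lemma tensor_act_linr f : linear (tensor_act^~ f).
Proof.
move=> c v v'; apply: flin_param => // w a.
by rewrite word_act_linear scalerDr !scalerA mulrC.
Qed.

Lemma tensor_act_ker v f : f \in env_ideal L -> tensor_act v f = 0.
Proof.
move: f; apply: (lspan_ker (tensor_act_linear v)) => _ [w w' a x y|w w' x y];
  rewrite !(linB (tensor_act_linear v)) ?(tensor_act_linear v) !tensor_act_word.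
  by rewrite !word_act_cat /= -(word_act_linear w) act_linl subrr.
rewrite !word_act_cat /= -!(linB (word_act_linear w)) act_lie subrr.
exact: lin0 (word_act_linear w).
Qed.

Lemma tensor_act_mul v f f' :
  tensor_act v (word_mul f f') = tensor_act (tensor_act v f') f.
Proof.
elim/fs_ind: f => [|f h IH IH'|w a].
- by rewrite (lin0 (word_mul_linl _)) !(lin0 (tensor_act_linear _)).
- by rewrite (linD (word_mul_linl _)) !(linD (tensor_act_linear _)) IH IH'.
elim/fs_ind: f' => [|f h IH IH'|w' b].
- rewrite (lin0 (word_mul_linr _)) !(lin0 (tensor_act_linear _)).
  by rewrite (lin0 (tensor_act_linr _)).
- rewrite (linD (word_mul_linr _)) !(linD (tensor_act_linear _)) IH IH'.
  by rewrite (linD (tensor_act_linr _)).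
rewrite word_mul_mono !tensor_act_mono word_act_cat.
by rewrite (linZ (word_act_linear w)) scalerA.
Qed.

Definition env_act u v : V := qlift (tensor_act v) u.

Lemma env_act_proj f v : env_act (Defs.proj (env_ideal L) f) v = tensor_act v f.
Proof. exact: (qlift_proj (tensor_act_linear v) (@tensor_act_ker v)). Qed.

Lemma env_act_linl v : linear (env_act^~ v).
Proof. exact: (qlift_linear (tensor_act_linear v) (@tensor_act_ker v)). Qed.

Lemma env_act_linr u : linear (env_act u).
Proof. by move=> a v v'; exact: tensor_act_linr. Qed.

Lemma env_actM u u' v : env_act (u * u') v = env_act u (env_act u' v).
Proof.
by rewrite -[u]repK -[u']repK env_mulE !env_act_proj tensor_act_mul.
Qed.

Lemma env_act1 v : env_act 1 v = v.
Proof. by rewrite env_act_proj tensor_act_word. Qed.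

Lemma env_act_inj y v : env_act (env_inj y) v = act y v.
Proof. by rewrite env_act_proj tensor_act_word. Qed.

End EnvelopingAction.

Section InducedModule.
Variables (K : fieldType) (L : lieAlgType K) (S : subalgebra L).
Variable X : lieModule (sub_lie S).

Lemma induced_gen (P : induced X -> Prop) :
  P 0 -> (forall v w, P v -> P w -> P (v + w)) -> (forall x, P (tens 1 x)) ->
  (forall y v, P v -> P (act y v)) -> forall v, P v.
Proof.
move=> P0 PD P1 PA; apply: induced_ind => // u x; rewrite -[u]repK.
elim/fs_ind: (rep u) => [|f h IH IH'|w a].
- by rewrite (lin0 (proj_linear _)) (lin0 (tens_linl x)).
- by rewrite projD (linD (tens_linl x)); exact: PD.
have -> : mono w a = a *: word w :> tensor_alg L.
  apply: fs_ext => l; rewrite fsZE !monoE; case: ifP => _; rewrite ?scaler0 //.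
  by rewrite -[a *: _]/(a * 1) mulr1.
rewrite projZ (linZ (tens_linl x)) -(linZ (tens_linr _)).
elim: w => [|y w IH]; first exact: P1.
have -> : Defs.proj (env_ideal L) (word (y :: w)) = env_inj y * (Defs.proj (env_ideal L) (word w) : env_alg L).
  by rewrite env_mulE word_mul_word.
by rewrite -induced_act_tens; exact: PA.
Qed.

Variables (V : lieModule L) (h : X -> V).
Hypothesis hlin : linear h.
Hypothesis hact : forall (s : sub_lie S) x, h (act s x) = act (val s) (h x).

(** The universal property of induction. *)
Lemma induced_hom : exists q : induced X -> V,
  module_hom q /\ forall x, q (tens 1 x) = h x.
Proof.
pose F : fsfunc (env_alg L * X)%type K^o -> V :=
  flin (fun ux (a : K^o) => (a : K) *: env_act ux.1 (h ux.2)).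
have inner (ux : env_alg L * X) : linear (fun a : K^o => (a : K) *: env_act ux.1 (h ux.2)).
  by move=> c a b; rewrite scalerDl scalerA.
have Flin : linear F by exact: flin_linear.
have Fgen u x : F (pair_gen u x) = env_act u (h x).
  by rewrite /F flin_mono //= scale1r.
have Fker f : f \in lspan (@tensor_rel _ _ S X) -> F f = 0.
  move: f; apply: (lspan_ker Flin) => _ [a u u' x|a u x x'|u s x];
    rewrite (linB Flin) ?Flin !Fgen.
  - by rewrite (env_act_linl (h x)) subrr.
  - by rewrite hlin (env_act_linr u) subrr.
  - by rewrite env_actM env_act_inj hact subrr.
have Ft u x : qlift F (tens u x) = env_act u (h x).
  by rewrite /tens (qlift_proj Flin Fker) Fgen.
have qlin : linear (fun v : induced X => qlift F v) := qlift_linear Flin Fker.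
exists (fun v => qlift F v); split; last by move=> x; rewrite Ft env_act1.
split=> // y; apply: induced_ind => [|v w IH IH'|u x].
- by rewrite act0r (lin0 qlin) act0r.
- by rewrite actDr !(linD qlin) actDr IH IH'.
by rewrite /= induced_act_tens !Ft env_actM env_act_inj.
Qed.

End InducedModule.

(** * The submodule generated from above *)

Section LowerPart.
Variables (K : numFieldType) (V : lmodType K) (d : V -> V) (c : K).
Hypothesis dlin : linear d.

Definition lower : subspace V :=
  lspan (fun v => exists i : nat, d v = (c - i.+1%:R) *: v).

Fixpoint lower_prod (r : nat) (v : V) : V :=
  if r is r'.+1 then d (lower_prod r' v) - (c - r%:R) *: lower_prod r' v else v.

Let lower_prod_linear r : linear (lower_prod r).
Proof.
elim: r => [|r IH] a u v //=.
rewrite IH dlin scalerDr scalerBr !scalerA opprD addrACA.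
by rewrite [_ * a]mulrC.
Qed.

Let lower_prod_eigen r nu v : d v = nu *: v ->
  lower_prod r v = (\prod_(j < r) (nu - (c - j.+1%:R))) *: v.
Proof.
move=> dv; elim: r => [|r IH] /=; first by rewrite big_ord0 scale1r.
rewrite IH (linZ dlin) dv big_ord_recr /= !scalerA -scalerBl; congr (_ *: _).
by rewrite mulrBr [_ * (c - _)]mulrC.
Qed.

Let lower_prod_stable (N : subspace V) r v :
  (forall u, u \in N -> d u \in N) -> v \in N -> lower_prod r v \in N.
Proof. by move=> Nd vN; elim: r => [|r IH] //=; rewrite rpredB ?rpredZ ?Nd. Qed.

Let killed_closed :
  submod_closed [pred v : V | `[< exists r, lower_prod r v = 0 >]].
Proof.
have up r s v : lower_prod r v = 0 -> lower_prod (r + s) v = 0.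
  by move=> rv; elim: s => [|s IH]; rewrite ?addn0 // addnS /= IH (lin0 dlin) scaler0 subrr.
split=> [|a u v /asboolP[r ru] /asboolP[s sv]]; apply/asboolP; first by exists 0%N.
exists (r + s)%N; rewrite lower_prod_linear up // addnC up //.
by rewrite scaler0 addr0.
Qed.

(** A [d]-stable subspace contains the components of its vectors with respect to the
    eigenvalue [c]: project with the product of the [d - (c - i)]. *)
Lemma lower_sep (N : subspace V) y u : (forall v, v \in N -> d v \in N) ->
  d y = c *: y -> u \in lower -> y + u \in N -> y \in N.
Proof.
move=> Nd dy uL yuN.
have : u \in Subspace killed_closed.
  apply: (lspan_sub _ uL) => v [i dv]; apply/asboolP; exists i.+1.
  by rewrite (lower_prod_eigen _ dv) big_ord_recr /= subrr mulr0 scale0r.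
move=> /asboolP[r ru]; have := lower_prod_stable r Nd yuN.
rewrite (linD (lower_prod_linear r)) ru addr0 (lower_prod_eigen _ dy).
set f := \prod_(j < r) _ => fy; have f0 : f != 0.
  by apply/prodf_neq0 => j _; rewrite subKr pnatr_eq0.
by rewrite -[y](scalerK f0) rpredZ.
Qed.

End LowerPart.

(** The submodule generated by a [tau_0]-stable space [Y] that [tau_+] kills is spanned
    by the words of negative degrees applied to [Y], so it consists of [Y] and of
    [d_0]-eigenvectors of lower eigenvalues. *)
Section NegativePart.
Variables (K : numFieldType) (n : nat) (g : finLieAlgType K) (kappa : invForm g).
Variables c1 c2 : K.

Local Notation tau := (tau n kappa c1 c2).
Local Notation tm := (tmono kappa c1 c2).
Local Notation Zn := 'rV[int]_n.+1.
Variables (V : lieModule tau) (Y : subspace V) (c : K).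
Local Notation d0 := (@act _ _ V (td kappa c1 c2 (0 : Zn) ord0)).
Hypothesis Ypos : forall y (k : Zn), y \in Y -> 0 < k 0 ord0 -> kills y k.
Hypothesis Yzero : forall y (k : Zn) a, y \in Y -> k 0 ord0 = 0 -> act (tm k a) y \in Y.
Hypothesis Yeig : forall y, y \in Y -> d0 y = c *: y.

Inductive generated : V -> Prop :=
| generated_in y : y \in Y -> generated y
| generated_add u v : generated u -> generated v -> generated (u + v)
| generated_neg (k : Zn) a u : k 0 ord0 < 0 -> generated u -> generated (act (tm k a) u).

(** A factor of nonnegative degree is moved to the right through the word; the
    commutators that appear act on a shorter word. *)
Lemma generated_mono u : generated u -> forall k a, generated (act (tm k a) u).
Proof.
elim=> {u} [y yY|u v _ IHu _ IHv|l b u l0 uG IH] k a.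
- have [k0|k0|k0] := ltrgt0P (k 0 ord0).
  + by rewrite Ypos //; apply: generated_in; exact: rpred0.
  + by apply: generated_neg => //; exact: generated_in.
  + by apply: generated_in; exact: Yzero.
- by rewrite actDr; exact: generated_add.
by rewrite act_swap lie_mono; apply: generated_add => //; exact: generated_neg.
Qed.

Lemma generated_act u x : generated u -> generated (act x u).
Proof.
move=> uG; elim/tau_ind: x => [|x y IHx IHy|k a]; last exact: generated_mono.
  by rewrite act0l; apply: generated_in; exact: rpred0.
by rewrite actDl; exact: generated_add.
Qed.

Lemma eigen_act (k : Zn) a (v : V) (nu : K) : d0 v = nu *: v ->
  d0 (act (tm k a) v) = (nu + (k 0 ord0)%:~R) *: act (tm k a) v.
Proof. by move=> dv; rewrite act_swap dv lie_td0 actZr actZl -scalerDl. Qed.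

Lemma generated_split u : generated u ->
  exists y u', [/\ y \in Y, u' \in lower d0 c & u = y + u'].
Proof.
elim=> {u} [y yY|u v _ [y [u' [yY u'L ->]]] _ [z [v' [zY v'L ->]]]|k a u k0 _ [y [u' [yY u'L ->]]]].
- by exists y, 0; split; rewrite ?addr0 ?rpred0.
- by exists (y + z), (u' + v'); split; rewrite ?rpredD // addrACA.
exists 0, (act (tm k a) (y + u')); split; rewrite ?rpred0 ?add0r //.
have [x kx] : exists x : nat, k 0 ord0 = - x.+1%:Z.
  by exists (`|k 0%R ord0|.-1)%N; lia.
rewrite actDr rpredD //.
  apply: sub_lspan; exists x; rewrite (eigen_act _ _ (Yeig yY)) kx.
  by rewrite rmorphN /= pmulrn.
move: u' u'L; apply: (lspan_map (act_linr (tm k a))) => v [i dv].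
apply: sub_lspan; exists (i.+1 + x)%N; rewrite (eigen_act _ _ dv) kx.
by rewrite rmorphN /= -pmulrn -addrA -opprD -natrD addnS.
Qed.

End NegativePart.

(** * Simultaneous eigenvectors *)

Section Eigenspaces.
Variables (K : fieldType) (V : lmodType K) (I : Type) (J : choiceType).
Variables (D : I -> V -> V) (chi : J -> I -> K).
Hypothesis Dlin : forall i, linear (D i).
Hypothesis chi_inj : forall j k, (forall i, chi j i = chi k i) -> j = k.

Definition eigen j v : Prop := forall i, D i v = chi j i *: v.

(** Applying [D i - chi m i] removes the term of index [m] from a vanishing sum. *)
Lemma eigen_indep (r : seq J) (f : J -> V) : uniq r ->
  (forall j, j \in r -> eigen j (f j)) -> \sum_(j <- r) f j = 0 ->
  forall j, j \in r -> f j = 0.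
Proof.
elim: r f => // m r IH f /= /andP[mr ur] fE; rewrite big_cons => f0.
have fr j : j \in r -> f j = 0.
  move=> jr; have [i ij] : exists i, chi j i != chi m i.
    apply: contrapT => H; move/negP: mr; apply.
    suff <- : j = m by [].
    apply: chi_inj => i; apply/eqP; apply: contrapT => /negP ji; apply: H.
    by exists i.
  have : (chi j i - chi m i) *: f j = 0.
    apply: (IH (fun k => (chi k i - chi m i) *: f k)) jr => //.
      move=> k kr i'; rewrite (linZ (Dlin i')) fE ?in_cons ?kr ?orbT //.
      by rewrite !scalerA mulrC.
    have : D i (f m + \sum_(j <- r) f j) - chi m i *: (f m + \sum_(j <- r) f j) = 0.
      by rewrite f0 (lin0 (Dlin i)) scaler0 subrr.
    rewrite (linD (Dlin i)) fE ?mem_head // scalerDr opprD addrACA subrr add0r.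
    rewrite (big_morph _ (linD (Dlin i)) (lin0 (Dlin i))) scaler_sumr -sumrB => {2}<-.
    rewrite !big_seq; apply: eq_bigr => k kr.
    by rewrite fE ?in_cons ?kr ?orbT // scalerBl.
  by move/eqP; rewrite scaler_eq0 subr_eq0 (negPf ij) => /eqP.
move=> j; rewrite in_cons => /orP[/eqP->|]; last exact: fr.
by move: f0; rewrite big_seq big1 ?addr0.
Qed.

Let eigen_closed : submod_closed [pred v : V |
  `[< exists f : fsfunc J V, (forall j, eigen j (f j)) /\ v = flin (fun _ => id) f >]].
Proof.
have Fl : linear (flin (fun _ : J => id : V -> V)) by exact: flin_linear.
split=> [|a u v /asboolP[f [fE ->]] /asboolP[h [hE ->]]]; apply/asboolP.
  exists 0; rewrite (lin0 Fl); split=> // j i.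
  by rewrite fs0E (lin0 (Dlin i)) scaler0.
exists (a *: f + h); rewrite Fl; split=> // j i.
by rewrite fsDE fsZE Dlin fE hE scalerDr !scalerA mulrC.
Qed.

Let flin_supp (f : fsfunc J V) : flin (fun _ => id) f = \sum_(j <- supp f) f j.
Proof. by apply: flin_widen; rewrite ?fsubset_refl. Qed.

Hypothesis Dspan : forall v, v \in lspan (fun v => exists j, eigen j v).

Lemma eigen_decomp v : exists f : fsfunc J V,
  (forall j, eigen j (f j)) /\ v = \sum_(j <- supp f) f j.
Proof.
suff /asboolP[f [fE ->]] : v \in Subspace eigen_closed.
  by exists f; rewrite -flin_supp.
apply: (lspan_sub _ (Dspan v)) => u [j uj]; apply/asboolP; exists (mono j u).
split; last by rewrite flin_mono.
by move=> k i; rewrite monoE; case: ifP => [/eqP->//|_]; rewrite (lin0 (Dlin i)) scaler0.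
Qed.

Lemma eigen_direct_sum : is_direct_sum eigen.
Proof.
move=> v; have [f [fE vf]] := eigen_decomp v; exists f; split.
  by split=> //; rewrite vf -flin_supp.
move=> h [hE vh]; have dE : flin (fun _ : J => id) (f - h) = 0.
  have Fl : linear (flin (fun _ : J => id : V -> V)) by exact: flin_linear.
  by rewrite (linB Fl) flin_supp -vf vh subrr.
rewrite flin_supp in dE.
apply/eqP; rewrite -subr_eq0; apply/eqP/fs_ext => j; rewrite fs0E.
have [jd|/supp0 //] := boolP (j \in supp (f - h)).
apply: (eigen_indep (fset_uniq _) _ dE jd) => k _ i.
have -> : fs_fun (f - h) k = f k - h k by [].
by rewrite (linB (Dlin i)) fE hE scalerBr.
Qed.

End Eigenspaces.

Section SubVectors.
Variables (K : pzRingType) (V : lmodType K) (U : subspace V).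
Record sub_vec := SubVec { sub_vec_val :> V; _ : sub_vec_val \in U }.
HB.instance Definition _ := [isSub for sub_vec_val].
HB.instance Definition _ := [Choice of sub_vec by <:].
HB.instance Definition _ := [SubChoice_isSubLmodule of sub_vec by <:].
Lemma sub_vec_val_linear : linear (val : sub_vec -> V).
Proof. exact: linearP. Qed.
End SubVectors.

(** * The module of top vectors *)

Section KernelImage.
Variables (K : fieldType) (L : lieAlgType K) (V W : lieModule L) (f : V -> W).
Hypothesis fhom : module_hom f.

Lemma image_closed (N : subspace V) :
  submod_closed [pred w : W | `[< exists2 v, v \in N & w = f v >]].
Proof.
have [fl _] := fhom.
split=> [|a u v /asboolP[y yU ->] /asboolP[y' y'U ->]]; apply/asboolP.
  by exists 0; [exact: rpred0|rewrite (lin0 fl)].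
by exists (a *: y + y'); [rewrite rpredD ?rpredZ|rewrite fl].
Qed.

Definition image_space (N : subspace V) : subspace W := Subspace (image_closed N).

Lemma image_submodule (N : subspace V) : submodule N -> submodule (image_space N).
Proof.
move=> NS x _ /asboolP[m mN ->]; apply/asboolP; exists (act x m); first exact: NS.
by have [_ ->] := fhom.
Qed.

Definition kernel_space : subspace V :=
  Subspace (preim_closed (proj1 fhom) (Subspace (@zero_closed _ W))).

Lemma kernelP v : v \in kernel_space <-> f v = 0.
Proof. by split=> /eqP. Qed.

Lemma kernel_submodule : submodule kernel_space.
Proof. by move=> x v /kernelP v0; apply/kernelP; have [_ ->] := fhom; rewrite v0 act0r. Qed.

End KernelImage.

Section TopModule.
Variables (K : numFieldType) (n : nat) (g : finLieAlgType K) (kappa : invForm g).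
Variables c1 c2 : K.

Local Notation tau := (tau n kappa c1 c2).
Local Notation tau0 := (tau0 n kappa c1 c2).
Local Notation tm := (tmono kappa c1 c2).
Local Notation Zn := 'rV[int]_n.+1.
Local Notation td0' := (td kappa c1 c2 (0 : Zn) ord0).

Variables (V : lieModule tau) (c : K).
Implicit Types (v : V) (k l m : Zn).

(** Fixing the eigenvalue of [d_0] puts the rest of the module generated by this space
    into eigenspaces for lower eigenvalues. *)
Definition top_pred : {pred V} := [pred v : V |
  `[< act td0' v = c *: v /\ forall k, 0 < k 0 ord0 -> kills v k >]].

Lemma top_closed : submod_closed top_pred.
Proof.
split=> [|a u v /asboolP[ud uk] /asboolP[vd vk]]; apply/asboolP; split.
- by rewrite act0r scaler0.
- by move=> k _ a; rewrite act0r.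
- by rewrite actDr actZr ud vd scalerDr !scalerA mulrC.
by move=> k k0 b; rewrite actDr actZr uk // vk // scaler0 addr0.
Qed.

Definition top_space : subspace V := Subspace top_closed.

Lemma top_eig v : v \in top_space -> act td0' v = c *: v.
Proof. by move=> /asboolP[]. Qed.

Lemma top_pos v k : v \in top_space -> 0 < k 0 ord0 -> kills v k.
Proof. by move=> /asboolP[_ vk] k0 a; apply: vk. Qed.

Lemma top_zero v k a : v \in top_space -> k 0 ord0 = 0 ->
  act (tm k a) v \in top_space.
Proof.
move=> vT k0; apply/asboolP; split.
  by rewrite (eigen_act _ _ (top_eig vT)) k0 addr0.
by move=> l l0; apply: kills_act; apply: top_pos; rewrite // mxE k0 addr0.
Qed.

Lemma top_act_sub (y : tau) v : y \in sub0 n kappa c1 c2 -> v \in top_space ->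
  act y v \in top_space.
Proof.
move=> yS vT; move: y yS; apply: (lspan_map (act_linl v)) => _ [k /eqP k0 [a ->]].
exact: top_zero.
Qed.

Definition top_act (y : tau0) (x : sub_vec top_space) : sub_vec top_space :=
  SubVec (top_act_sub (valP y) (valP x)).

Fact top_act_linl x : linear (top_act^~ x).
Proof. by move=> a y z; apply: val_inj; rewrite [RHS]linearP; exact: act_linl. Qed.
Fact top_act_linr y : linear (top_act y).
Proof. by move=> a x z; apply: val_inj; rewrite [RHS]linearP; exact: act_linr. Qed.
Fact top_act_lie x y (v : sub_vec top_space) : top_act (lie x y) v =
  top_act x (top_act y v) - top_act y (top_act x v).
Proof. by apply: val_inj; rewrite [RHS]linearB; exact: act_lie. Qed.

Definition top_module : lieModule tau0 :=
  LieModule top_act_linl top_act_linr top_act_lie.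

Local Notation X := top_module.

Lemma top_valE (y : tau0) (x : X) : val (act y x) = act (val y) (val x).
Proof. by []. Qed.

Lemma top_trunc (y : tau) v : y \in sub_ge0 n kappa c1 c2 -> v \in top_space ->
  act (Defs.trunc y) v = act y v.
Proof.
move=> yS vT; apply/eqP; rewrite -subr_eq0; apply/eqP; move: y yS.
apply: lspan_ker => [a y z|_ [k k0 [a ->]]].
  by rewrite trunc_linear !act_linl scalerBr opprD addrACA.
rewrite trunc_mono; have [_|k0'] := boolP (deg0 k); first by rewrite subrr.
by rewrite act0l (top_pos vT) ?subrr // lt_def k0'.
Qed.

Hypothesis Virr : irreducible V.
Hypothesis topN0 : exists2 w : V, w != 0 & w \in top_space.

Let irr_generated (Y : subspace V) : (exists2 w, w != 0 & w \in Y) ->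
  {subset Y <= top_space} ->
  (forall y k a, y \in Y -> k 0 ord0 = 0 -> act (tm k a) y \in Y) ->
  forall v, exists y u, [/\ y \in Y, u \in lower (@act _ _ V td0') c & v = y + u].
Proof.
move=> [w w0 wY] YT Yzero v.
have Ypos y k : y \in Y -> 0 < k 0 ord0 -> kills y k by move=> /YT; exact: top_pos.
have Yeig y : y \in Y -> act td0' y = c *: y by move=> /YT; exact: top_eig.
have Gcl : submod_closed [pred v : V | `[< generated Y v >]].
  split=> [|a u u' /asboolP uG /asboolP u'G]; apply/asboolP.
    by apply: generated_in; exact: rpred0.
  apply: generated_add => //; elim: uG => {u} [y yY|u u'' _ IH _ IH'|k b u k0 _ IH].
  - by apply: generated_in; rewrite rpredZ.
  - by rewrite scalerDr; exact: generated_add.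
  - by rewrite -actZr; exact: generated_neg.
have Gsub : submodule (Subspace Gcl).
  by move=> x u /asboolP uG; apply/asboolP; exact: (generated_act Ypos Yzero).
have /asboolP vG : v \in Subspace Gcl.
  by apply: (irreducible_all Virr Gsub _ w0); apply/asboolP; exact: generated_in.
exact: (generated_split Yeig vG).
Qed.

Let zero_sub : subspace V := Subspace (@zero_closed _ V).

Let zero_sep y u : act td0' y = c *: y -> u \in lower (@act _ _ V td0') c ->
  y + u = 0 -> y = 0.
Proof.
move=> dy uL yu0; apply/eqP.
apply: (lower_sep (act_linr td0') (N := zero_sub) _ dy uL); last by rewrite yu0; exact: rpred0.
by move=> v /eqP->; rewrite act0r; exact: rpred0.
Qed.

(** A [tau_0]-submodule [U] generates [V], and the component of the highest
    [d_0]-eigenvalue of what it generates is [U] itself. *)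
Lemma top_irreducible : irreducible X.
Proof.
split.
  have [w w0 wT] := topN0; exists (SubVec wT : X).
  by apply: contraNneq w0 => /(congr1 val) /= wE; apply/eqP; exact: wE.
move=> U Usub; have [[x xU x0]|Uz] := pselect (exists2 x, x \in U & x != 0); last first.
  left=> x xU; apply/eqP; apply: contrapT => /negP x0; apply: Uz; by exists x.
right=> z.
have Ycl : submod_closed [pred v : V | `[< exists2 x, x \in U & v = val x >]].
  split=> [|a u v /asboolP[y yU ->] /asboolP[y' y'U ->]]; apply/asboolP.
    by exists 0; first exact: rpred0.
  by exists (a *: y + y'); first by rewrite rpredD ?rpredZ.
have [||y k a|y [u [/asboolP[x' x'U ->] uL zE]]] := @irr_generated (Subspace Ycl) _ _ _ (val z).
- exists (val x); last by apply/asboolP; exists x.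
  by apply: contraNneq x0 => x0; apply/eqP/val_inj; exact: x0.
- by move=> _ /asboolP[y _ ->]; exact: valP.
- move=> /asboolP[y' y'U ->] k0; apply/asboolP.
  have kS : tm k a \in sub0 n kappa c1 c2.
    by apply: sub_lspan; exists k; [exact/eqP|exists a].
  by exists (act (SubLie kS : tau0) y'); first exact: Usub.
suff : val x' - val z = 0 by move=> /eqP; rewrite subr_eq0 => /eqP/val_inj <-.
apply: (zero_sep _ uL); last by rewrite addrAC -zE subrr.
by rewrite actBr !(top_eig (valP _)) scalerBr.
Qed.

Local Notation M := (verma X).
Definition verma_top (x : X) : M := @tens _ _ _ (inflate X) 1 x.
Local Notation lift1 := verma_top.

Let verma_act (y : tau) (x : X) : y \in sub_ge0 n kappa c1 c2 ->
  exists x' : X, act y (lift1 x) = lift1 x' /\ val x' = act y (val x).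
Proof.
move=> yS; exists (act (Defs.trunc0 (SubLie yS : tau_ge0 n kappa c1 c2)) x); split.
  transitivity (@tens _ _ _ (inflate X) (env_inj y * 1) x).
    exact: induced_act_tens.
  rewrite mulr1 -[env_inj y]mul1r.
  exact: (@tens_bal _ _ _ (inflate X) 1 (SubLie yS)).
by rewrite top_valE /=; apply: top_trunc => //; exact: valP.
Qed.

Let ge0_mem k a : 0 <= k 0 ord0 -> tm k a \in sub_ge0 n kappa c1 c2.
Proof. by move=> k0; apply: sub_lspan; exists k => //; exists a. Qed.

Let lift1_linear : linear lift1. Proof. exact: (@tens_linr _ _ _ (inflate X) 1). Qed.

Let verma_split (v : M) : exists x u,
  u \in lower (@act _ _ M td0') c /\ v = lift1 x + u.
Proof.
have Ycl : submod_closed [pred v : M | `[< exists x, v = lift1 x >]].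
  split=> [|a u u' /asboolP[y ->] /asboolP[y' ->]]; apply/asboolP.
    by exists 0; rewrite (lin0 lift1_linear).
  by exists (a *: y + y'); rewrite lift1_linear.
have Ypos y k : y \in Subspace Ycl -> 0 < k 0 ord0 -> kills y k.
  move=> /asboolP[x ->] k0 a; have [x' [-> x'E]] := verma_act x (ge0_mem a (ltW k0)).
  rewrite (_ : x' = 0) ?(lin0 lift1_linear) //; apply: val_inj.
  by rewrite x'E linear0 (top_pos (valP x) k0).
have Yzero y k a : y \in Subspace Ycl -> k 0 ord0 = 0 -> act (tm k a) y \in Subspace Ycl.
  move=> /asboolP[x ->] k0; have k0' : 0 <= k 0 ord0 by rewrite k0.
  have [x' [-> _]] := verma_act x (ge0_mem a k0').
  by apply/asboolP; exists x'.
have Yeig y : y \in Subspace Ycl -> act td0' y = c *: y.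
  move=> /asboolP[x ->]; have z0 : 0 <= (0 : Zn) 0 ord0 by rewrite mxE.
  have [x' [-> x'E]] := verma_act x (ge0_mem (0, 0, delta_mx 0 ord0) z0).
  rewrite -(linZ lift1_linear); congr lift1; apply: val_inj.
  by rewrite x'E linearZ /= -[tmono _ _ _ _ _]/td0' (top_eig (valP x)).
have vG : generated (Subspace Ycl) v.
  move: v; apply: induced_gen => [|v w vG wG|x|y v vG].
  - by apply: generated_in; exact: rpred0.
  - exact: generated_add.
  - by apply: generated_in; apply/asboolP; exists x.
  - exact: (generated_act Ypos Yzero).
have [y [u [/asboolP[x ->] uL vE]]] := generated_split Yeig vG.
by exists x, u.
Qed.

(** The inclusion of the top space extends to a surjection [q] of the induced module
    onto [V].  The kernel of [q] contains the kernel of any irreducible quotient [q']: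
    otherwise [q] maps the kernel of [q'] onto [V], so this kernel contains a vector
    whose top component is nonzero, hence the whole top space, which generates.  By
    irreducibility of the target of [q'] the two kernels agree. *)
Lemma top_is_L : is_L X V.
Proof.
split=> //.
have [q [qhom qx]] : exists q : M -> V, module_hom q /\ forall x, q (lift1 x) = val x.
  apply: (@induced_hom _ _ _ (inflate X) V (fun x : X => val x)).
    exact: sub_vec_val_linear.
  move=> s x; rewrite /= top_trunc //; [exact: (valP s)|exact: (valP x)].
have [qlin qact] := qhom.
have qsurj v : exists u : M, q u = v.
  have fullcl : submod_closed [pred u : M | true] by split.
  have [w w0 wT] := topN0.
  have /asboolP[m _ ->] : v \in image_space qhom (Subspace fullcl).
    apply: (irreducible_all Virr _ _ w0); first exact: image_submodule.
    by apply/asboolP; exists (lift1 (SubVec wT)) => //; rewrite qx.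
  by exists m.
exists q; split=> // Q' q' [[z z0] Q'irr] q'hom q'surj.
have [q'lin q'act] := q'hom.
have ker12 (m : M) : q' m = 0 -> q m = 0.
  move=> q'm; apply/eqP; apply: contrapT => /negP qm.
  have [w w0 wT] := topN0.
  have /asboolP[u uK wE] : w \in image_space qhom (kernel_space q'hom).
    apply: (irreducible_all Virr _ _ qm).
      exact/image_submodule/kernel_submodule.
    by apply/asboolP; exists m => //; exact/kernelP.
  have [x1 [u' [u'L uE]]] := verma_split u.
  have qu'L : q u' \in lower (@act _ _ V td0') c.
    move: u' u'L {uE}; apply: (lspan_map qlin) => v [i dv]; apply: sub_lspan; exists i.
    by rewrite -qact dv (linZ qlin).
  have wx : val x1 - w = 0.
    apply: (zero_sep _ qu'L); last by rewrite addrAC -qx -(linD qlin) -uE wE subrr.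
    by rewrite actBr (top_eig (valP x1)) (top_eig wT) scalerBr.
  have z1 : act td0' (lift1 x1) = c *: lift1 x1.
    have z0' : 0 <= (0 : Zn) 0 ord0 by rewrite mxE.
    have [x' [xE x'E]] := verma_act x1 (ge0_mem (0, 0, delta_mx 0 ord0) z0').
    rewrite [LHS]xE -(linZ lift1_linear); congr lift1; apply: val_inj.
    by rewrite x'E linearZ /= -[tmono _ _ _ _ _]/td0' (top_eig (valP x1)).
  have x1K : lift1 x1 \in kernel_space q'hom.
    apply: (lower_sep (act_linr td0') _ z1 u'L); last by rewrite -uE.
    by move=> v; exact: kernel_submodule.
  have x10 : x1 != 0.
    apply: contraNneq w0 => x10; move/eqP: wx; rewrite subr_eq0 => /eqP <-.
    by rewrite x10 linear0.
  have liftK x : q' (lift1 x) = 0.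
    have Ucl := preim_closed lift1_linear (kernel_space q'hom).
    suff xU : x \in Subspace Ucl by exact/(kernelP q'hom (lift1 x)).
    apply: (@irreducible_all _ _ X (Subspace Ucl) x1 top_irreducible _ x1K x10) => s y.
    move=> /(kernelP q'hom (lift1 y)) y0; apply/(kernelP q'hom (lift1 (act s y))).
    have sS : val s \in sub_ge0 n kappa c1 c2.
      apply: (lspan_sub _ (valP s)) => _ [k /eqP k0 [a ->]]; apply: ge0_mem.
      by rewrite k0.
    have [y' [yE y'E]] := verma_act y sS.
    have -> : act s y = y' by apply: val_inj; rewrite y'E.
    by rewrite -yE q'act y0 act0r.
  have [u2 u2E] := q'surj z; move/eqP: z0; apply; rewrite -u2E; move: u2 {u2E}.
  apply: induced_gen => [|v v' v0 v'0|x|y v v0].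
  - exact: lin0 q'lin.
  - by rewrite (linD q'lin) v0 v'0 addr0.
  - exact: liftK.
  - by rewrite q'act v0 act0r.
have ker21 (m : M) : q m = 0 -> q' m = 0.
  move=> qm; have := Q'irr (image_space q'hom (kernel_space qhom)).
  case=> [|H|H]; first exact/image_submodule/kernel_submodule.
    by apply: H; apply/asboolP; exists m => //; exact/kernelP.
  have [w w0 wT] := topN0; case/eqP: w0; have [u <-] := qsurj w.
  have /asboolP[u' /kernelP u'0 u'E] := H (q' u).
  have : q (u - u') = 0 by apply: ker12; rewrite (linB q'lin) u'E subrr.
  by rewrite (linB qlin) u'0 subr0.
have /choice[r rE] := qsurj; have /choice[r' r'E] := q'surj.
have fq (m : M) : q' (r (q m)) = q' m.
  apply/eqP; rewrite -subr_eq0 -(linB q'lin); apply/eqP/ker21.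
  by rewrite (linB qlin) rE subrr.
have fq' (m : M) : q (r' (q' m)) = q m.
  apply/eqP; rewrite -subr_eq0 -(linB qlin); apply/eqP/ker12.
  by rewrite (linB q'lin) r'E subrr.
exists (fun v => q' (r v)); split.
- split=> [a u v|y v].
    by rewrite -{1}[u]rE -{1}[v]rE -qlin fq q'lin.
  by rewrite -{1}[v]rE -qact fq q'act.
- exists (fun z' => q (r' z')) => [v|z']; first by rewrite fq' rE.
  by rewrite fq r'E.
by apply/funext => m /=; rewrite fq.
Qed.

End TopModule.

(** * Cuspidality of the top *)

Section Cuspidality.
Variables (K : numFieldType) (n : nat) (g : finLieAlgType K) (kappa : invForm g).
Variables c1 c2 : K.

Local Notation tau := (tau n kappa c1 c2).
Local Notation tau0 := (tau0 n kappa c1 c2).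
Local Notation tm := (tmono kappa c1 c2).
Local Notation Zn := 'rV[int]_n.+1.
Local Notation rv := 'rV[K]_n.+1.
Local Notation td0' := (td kappa c1 c2 (0 : Zn) ord0).

Variables (V : lieModule tau) (lam : rv) (z0 : int).
Implicit Types (v : V) (k l m : Zn).
Hypotheses (n_gt0 : (0 < n)%N) (Virr : irreducible V) (Vnontriv : nontrivial V).
Hypothesis Vspan : forall v, v \in lspan (fun v => exists m, weight_space (lam + zvec K m) v).
Hypothesis Vfin : forall m, exists N, dim_le (@weight_space K n g kappa c1 c2 V (lam + zvec K m)) N.

Let c : K := lam 0 ord0 + z0%:~R.
Local Notation X := (top_module V c).

Definition row_cons (z : int) (m : 'rV[int]_n) : Zn :=
  \row_i (if unlift ord0 i is Some j then m 0 j else z).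

Let lamt : 'rV[K]_n := \row_j lam 0 (lift ord0 j).

Lemma top_weight (m : 'rV[int]_n) (x : X) : weight_space0 (lamt + map_mx intr m) x ->
  weight_space (lam + zvec K (row_cons z0 m)) (val x).
Proof.
move=> xm i; case: (unliftP ord0 i) => [j|] ->.
  rewrite !mxE liftK; have /(congr1 val) := xm j; rewrite !mxE => xE.
  by transitivity (val (act (td0 kappa c1 c2 j) x)); [|rewrite xE linearZ].
by rewrite (top_eig (valP x)) !mxE unlift_none.
Qed.

Lemma piece_basis : exists C (bs : 'I_C -> piece n g),
  forall a, exists d : 'I_C -> K, a = \sum_i d i *: bs i.
Proof.
pose b := vbasis (fullv : {vspace (g * rv * rv)%type}).
exists (\dim (fullv : {vspace (g * rv * rv)%type})), (fun i => b`_i) => a.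
by exists (fun i => coord b i a); exact: (coord_vbasis (memvf (a : (g * rv * rv)%type))).
Qed.

(** The conditions defining the top space are preserved by the weight decomposition. *)
Lemma top_components (f : fsfunc Zn V) (x : X) :
  (forall m, weight_space (lam + zvec K m) (f m)) ->
  val x = \sum_(m <- supp f) f m -> forall m, f m \in top_space V c.
Proof.
move=> fE xE m; have [mf|/supp0->] := boolP (m \in supp f); last exact: rpred0.
have wt_inj k l l' : (forall i : 'I_n.+1, (lam + zvec K (l + k)) 0 i =
    (lam + zvec K (l' + k)) 0 i) -> l = l'.
  move=> e; apply/(addIr k)/rowP => i; have := e i; rewrite !mxE.
  by move=> /addrI/intr_inj.
have indep k (h : Zn -> V) : (forall l, weight_space (lam + zvec K (l + k)) (h l)) ->
    \sum_(l <- supp f) h l = 0 -> h m = 0.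
  move=> hE h0; apply: (eigen_indep (fun i => act_linr (td kappa c1 c2 0 i))
    (@wt_inj k) (fset_uniq (supp f)) _ h0 mf) => l _; exact: hE.
apply/asboolP; split.
  suff /eqP : ((lam + zvec K m) 0 ord0 - c) *: f m = 0.
    by rewrite scalerBl subr_eq0 => /eqP <-; exact: fE.
  apply: (indep 0 (fun l => ((lam + zvec K l) 0 ord0 - c) *: f l)) => [l i|].
    by rewrite addr0 actZr fE !scalerA mulrC.
  transitivity (act td0' (val x) - c *: val x).
    2: by rewrite (top_eig (valP x)) subrr.
  rewrite xE act_sumr scaler_sumr -sumrB; apply: eq_bigr => l _.
  by rewrite scalerBl fE.
move=> k k0 a; apply: (indep k (fun l => act (tm k a) (f l))) => [l|].
  exact: weight_act_deg.
by rewrite -act_sumr -xE (top_pos (valP x) k0).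
Qed.

Let weight0_closed (m : 'rV[int]_n) : submod_closed [pred x : X |
  `[< weight_space0 (lamt + map_mx intr m) x >]].
Proof.
split=> [|a u v /asboolP u0 /asboolP v0]; apply/asboolP => i.
  by rewrite act0r scaler0.
by rewrite actDr actZr u0 v0 scalerDr !scalerA mulrC.
Qed.

(** Every weight space of the top space embeds, through the components of [tau] in one
    degree [(-1, r)], into a number of copies of the same weight space [V_s], where
    [r] depends on the weight but [s] does not: a vector killed by this degree and by
    [tau_+] is killed by an opposite of an absorbing degree. *)
Lemma top_cuspidal : cuspidal X.
Proof.
exists lamt; split.
  pose D (i : 'I_n) (x : X) := act (td0 kappa c1 c2 i) x.
  pose chi (m : 'rV[int]_n) i := (lamt + map_mx intr m) 0 i.
  suff ds : is_direct_sum (eigen D chi) by exact: ds.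
  apply: eigen_direct_sum.
  - by move=> i; exact: act_linr.
  - move=> l l' e; apply/rowP => i; have := e i; rewrite /chi !mxE.
    by move=> /addrI/intr_inj.
  move=> x.
  have [f [fE xE]] := eigen_decomp (fun i => act_linr (td kappa c1 c2 0 i)) Vspan (val x).
  have fT := top_components fE xE.
  have -> : x = \sum_(m <- supp f) (SubVec (fT m) : X).
    apply: val_inj; rewrite xE.
    rewrite (big_morph _ (linD (@sub_vec_val_linear _ _ (top_space V c)))
      (lin0 (@sub_vec_val_linear _ _ (top_space V c)))).
    exact: eq_bigr.
  apply: rpred_sum => m _; apply: sub_lspan.
  exists (\row_j m 0 (lift ord0 j)) => i; apply: val_inj.
  rewrite linearZ /= /chi !mxE; have := fE m (lift ord0 i); rewrite !mxE.
  by [].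
pose s := row_cons (z0 - 1) 0.
have [D sD] := Vfin s; have [C [bs bsP]] := piece_basis.
exists (C * D)%N => m.
have [t [tw tE]] : dim_le (fun x => x \in Subspace (weight0_closed m)) (C * D).
  apply: indep_dim_le => r t tm' it; have [w [wS wE]] := sD.
  pose k := s - row_cons z0 m.
  apply: (indep_le (T := fun j (x : X) => act (tm k (bs j)) (val x)) (w := w)
    (U := Subspace (weight0_closed m)) _ _ _ tm' it).
  - by move=> j a x y; rewrite -act_linr; congr act; exact: sub_vec_val_linear.
  - move=> j x /asboolP xm; apply: wE; have := weight_act_deg k (bs j) (top_weight xm).
    by rewrite {1}/k subrKC.
  move=> x _ xk; apply: val_inj; apply/eqP; apply: contrapT => /negP x0.
  have xT := valP x.
  have kE : (- k) 0 ord0 = 1 by rewrite /k /s opprB !mxE !unlift_none; lia.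
  have pk : positive V (- k).
    apply: (absorbs_positive Virr x0) => q; exists (`|q 0%R ord0|.+1)%N => y yq.
    by apply: (top_pos xT); rewrite mxE mulmxnE kE -mulr_natr natz mul1r; move: (q 0 ord0) yq => z yz; lia.
  apply: (not_kills_opp n_gt0 Virr Vnontriv pk x0) => a; rewrite opprK.
  have [d ->] := bsP a; have tl := tmono_linear kappa c1 c2 k.
  rewrite (big_morph _ (linD tl) (lin0 tl)) act_suml big1 // => j _.
  by rewrite (linZ tl) actZl xk scaler0.
exists t; split=> [i|x /asboolP /tE //]; by have /asboolP := tw i.
Qed.

End Cuspidality.

(** * Twisting *)

Section TwistTransport.
Variables (K : numFieldType) (n : nat) (g : finLieAlgType K) (kappa : invForm g).
Variables c1 c2 : K.

Local Notation tau := (tau n kappa c1 c2).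
Local Notation tm := (tmono kappa c1 c2).
Local Notation Zn := 'rV[int]_n.+1.
Local Notation rv := 'rV[K]_n.+1.

Lemma twistK (B : 'M[int]_n.+1) : B \in unitmx ->
  cancel (twist (invmx B) : tau -> tau) (twist B).
Proof.
move=> Bu; have tl := @twist_linear K n g kappa c1 c2.
elim/tau_ind => [|x y IHx IHy|k a].
- by rewrite !(lin0 (tl _)).
- by rewrite !(linD (tl _)) IHx IHy.
rewrite !twist_mono -mulmxA -trmx_mul mulmxV // trmx1 mulmx1; congr tmono.
case: a => [[x w] u] /=; rewrite -!mulmxA -trmx_mul /zmx -!map_mxM invmxK mulmxV //.
by rewrite !map_mx1 trmx1 !mulmx1.
Qed.

Variables (V : lieModule tau) (B : 'M[int]_n.+1) (Bu : B \in unitmx).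
Let Cu : invmx B \in unitmx. Proof. by rewrite unitmx_inv. Qed.

Local Notation V' := (twist_module Cu V).

Lemma twist_actE (y : tau) (v : V) : @act _ _ V' y v = act (twist (invmx B) y) v.
Proof. by []. Qed.

Lemma twist_actK (y : tau) (v : V) : @act _ _ V' (twist B y) v = act y v.
Proof.
rewrite twist_actE; have := twistK Cu y; rewrite invmxK => ->.
by [].
Qed.

Lemma twist_irreducible : irreducible V -> irreducible V'.
Proof.
move=> [V0 Virr]; split=> // U Usub; apply: (Virr U) => y v vU.
by rewrite -twist_actK; exact: Usub.
Qed.

Lemma twist_nontrivial : nontrivial V -> nontrivial V'.
Proof. by move=> [y [v yv]]; exists (twist B y), v; rewrite twist_actK. Qed.

Lemma twist_iso : module_iso V (twist_module Bu V').
Proof.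
exists id; split; last by exists id.
by split=> // y v; rewrite /= -[LHS]twist_actK.
Qed.

Lemma twist_weight mu (v : V) :
  weight_space mu v -> @weight_space _ _ _ _ _ _ V' (mu *m (zmx K B)^T) v.
Proof.
move=> vmu i; rewrite twist_actE twist_td mul0mx act_suml invmxK mxE scaler_suml.
by apply: eq_bigr => p _; rewrite actZl vmu scalerA !mxE mulrC.
Qed.

Lemma untwist_weight mu (v : V) :
  @weight_space _ _ _ _ _ _ V' mu v -> weight_space (mu *m (zmx K (invmx B))^T) v.
Proof.
move=> vmu i; rewrite -twist_actK twist_td mul0mx act_suml mxE scaler_suml.
by apply: eq_bigr => p _; rewrite actZl vmu scalerA !mxE mulrC.
Qed.

Variable lam : rv.
Local Notation lam' := (lam *m (zmx K B)^T).

Lemma twist_weight_deg m (v : V) : weight_space (lam + zvec K m) v ->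
  @weight_space _ _ _ _ _ _ V' (lam' + zvec K (m *m B^T)) v.
Proof. by move/twist_weight; rewrite mulmxDl zvec_twist. Qed.

Lemma untwist_weight_deg m (v : V) : @weight_space _ _ _ _ _ _ V' (lam' + zvec K m) v ->
  weight_space (lam + zvec K (m *m (invmx B)^T)) v.
Proof.
move/untwist_weight; rewrite mulmxDl zvec_twist -mulmxA -trmx_mul /zmx -map_mxM.
by rewrite mulVmx // map_mx1 trmx1 mulmx1.
Qed.

Lemma twist_span :
  (forall v : V, v \in lspan (fun v => exists m, weight_space (lam + zvec K m) v)) ->
  forall v : V', v \in lspan (fun v : V' => exists m, @weight_space _ _ _ _ _ _ V' (lam' + zvec K m) v).
Proof.
move=> Vspan v; apply: (lspan_sub _ (Vspan v)) => u [m um].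
by apply: sub_lspan; exists (m *m B^T); exact: twist_weight_deg.
Qed.

Lemma twist_fin :
  (forall m, exists N, dim_le (@weight_space _ _ _ _ _ _ V (lam + zvec K m)) N) ->
  forall m, exists N, dim_le (@weight_space _ _ _ _ _ _ V' (lam' + zvec K m)) N.
Proof.
move=> Vfin m; have [N [t [tw tE]]] := Vfin (m *m (invmx B)^T); exists N, t.
split=> [i|v /untwist_weight_deg/tE //].
have := twist_weight_deg (tw i); rewrite -mulmxA -trmx_mul mulmxV // trmx1 mulmx1.
by [].
Qed.

End TwistTransport.

Theorem theorem6p1 (R : realType) (n : nat) (hn : (1 <= n)%N)
    (g : finLieAlgType R[i]) (hg : simple_lie g) (kappa : invForm g)
    (c1 c2 : R[i]) (V : lieModule (tau n kappa c1 c2))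
    (Virr : irreducible V) (Vnontriv : nontrivial V)
    (VGHW : GHW_module V) (VHC : harish_chandra V) :
  exists (X : lieModule (tau0 n kappa c1 c2)) (L : lieModule (tau n kappa c1 c2))
    (B : 'M[int]_n.+1) (hB : B \in unitmx),
    [/\ irreducible X, cuspidal X, is_L X L & module_iso V (twist_module hB L)].
Proof.
have [lam [Vsum Vfin]] := VHC.
have Vspan (v : V) : v \in lspan (fun v : V => exists m, weight_space (lam + zvec R[i] m) v).
  have [f [[fE ->] _]] := Vsum v.
  rewrite -[X in X \in _]/(flin (fun _ => id) f).
  rewrite (@flin_widen _ _ _ _ (fun _ => id) _ f (supp f)) ?fsubset_refl //.
  by apply: rpred_sum => m _; apply: sub_lspan; exists m; exact: fE.
have [b [e [be [m [w [w0 wm wtop]]]]]] :=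
  exists_top_vector hn Virr Vnontriv Vspan Vfin VGHW.
(* Row 0 of [B] is [b], so that after twisting by the inverse of [B] the degrees with
   [b . k > 0] become those with [k_0 > 0]. *)
have [B Bu rB] := unimodular_completion be.
have Cu : invmx B \in unitmx by rewrite unitmx_inv.
pose V' := twist_module Cu V.
have V'irr : irreducible V' := twist_irreducible Bu Virr.
have V'nt : nontrivial V' := twist_nontrivial Bu Vnontriv.
have V'span := twist_span (Bu := Bu) Vspan.
have V'fin := twist_fin Bu Vfin.
pose lam' := lam *m (zmx R[i] B)^T; pose z0 := (m *m B^T) 0 ord0.
have wT : (w : V') \in top_space V' (lam' 0 ord0 + z0%:~R).
  apply/asboolP; split.
    rewrite (twist_weight_deg Bu wm ord0); congr (_ *: _); rewrite [LHS]mxE.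
    by congr (_ + _); rewrite [LHS]mxE.
  move=> k k0 a; rewrite -[LHS]/(@act _ _ V (twist (invmx B) (tmono kappa c1 c2 k a)) w).
  rewrite twist_mono; apply: wtop.
  have -> : \sum_i b 0 i * (k *m (invmx B)^T) 0 i = k 0 ord0 => //.
  transitivity ((k *m (invmx B)^T *m B^T) 0 ord0).
    by rewrite mxE; apply: eq_bigr => i _; rewrite -rB [row _ _ _ _]mxE [B^T _ _]mxE mulrC.
  by rewrite -mulmxA -trmx_mul mulmxV // trmx1 mulmx1.
exists (top_module V' (lam' 0 ord0 + z0%:~R)), V', B, Bu; split.
- by apply: top_irreducible => //; exists w.
- exact: top_cuspidal.
- by apply: top_is_L => //; exists w.
- exact: (@twist_iso _ n g kappa c1 c2 V B Bu).
Qed.
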